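(* Let $k,n\ge1$ be integers and let $G\subset\mathbb{R}^k$ be a bounded domain. Let $0<s<1$ and $1\le p,q,r\le+\infty$ be such that $$\frac1p+\frac sq\le\frac1r$$ with the agreement that $\frac1\infty:=0$. If $0<\theta<1$, $\varphi\in BV(\mathbb{R}^n)$ and $u\in W^{\theta,q}(G,\mathbb{R}^n)\cap V(\varphi,s,p)$, then for any $0<\beta<\theta s$ we have, for $p<+\infty$, $$[\varphi\circ u]_{\beta,r}\le c\,[u]_{\theta,q}^s\,(V_{\varphi,s,p}(u))^{\frac1p},$$ and for $p=+\infty$, $$[\varphi\circ u]_{\beta,r}\le c\,[u]_{\theta,q}^s\,V_{\varphi,s,\infty}(u),$$ where $c>0$ is a constant depending only on $k$, $n$, $s$, $p$, $q$, $r$, $\beta$ and $\theta$. This remains true for $\beta=\theta s$ if $r=+\infty$ or if $r<+\infty$ and $q=sr$.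
   Context: For $0<\delta<1$ and $1\le\ell<\infty$, $[u]_{\delta,\ell}:=\big(\int_G\int_G\frac{|u(x)-u(y)|^\ell}{|x-y|^{k+\delta\ell}}dx\,dy\big)^{1/\ell}$, and $W^{\delta,\ell}(G,\mathbb{R}^n)$ is the space of $u\in L^\ell(G,\mathbb{R}^n)$ with $\big(\int_G|u|^\ell dx+[u]^\ell_{\delta,\ell}\big)^{1/\ell}<\infty$. Moreover $[u]_{\delta,\infty}:=\sup_{x,y\in G,x\ne y}\frac{|u(y)-u(x)|}{|y-x|^\delta}$, and $W^{\delta,\infty}(G,\mathbb{R}^n)$ is the space of Borel functions $u:G\to\mathbb{R}^n$ with $\sup_G|u|+[u]_{\delta,\infty}<\infty$; for an $\mathcal{L}^k$-equivalence class, $[\cdot]_{\delta,\infty}$ refers to a suitable representative. Here $\mathcal{L}^k$ is Lebesgue measure, and $L^0(G,\mathbb{R}^n)$ is the space of $\mathcal{L}^k$-equivalence classes of measurable functions $G\to\mathbb{R}^n$, with $L^0(G)$ the real-valued case. $BV(\mathbb{R}^n)$ is the space of $\varphi\in L^1(\mathbb{R}^n)$ whose distributional gradient $D\varphi$ is an $\mathbb{R}^n$-valued Radon measure with finite total variation measure $\|D\varphi\|$. For $0<\alpha<n$, $U^\alpha\mu(x)=\int_{\mathbb{R}^n}|x-y|^{\alpha-n}\mu(dy)$. For $0<s<1$ and $1\le p<\infty$, $V_{\varphi,s,p}(u):=\int_G(U^{1-s}\|D\varphi\|(u(x)))^p\,dx$ for $u\in L^0(G,\mathbb{R}^n)$;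 $V_{\varphi,s,\infty}(u)$ is the $\mathcal{L}^k$-essential supremum over $x\in G$ of $U^{1-s}\|D\varphi\|(u(x))$; and $V(\varphi,s,p):=\{u\in L^0(G,\mathbb{R}^n):V_{\varphi,s,p}(u)<+\infty\}$. Composition: $\varphi\in L^1_{\mathrm{loc}}(\mathbb{R}^n)$ has approximate limit $\lambda_\varphi(x)\in\mathbb{R}$ at $x$ if $\lim_{r\to0}\frac{1}{|B(x,r)|}\int_{B(x,r)}|\varphi(z)-\lambda_\varphi(x)|dz=0$, where $B(x,r)$ is the open ball; $S_\varphi$ is the set of $x$ where no approximate limit exists. A Borel function $\widetilde\varphi:\mathbb{R}^n\to\mathbb{R}$ is a Lebesgue representative of $\varphi$ if $\widetilde\varphi(x)=\lambda_\varphi(x)$ for all $x\in\mathbb{R}^n\setminus S_\varphi$. If $u\in V(\varphi,s,1)$ (which contains $V(\varphi,s,p)$ for $p\geq 1$), then $\mathcal{L}^k(\{x\in G:u(x)\in S_\varphi\})=0$, and $\varphi\circ u\in L^0(G)$ is defined as the $\mathcal{L}^k$-equivalence class of $\widetilde\varphi\circ u$ for an arbitrary Lebesgue representative $\widetilde\varphi$ (independent of the choice).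
   Formalization: For β<θs the constant c may also depend on an upper bound for the diameter of G, since by dilating G no constant depending only on k, n, s, p, q, r, β, θ can work; for β=θs c depends only on the listed parameters. *)

(* Defs.v *)
From HB Require Import structures.
From mathcomp Require Import all_boot all_order all_algebra.
From mathcomp Require Import all_classical all_reals all_analysis.
From mathcomp Require Import measurable_realfun.
From mathcomp Require Import ring lra.

Set Implicit Arguments.
Unset Strict Implicit.
Unset Printing Implicit Defensive.

Import Order.TTheory GRing.Theory Num.Theory numFieldNormedType.Exports.
Local Open Scope classical_set_scope.
Local Open Scope ring_scope.

Definition rV_display : measure_display.
Proof. exact. Qed.

Section borel_rV.
Context {R : realType} {n : nat}.

Let rV_set0 : <<s @open 'rV[R]_n >> set0.
Proof. exact: sigma_algebra0. Qed.

Let rV_setC A : <<s @open 'rV[R]_n >> A -> <<s @open 'rV[R]_n >> (~` A).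
Proof. exact: sigma_algebraC. Qed.

Let rV_bigcup (F : (set 'rV[R]_n)^nat) :
  (forall i, <<s @open 'rV[R]_n >> (F i)) ->
  <<s @open 'rV[R]_n >> (\bigcup_i F i).
Proof. exact: sigma_algebra_bigcup. Qed.

HB.instance Definition _ := @isMeasurable.Build rV_display
  'rV[R]_n <<s @open 'rV[R]_n >> rV_set0 rV_setC rV_bigcup.

Lemma open_measurable_rV (A : set 'rV[R]_n) : open A -> measurable A.
Proof. by move=> oA; apply: sub_sigma_algebra. Qed.

Lemma measurable_coord i : measurable_fun setT (fun v : 'rV[R]_n => v ord0 i).
Proof.
apply: (measurability _ (RGenOpens.measurableE R)) => _ [_ [a [b ->]] <-].
rewrite setTI; apply: open_measurable_rV.
by apply: open_comp; [move=> x _; exact: coord_continuous|exact: interval_open].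
Qed.

Lemma measurable_fun_rV d (T : measurableType d) (f : T -> 'rV[R]_n) :
  (forall i, measurable_fun setT (fun x => f x ord0 i)) -> measurable_fun setT f.
Proof.
move=> mf; apply: (@measurability _ _ _ _ _ _ (@open 'rV[R]_n)) => //.
move=> _ [U oU <-]; rewrite setTI.
pose box (q : 'rV[rat]_n * rat) := [set v : 'rV[R]_n |
  forall i, ball (ratr (q.1 ord0 i) : R) (ratr q.2) (v ord0 i)].
have -> : f @^-1` U =
    \bigcup_q (if `[< box q `<=` U >] then f @^-1` (box q) else set0).
  apply/seteqP; split => [t Uft|t [q _]]; last first.
    by case: asboolP => // qU; exact: qU.
  have [e /= e0 eU] := (nbhs_ballP _ _).1 (open_nbhs_nbhs (conj oU Uft)).
  have e2 : 0 < e / 2 by rewrite divr_gt0.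
  have [e'] := rat_in_itvoo e2.
  rewrite in_itv/= => /andP[e'0 e'e].
  have /choice[q qP] : forall i, exists q : rat,
      ball (ratr q : R) (ratr e') (f t ord0 i).
    move=> i; have fq : f t ord0 i < f t ord0 i + ratr e' by rewrite ltrDl.
    have [q] := rat_in_itvoo fq.
    rewrite in_itv/= => /andP[q1 q2]; exists q.
    by rewrite -ball_normE /= ltr_norml; apply/andP; split; lra.
  exists (\row_i q i, e') => //.
  case: asboolP => [_ i|]; first by rewrite mxE.
  case=> v vq; apply: eU; split=> // i j; rewrite (ord1 i).
  move: (qP j) (vq j); rewrite /= mxE -!ball_normE /= !ltr_norml.
  by move=> /andP[? ?] /andP[? ?]; apply/andP; split; lra.
apply: countable_bigcupT_measurable => // q.
case: asboolP => // _; rewrite [X in measurable X](_ : _ =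
  \bigcap_(i in [set: 'I_n])
    ((fun x => f x ord0 i) @^-1` ball (ratr (q.1 ord0 i) : R) (ratr q.2))).
  apply: fin_bigcap_measurable => // i _.
  rewrite -[X in measurable X]setTI; apply: mf => //; exact: measurable_ball.
by apply/seteqP; split => [t h i _|t h i]; exact: h.
Qed.

End borel_rV.

Section lebesgue_rV_step.
Context {R : realType} {n : nat}.

Definition consrV (z : R * 'rV[R]_n) : 'rV[R]_n.+1 :=
  row_mx (const_mx z.1 : 'rV_1) z.2.

Let unconsrV (v : 'rV[R]_n.+1) : R * 'rV[R]_n :=
  (v ord0 ord0, @rsubmx R 1 1 n v).

Let consrVK : cancel consrV unconsrV.
Proof.
move=> [x v]; rewrite /unconsrV /consrV /= row_mxKr; congr (_, _).
by rewrite mxE; case: splitP => // j _; rewrite mxE.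
Qed.

Let unconsrVK : cancel unconsrV consrV.
Proof.
move=> v; rewrite /unconsrV /consrV /=.
have -> : const_mx (v ord0 ord0) = @lsubmx R 1 1 n v.
  by apply/rowP => i; rewrite !mxE (ord1 i); congr (v _ _); apply: val_inj.
exact: (@hsubmxK R 1 1 n v).
Qed.

Lemma measurable_consrV : measurable_fun setT consrV.
Proof.
apply: measurable_fun_rV => i; case: (@split_ordP 1 n i) => j ->.
  rewrite (_ : (fun z => _) = fst); first exact: measurable_fst.
  by apply/funext => z; rewrite /consrV (@row_mxEl R 1 1 n) mxE.
rewrite (_ : (fun z => _) = (fun v : 'rV[R]_n => v ord0 j) \o snd).
  exact: (measurableT_comp (measurable_coord j) measurable_snd).
by apply/funext => z; rewrite /consrV (@row_mxEr R 1 1 n).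
Qed.

Let measurable_unconsrV : measurable_fun setT unconsrV.
Proof.
apply: measurable_fun_pair; first exact: measurable_coord.
apply: measurable_fun_rV => i; under eq_fun do rewrite mxE.
exact: measurable_coord.
Qed.

Variable mu : {sigma_finite_measure set 'rV[R]_n -> \bar R}.

Definition lebesgue_rV_step : set 'rV[R]_n.+1 -> \bar R :=
  pushforward (lebesgue_measure \x mu)%E consrV.

Let step0 : lebesgue_rV_step set0 = 0%E.
Proof. by rewrite /lebesgue_rV_step /pushforward preimage_set0 measure0. Qed.

Let step_ge0 A : (0 <= lebesgue_rV_step A)%E.
Proof. by rewrite /lebesgue_rV_step /pushforward measure_ge0. Qed.

Let step_sigma_additive : semi_sigma_additive lebesgue_rV_step.
Proof.
move=> F mF tF _; rewrite /lebesgue_rV_step /pushforward preimage_bigcup.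
have mcF i : measurable (consrV @^-1` F i).
  by rewrite -[X in measurable X]setTI; exact: measurable_consrV.
apply: measure_semi_sigma_additive => //; last exact: bigcupT_measurable.
apply/trivIsetP => /= i j _ _ ij; rewrite -preimage_setI.
by move/trivIsetP : tF => /(_ _ _ _ _ ij) ->//; rewrite preimage_set0.
Qed.

HB.instance Definition _ := isMeasure.Build _ _ _ lebesgue_rV_step
  step0 step_ge0 step_sigma_additive.

Let step_sigma_finite : sigma_finite setT lebesgue_rV_step.
Proof.
have /sigma_finiteP[F [TF ndF Foo]] := sigma_finiteT (@lebesgue_measure R).
have /sigma_finiteP[G [TG ndG Goo]] := sigma_finiteT mu.
exists (fun i => unconsrV @^-1` (F i `*` G i)).
  rewrite -preimage_bigcup (_ : \bigcup_i _ = setT) ?preimage_setT//.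
  apply/seteqP; split => // -[x y] _.
  have [i _ Fi] : (\bigcup_i F i) x by rewrite -TF.
  have [j _ Gj] : (\bigcup_i G i) y by rewrite -TG.
  exists (maxn i j) => //; split => /=.
  - by move: x Fi; exact/subsetPset/ndF/leq_maxl.
  - by move: y Gj; exact/subsetPset/ndG/leq_maxr.
move=> i; have [mF Fi] := Foo i; have [mG Gi] := Goo i; split.
  rewrite -[X in measurable X]setTI; apply: measurable_unconsrV => //.
  exact: measurableX.
rewrite /lebesgue_rV_step /pushforward -comp_preimage.
rewrite [_ \o _](_ : _ = id) ?preimage_id; last first.
  by apply/funext => z /=; rewrite consrVK.
by rewrite product_measure1E// lte_mul_pinfty// ge0_fin_numE.
Qed.

HB.instance Definition _ := Measure_isSigmaFinite.Build _ _ _ lebesgue_rV_step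
  step_sigma_finite.

End lebesgue_rV_step.

(* Iterated product of the Lebesgue measure of R; see lebesgue_rV_consrV. *)
Fixpoint lebesgue_rV {R : realType} (n : nat) :
    {sigma_finite_measure set 'rV[R]_n -> \bar R} :=
  match n with
  | 0%N => dirac (0 : 'rV[R]_0)
  | m.+1 => lebesgue_rV_step (lebesgue_rV m)
  end.

Lemma lebesgue_rV_consrV (R : realType) n (A : set R) (B : set 'rV[R]_n) :
  measurable A -> measurable B ->
  lebesgue_rV n.+1 (consrV @` (A `*` B)) =
  (lebesgue_measure A * lebesgue_rV n B)%E.
Proof.
move=> mA mB; rewrite -[LHS]/((lebesgue_measure \x lebesgue_rV n)%E _).
rewrite -product_measure1E//; congr (_ _); apply/seteqP; split => [[x v]|z Az].
  move=> [[y w] /= [Ay Bw]]; rewrite /consrV.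
  move=> /(@eq_row_mx R 1 1 n)[/rowP/(_ ord0)].
  by rewrite !mxE /= => <- <-.
by exists z.
Qed.

Section euclidean_norm.
Context {R : realType} {n : nat}.
Implicit Types x y : 'rV[R]_n.

(* The library norm on 'rV[R]_n is the sup norm. *)
Definition enorm x : R := Num.sqrt (\sum_i (x ord0 i) ^+ 2).

Lemma enorm_ge0 x : 0 <= enorm x.
Proof. exact: sqrtr_ge0. Qed.

Lemma enorm0 : enorm 0 = 0.
Proof. by rewrite /enorm big1 ?sqrtr0// => i _; rewrite mxE expr0n. Qed.

Let sum_sqr_ge0 x : 0 <= \sum_i (x ord0 i) ^+ 2.
Proof. by apply: sumr_ge0 => i _; rewrite sqr_ge0. Qed.

Let cauchy_schwarz x y :
  (\sum_i x ord0 i * y ord0 i) ^+ 2 <=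
  (\sum_i (x ord0 i) ^+ 2) * (\sum_i (y ord0 i) ^+ 2).
Proof.
set C := \sum_i x ord0 i * y ord0 i.
set A := \sum_i (x ord0 i) ^+ 2; set B := \sum_i (y ord0 i) ^+ 2.
have := sum_sqr_ge0 y; rewrite -/B le_eqVlt => /predU1P[/esym B0|B0].
  have y0 i : y ord0 i = 0.
    have /eqP := B0; rewrite psumr_eq0 => [|j _]; last exact: sqr_ge0.
    by move=> /allP/(_ i (mem_index_enum _)); rewrite sqrf_eq0 => /eqP.
  rewrite B0 mulr0 /C big1 ?expr0n// => i _; by rewrite y0 mulr0.
have : 0 <= \sum_i (x ord0 i * B - y ord0 i * C) ^+ 2.
  by apply: sumr_ge0 => i _; rewrite sqr_ge0.
rewrite (eq_bigr (fun i => B ^+ 2 * (x ord0 i) ^+ 2 +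
    (C ^+ 2 * (y ord0 i) ^+ 2 + (- (2 * B * C)) * (x ord0 i * y ord0 i)))); last first.
  by move=> i _; ring.
rewrite 2!big_split/= -!mulr_sumr -/A -/B -/C.
rewrite (_ : _ + _ = B * (A * B - C ^+ 2)); last by ring.
by rewrite pmulr_rge0// subr_ge0.
Qed.

Lemma ler_enormD x y : enorm (x + y) <= enorm x + enorm y.
Proof.
rewrite -(@ler_pXn2r _ 2) ?nnegrE ?addr_ge0 ?enorm_ge0//.
rewrite sqrrD !sqr_sqrtr//.
rewrite (eq_bigr (fun i => (x ord0 i) ^+ 2 +
    (2 * (x ord0 i * y ord0 i) + (y ord0 i) ^+ 2))); last first.
  by move=> i _; rewrite mxE; ring.
rewrite 2!big_split/= -mulr_sumr addrA lerD2r lerD2l -[leRHS]mulr_natl ler_pM2l//.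
rewrite -sqrtrM//; apply: le_trans (ler_norm _) _.
by rewrite -sqrtr_sqr ler_wsqrtr.
Qed.

Lemma ler_enorm_sum I (s : seq I) (f : I -> 'rV[R]_n) :
  enorm (\sum_(i <- s) f i) <= \sum_(i <- s) enorm (f i).
Proof.
elim/big_ind2 : _ => [|x a y b xa yb|//]; first by rewrite enorm0.
by rewrite (le_trans (ler_enormD _ _))// lerD.
Qed.

Lemma cvg_enorm (u : nat -> 'rV[R]_n) x :
  (forall i, (fun k => u k ord0 i) @ \oo --> x ord0 i) ->
  (fun k => enorm (u k)) @ \oo --> enorm x.
Proof.
move=> ux; rewrite /enorm; apply: continuous_cvg; first exact: sqrt_continuous.
apply: cvg_big => [z|i _]; last by rewrite expr2; under eq_fun do rewrite expr2; apply: cvgM.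
exact: add_continuous.
Qed.

End euclidean_norm.

Section vector_charge.
Context d {T : measurableType d} {R : realType} {n : nat}.
Implicit Types (D : 'I_n -> {charge set T -> \bar R}) (A : set T).

Definition vector_charge D A : 'rV[R]_n := \row_i fine (D i A).

(* Families of disjoint measurable subsets of A, rather than partitions of A:
   same supremum when A is measurable, and nonnegative on every set. *)
Definition total_variation D A : \bar R :=
  ereal_sup [set z | exists m (F : 'I_m -> set T),
    [/\ forall j, measurable (F j), trivIset setT F, \bigcup_j F j `<=` A &
        z = (\sum_(j < m) enorm (vector_charge D (F j)))%:E]].

Variable D : 'I_n -> {charge set T -> \bar R}.
Local Notation tv := (total_variation D).

Let vector_charge0 : vector_charge D set0 = 0.
Proof. by apply/rowP => i; rewrite !mxE charge0. Qed.

Let le_tv A B : A `<=` B -> (tv A <= tv B)%E.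
Proof.
move=> AB; apply: ereal_sup_le => z [m [F [mF tF FA ->]]].
by exists m, F; split => //; exact: subset_trans AB.
Qed.

Let tv_ge0 A : (0 <= tv A)%E.
Proof.
apply: ereal_sup_ubound; exists 0%N, (fun=> set0); split.
- by case.
- by case.
- by move=> x [[]].
- by rewrite big_ord0.
Qed.

Let tv0 : tv set0 = 0%E.
Proof.
apply/eqP; rewrite eq_le tv_ge0 andbT; apply: ge_ereal_sup => z.
move=> [m [F [mF tF F0 ->]]]; rewrite big1// => j _.
rewrite (_ : F j = set0) ?vector_charge0 ?enorm0//.
by apply/seteqP; split => // x Fx; apply: F0; exists j.
Qed.

Let tv_superadditive A B : A `&` B = set0 -> (tv A + tv B <= tv (A `|` B))%E.
Proof.
move=> AB0.
have [->|U_neqy] := eqVneq (tv (A `|` B)) +oo%E; first by rewrite leey.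
have tvfin C : C `<=` A `|` B -> tv C \is a fin_num.
  move=> CU; rewrite ge0_fin_numE//; apply: le_lt_trans (le_tv CU) _.
  by rewrite ltey.
rewrite -leeBrDr; last exact/tvfin/subsetUr.
apply: ge_ereal_sup => _ [m1 [F1 [mF1 tF1 FA ->]]].
rewrite leeBrDr; last exact/tvfin/subsetUr.
rewrite addeC -leeBrDr//; apply: ge_ereal_sup => _ [m2 [F2 [mF2 tF2 FB ->]]].
rewrite leeBrDr// -EFinD addrC; apply: ereal_sup_ubound.
pose F (j : 'I_(m1 + m2)) := match fintype.split j with
  | inl i => F1 i | inr i => F2 i end.
have Fl i : F (lshift m2 i) = F1 i by rewrite /F (unsplitK (inl i)).
have Fr i : F (rshift m1 i) = F2 i by rewrite /F (unsplitK (inr i)).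
have F1A i x : F1 i x -> A x by move=> Fx; apply: FA; exists i.
have F2B i x : F2 i x -> B x by move=> Fx; apply: FB; exists i.
have AB x : A x -> B x -> False by move=> Ax Bx; rewrite -[False]/(set0 x) -AB0.
exists (m1 + m2)%N, F; split.
- by move=> j; case: (split_ordP j) => i ->; rewrite ?Fl ?Fr.
- move=> i j _ _; case: (split_ordP i) => i' ->; case: (split_ordP j) => j' ->;
    rewrite ?Fl ?Fr => -[x [Fx Gx]].
  + by rewrite (tF1 i' j')//; exists x.
  + by have := AB x (F1A _ _ Fx) (F2B _ _ Gx).
  + by have := AB x (F1A _ _ Gx) (F2B _ _ Fx).
  + by rewrite (tF2 i' j')//; exists x.
- move=> x [j _]; case: (split_ordP j) => i ->; rewrite ?Fl ?Fr => Fx.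
  + by left; exact: F1A Fx.
  + by right; exact: F2B Fx.
- rewrite big_split_ord/=; congr (_ + _)%:E; apply: eq_bigr => i _.
  + by rewrite Fl.
  + by rewrite Fr.
Qed.

Let enorm_series (E : set T) (A : (set T)^nat) : measurable E ->
  (forall k, measurable (A k)) -> trivIset setT A -> E `<=` \bigcup_k A k ->
  ((enorm (vector_charge D E))%:E <=
   \sum_(k <oo) (enorm (vector_charge D (E `&` A k)))%:E)%E.
Proof.
move=> mE mA tA EA.
have mEA k : measurable (E `&` A k) by exact: measurableI.
have tEA : trivIset setT (fun k => E `&` A k) by exact: trivIset_setIl.
have EEA : \bigcup_k (E `&` A k) = E by rewrite -setI_bigcupr; exact/setIidPl.
have cD : (fun N => enorm (\sum_(0 <= k < N) vector_charge D (E `&` A k))) @ \oo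
    --> enorm (vector_charge D E).
  apply: cvg_enorm => i; rewrite mxE.
  have : (fun N => \sum_(0 <= k < N) D i (E `&` A k))%E @ \oo
      --> (fine (D i E))%:E.
    rewrite fineK; last exact: fin_num_measure.
    rewrite -[in X in _ --> X]EEA.
    by apply: charge_semi_sigma_additive => //; rewrite EEA.
  move/fine_cvg; rewrite [X in X @ _](_ : _ =
    (fun N => (\sum_(0 <= k < N) vector_charge D (E `&` A k)) ord0 i))//.
  apply/funext => N /=; rewrite summxE -sum_fine; last by move=> k _; exact: fin_num_measure.
  by apply: eq_bigr => k _; rewrite mxE.
have {}cD : (fun N => (enorm (\sum_(0 <= k < N) vector_charge D (E `&` A k)))%:E)
    @ \oo --> (enorm (vector_charge D E))%:E by apply: cvg_EFin; [exact: nearW|exact: cD].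
rewrite -(cvg_lim _ cD)//; apply: lime_le; first by apply/cvg_ex; eexists; exact: cD.
apply: nearW => N; apply: (@le_trans _ _
  (\sum_(0 <= k < N) (enorm (vector_charge D (E `&` A k)))%:E)%E).
  by rewrite sumEFin lee_fin ler_enorm_sum.
by apply: nneseries_lim_ge => k _ _; rewrite lee_fin enorm_ge0.
Qed.

Let tv_semi_sigma_additive : semi_sigma_additive tv.
Proof.
move=> A mA tA mUA.
suff -> : tv (\bigcup_k A k) = (\sum_(k <oo) tv (A k))%E.
  by apply: is_cvg_nneseries => k _ _; exact: tv_ge0.
apply/eqP; rewrite eq_le; apply/andP; split.
  apply: ge_ereal_sup => _ [m [F [mF tF FA ->]]].
  rewrite -sumEFin.
  apply: (@le_trans _ _ (\sum_(j < m) \sum_(k <oo)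
      (enorm (vector_charge D (F j `&` A k)))%:E)%E).
    apply: lee_sum => j _; apply: enorm_series => //.
    by move=> x Fx; apply: FA; exists j.
  rewrite -nneseries_sum; last by move=> *; rewrite lee_fin enorm_ge0.
  apply: lee_nneseries => [k _ _|k _].
    by apply: sume_ge0 => j _; rewrite lee_fin enorm_ge0.
  apply: ereal_sup_ubound; exists m, (fun j => F j `&` A k); split => //.
  - by move=> j; exact: measurableI.
  - exact: trivIset_setIr.
  - by move=> x [j _ []].
  - by rewrite sumEFin.
apply: lime_le; first by apply: is_cvg_nneseries => k _ _; exact: tv_ge0.
apply: nearW => N.
apply: (@le_trans _ _ (tv (\big[setU/set0]_(0 <= k < N) A k))); last first.
  by apply: le_tv; rewrite big_mkord; exact: bigsetU_bigcup.
elim: N => [|N ih]; first by rewrite !big_geq// tv0.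
rewrite !big_nat_recr//=; apply: le_trans (tv_superadditive _).
  exact: leeD2r.
rewrite big_mkord; apply/seteqP; split => // x []; rewrite -bigcup_mkord.
by move=> [k /= kN Akx] ANx; move: kN; rewrite (tA k N)// ?ltnn//; exists x.
Qed.

HB.instance Definition _ := isMeasure.Build _ _ _ (total_variation D)
  tv0 tv_ge0 tv_semi_sigma_additive.

End vector_charge.

Section composition_definitions.
Context {R : realType}.

Definition bounded_domain {k : nat} (G : set 'rV[R]_k) : Prop :=
  [/\ G !=set0, open G, connected G & bounded_set G].

Section sobolev_slobodeckij.
Context {k : nat} {E : zmodType} (N : E -> R).
Implicit Types (G : set 'rV[R]_k) (u : 'rV[R]_k -> E) (delta l : R).

Definition gagliardo delta l G u : \bar R :=
  ((\int[lebesgue_rV k]_(x in G) \int[lebesgue_rV k]_(y in G)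
    (N (u x - u y) `^ l / enorm (x - y) `^ (k%:R + delta * l))%:E) `^ l^-1)%E.

Definition holder_quotient delta G u : \bar R :=
  ereal_sup [set z | exists x y, [/\ G x, G y, x != y &
    z = (N (u y - u x) / enorm (y - x) `^ delta)%:E]].

(* For l = +oo the seminorm of an almost-everywhere class is that of its
   Hoelder representative; on an open set that representative is unique and has
   the smallest quotient among all members of the class. *)
Definition seminorm delta (l : \bar R) G u : \bar R :=
  match l with
  | l'%:E => gagliardo delta l' G u
  | +oo => ereal_inf [set holder_quotient delta G v | v in
      [set v | {ae lebesgue_rV k, forall x, G x -> v x = u x}]]
  | -oo => 0
  end%E.

End sobolev_slobodeckij.

Definition sobolev {k n : nat} (delta : R) (l : \bar R) (G : set 'rV[R]_k)
    (u : 'rV[R]_k -> 'rV[R]_n) : Prop :=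
  measurable_fun G u /\
  match l with
  | l'%:E => ((\int[lebesgue_rV k]_(x in G) (enorm (u x) `^ l')%:E +
      gagliardo enorm delta l' G u `^ l') `^ l'^-1 < +oo)%E
  | +oo%E => exists v : 'rV[R]_k -> 'rV[R]_n,
      [/\ measurable_fun G v,
          {ae lebesgue_rV k, forall x, G x -> v x = u x} &
          (ereal_sup [set (enorm (v x))%:E | x in G] +
            holder_quotient enorm delta G v < +oo)%E]
  | -oo%E => False
  end.

Section bounded_variation.
Context {n : nat}.
Implicit Types phi psi : 'rV[R]_n -> R.

Definition partial (i : 'I_n) psi : 'rV[R]_n -> R :=
  fun x => 'D_(delta_mx ord0 i) psi x.

Fixpoint continuously_differentiable (m : nat) psi : Prop :=
  match m with
  | 0%N => continuous psi
  | m'.+1 => continuous psi /\ forall i : 'I_n,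
      (forall x, derivable psi x (delta_mx ord0 i)) /\
      continuously_differentiable m' (partial i psi)
  end.

Definition test_function psi : Prop :=
  (forall m, continuously_differentiable m psi) /\
  compact (closure [set x | psi x != 0]).

(* The value does not depend on the Hahn decomposition. *)
Definition charge_integral (nu : {charge set 'rV[R]_n -> \bar R})
    (f : 'rV[R]_n -> \bar R) : \bar R :=
  let: exist P hP := cid (Hahn_decomposition nu) in
  let: exist Q hPQ := cid hP in
  (\int[jordan_pos hPQ]_x f x - \int[jordan_neg hPQ]_x f x)%E.

Definition distributional_gradient phi
    (D : 'I_n -> {charge set 'rV[R]_n -> \bar R}) : Prop :=
  forall i psi, test_function psi ->
    (\int[lebesgue_rV n]_x (phi x * partial i psi x)%:E =
     - charge_integral (D i) (EFin \o psi))%E.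

Definition BV phi : Prop :=
  (lebesgue_rV n).-integrable setT (EFin \o phi) /\
  exists D, distributional_gradient phi D.

(* D phi; the zero measure is a junk value outside BV. *)
Definition gradient_measure phi : 'I_n -> {charge set 'rV[R]_n -> \bar R} :=
  if pselect (exists D, distributional_gradient phi D) is left h
  then sval (cid h) else fun=> czero.

(* At y = x the kernel is +oo, whereas powR would give 0: atoms of mu (which
   occur for n = 1) must contribute +oo. *)
Definition riesz_potential (alpha : R) (mu : {measure set 'rV[R]_n -> \bar R})
    (x : 'rV[R]_n) : \bar R :=
  (\int[mu]_y (if x == y then +oo
               else (enorm (x - y) `^ (alpha - n%:R))%:E))%E.

Definition gradient_potential phi (s : R) (x : 'rV[R]_n) : \bar R :=
  riesz_potential (1 - s) (total_variation (gradient_measure phi)) x.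

Definition V_energy {k : nat} phi (s : R) (p : \bar R) (G : set 'rV[R]_k)
    (u : 'rV[R]_k -> 'rV[R]_n) : \bar R :=
  match p with
  | p'%:E => \int[lebesgue_rV k]_(x in G) gradient_potential phi s (u x) `^ p'
  | +oo => ereal_inf [set a | {ae lebesgue_rV k,
             forall x, G x -> gradient_potential phi s (u x) <= a}]
  | -oo => 0
  end%E.

Definition V_space {k : nat} phi (s : R) (p : \bar R) (G : set 'rV[R]_k)
    (u : 'rV[R]_k -> 'rV[R]_n) : Prop :=
  measurable_fun G u /\ (V_energy phi s p G u < +oo)%E.

Definition euclidean_ball (x : 'rV[R]_n) (r : R) : set 'rV[R]_n :=
  [set z | enorm (z - x) < r].

Definition approximate_limit phi (x : 'rV[R]_n) (a : R) : Prop :=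
  ((lebesgue_rV n (euclidean_ball x r))^-1 *
    \int[lebesgue_rV n]_(z in euclidean_ball x r) `|phi z - a|%:E)%E
  @[r --> 0^'+] --> 0%E.

Definition lebesgue_representative phi (phit : 'rV[R]_n -> R) : Prop :=
  measurable_fun setT phit /\
  forall x a, approximate_limit phi x a -> phit x = a.

End bounded_variation.

(* Elements of L^0 are represented by Borel functions; phi \o u is the class of
   phit \o u for any Lebesgue representative phit of phi. *)
Definition composition_estimate (k n : nat) (s theta beta : R)
    (p q r : \bar R) (c : R) (G : set 'rV[R]_k) : Prop :=
  forall (phi : 'rV[R]_n -> R) (u : 'rV[R]_k -> 'rV[R]_n),
    BV phi -> sobolev theta q G u -> V_space phi s p G u ->
    forall phit : 'rV[R]_n -> R, lebesgue_representative phi phit ->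
    ((p < +oo)%E ->
      (seminorm Num.norm beta r G (phit \o u) <=
        c%:E * seminorm enorm theta q G u `^ s *
        V_energy phi s p G u `^ (fine p)^-1)%E) /\
    (p = +oo%E ->
      (seminorm Num.norm beta r G (phit \o u) <=
        c%:E * seminorm enorm theta q G u `^ s * V_energy phi s p G u)%E).

End composition_definitions.

Arguments composition_estimate {R} k n s theta beta p q r c G.

(* Main.v *)
(** The variation of phi on a cube is controlled by the total variation of its
    gradient: testing D phi against smooth approximations of the indicator of a
    box swept in a coordinate direction bounds the integral over the box of a
    difference phi(x + h e_i) - phi(x), hence by approximation the L^1 norm of
    that difference on any Borel set. Consequently some constant is
    at distance at most C r ||D phi||(Q') from phi in L^1(Q), where Q is a cube
    of radius r and Q' a dilate of it. If the potential U = U^(1-s) ||D phi|| is finite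
    at a, then ||D phi||(Q(a, r)) <= C r^(n-1+s) U(a), so the mean constants on
    the dyadic cubes around a converge geometrically; a is a Lebesgue point, and
    comparing the constants at a and b at the scale |a - b| gives the pointwise
    inequality |phi(a) - phi(b)| <= C |a - b|^s (U(a) + U(b)).

    Inserting a = u(x), b = u(y) leaves integrals over G x G: Hoelder's
    inequality separates the Gagliardo energy of u from
    (U(u(x)) + U(u(y)))^t |x - y|^(g-k) with g = (theta s - beta) t > 0, whose
    kernel is integrable on the bounded set G. When beta = theta s no kernel is
    left, and p = +oo; for r = +oo the estimate holds off a null set and
    McShane's extension provides the Hoelder representative. *)
Require Import Defs.
From HB Require Import structures.
From mathcomp Require Import all_boot all_order all_algebra.
From mathcomp Require Import all_classical all_reals all_analysis.
From mathcomp Require Import measurable_realfun.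
From mathcomp Require Import ring lra.
Import Order.TTheory GRing.Theory Num.Theory numFieldNormedType.Exports.
Local Open Scope classical_set_scope.
Local Open Scope ring_scope.
Set Implicit Arguments.
Unset Strict Implicit.
Unset Printing Implicit Defensive.

(** * Smooth functions on the line *)

(** No convolution enters: smoothness is carried by the test functions alone, which are products of
    one-variable functions, so that a partial derivative touches a single factor. In the swept
    direction this factor is a combination of four smooth ramps. The derivative of a ramp tends to
    the indicator of a half-line, so that of the factor tends to the indicator of an interval minus
    that of its translate by h. On boxes the absolute value stands outside the integral; moving it
    inside needs the set where phi(x + h e_i) - phi(x) has a given sign, and this set is only Borel.
    Cubes replace Euclidean balls wherever a volume or a product structure is used. The exponent s
    of the pointwise inequality comes from multiplying the Poincare factor r by the bound on ||D
    phi||(Q'): the result is r^s times the volume r^n. For q finite and s/q < 1/r, Hoelder's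
    inequality puts the weight A = s r / q on the energy of u, which leaves the exponent t with 1/t
    = 1/r - s/q for the potential; the hypothesis on p, q, r then says that t <= p. *)

Section smooth_functions.
Context {R : realType}.
Implicit Types f g : R -> R.

(** Continuity of the derivatives is not recorded: once all orders are available, it follows from
    derivability at the next order. *)
Fixpoint times_derivable (m : nat) f : Prop :=
  if m is m'.+1 then (forall x, derivable f x 1) /\ times_derivable m' (f^`()%classic)
  else True.

Definition smooth f := forall m, times_derivable m f.

Lemma times_derivableS m f g : (forall x : R, is_derive x (1 : R) f (g x)) ->
  times_derivable m g -> times_derivable m.+1 f.
Proof.
move=> fg mg; split=> [x|]; first by have [] := fg x.
rewrite (_ : (f^`()%classic) = g)//; apply/funext => x; rewrite derive1E.
exact: (@derive_val _ _ _ _ _ _ _ (fg x)).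
Qed.

Lemma times_derivableW m f : times_derivable m.+1 f -> times_derivable m f.
Proof.
elim: m f => // m ih f [df] Df; split=> //; exact: ih.
Qed.

Lemma times_derivable_is_derive m f : times_derivable m.+1 f ->
  forall x : R, is_derive x (1 : R) f (f^`()%classic x).
Proof. by move=> [df _] x; rewrite derive1E; exact: derivableP. Qed.

Lemma times_derivable_cst m (a : R) : times_derivable m (cst a).
Proof.
by elim: m a => // m ih a; exact: (@times_derivableS _ _ (cst 0)).
Qed.

Lemma times_derivableD m f g :
  times_derivable m f -> times_derivable m g -> times_derivable m (f \+ g).
Proof.
elim: m f g => // m ih f g Hf Hg.
apply: (@times_derivableS _ _ ((f^`()%classic) \+ (g^`()%classic))); last exact: ih Hf.2 Hg.2.
by move=> x; exact: (is_deriveD (times_derivable_is_derive Hf x)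
  (times_derivable_is_derive Hg x)).
Qed.

Lemma times_derivableM m f g :
  times_derivable m f -> times_derivable m g -> times_derivable m (f \* g).
Proof.
elim: m f g => // m ih f g Hf Hg.
apply: (@times_derivableS _ _ ((f \* (g^`()%classic)) \+ (g \* (f^`()%classic)))).
  move=> x; have := is_deriveM (times_derivable_is_derive Hf x)
    (times_derivable_is_derive Hg x).
  by rewrite /GRing.scale.
by apply: times_derivableD; apply: ih; [exact: times_derivableW|exact: Hg.2|
  exact: times_derivableW|exact: Hf.2].
Qed.

(** The derivative of 1/f is the product of -f' and two copies of 1/f, so the induction feeds the
    claim for 1/f at order m back into itself. *)
Lemma times_derivableV m f : (forall x, f x != 0) ->
  times_derivable m f -> times_derivable m (fun x => (f x)^-1).
Proof.
move=> f0; elim: m => // m ih Hf.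
apply: (@times_derivableS _ _
  (((fun x => (f x)^-1) \* (fun x => (f x)^-1)) \* (cst (-1) \* (f^`()%classic)))).
  move=> x; have := times_derivable_is_derive Hf x => dfx.
  apply: (is_derive_eq (is_deriveV (f0 x) dfx)).
  by rewrite /= /GRing.scale/= -exprVn; ring.
have H := ih (times_derivableW Hf).
apply: times_derivableM; first exact: times_derivableM.
by apply: times_derivableM; [exact: times_derivable_cst|exact: Hf.2].
Qed.

Lemma times_derivable_id m : times_derivable m (@id R).
Proof.
case: m => // m; apply: (@times_derivableS _ _ (cst 1)) => //.
exact: times_derivable_cst.
Qed.

Lemma times_derivable_affine m (c d : R) f : times_derivable m f ->
  times_derivable m (fun x => f (c * x + d)).
Proof.
elim: m f => // m ih f Hf.
apply: (@times_derivableS _ _ (cst c \* (fun x => (f^`()%classic) (c * x + d)))).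
  move=> x.
  have dg : is_derive x (1 : R) (fun x => c * x + d) c.
    apply: is_derive_eq; rewrite /GRing.scale/= ?mulr0 ?addr0 ?mulr1//.
  have df := times_derivable_is_derive Hf (c * x + d).
  have := @is_derive1_comp _ f (fun x => c * x + d) x _ _ df dg.
  by rewrite mulrC.
apply: times_derivableM; [exact: times_derivable_cst|exact: ih Hf.2].
Qed.

Lemma smoothD f g : smooth f -> smooth g -> smooth (f \+ g).
Proof. by move=> sf sg m; exact: times_derivableD. Qed.

Lemma smoothM f g : smooth f -> smooth g -> smooth (f \* g).
Proof. by move=> sf sg m; exact: times_derivableM. Qed.

Lemma smooth_derivable f : smooth f -> forall x, derivable f x 1.
Proof. by move=> /(_ 1%N) [df _]. Qed.

Lemma smooth_derive1 f : smooth f -> smooth (f^`()%classic).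
Proof. by move=> sf m; have [] := sf m.+1. Qed.

Lemma smooth_continuous f : smooth f -> continuous f.
Proof.
by move=> sf x; apply/differentiable_continuous/derivable1_diffP/smooth_derivable.
Qed.

(** The powers of 1/t make the family closed under differentiation, so that a single induction gives
    smoothness of all members at once. *)
Definition flat (j : nat) (t : R) : R :=
  if 0 < t then t^-1 ^+ j * expR (- t^-1) else 0.

Lemma flat_ge0 j t : 0 <= flat j t.
Proof.
by rewrite /flat; case: ifPn => // t0; rewrite mulr_ge0 ?expR_ge0// exprn_ge0// invr_ge0 ltW.
Qed.

Lemma flat_gt0 j t : 0 < t -> 0 < flat j t.
Proof. by move=> t0; rewrite /flat t0 mulr_gt0 ?expR_gt0// exprn_gt0// invr_gt0. Qed.

Lemma flat_le0 j t : t <= 0 -> flat j t = 0.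
Proof. by move=> t0; rewrite /flat ltNge t0. Qed.

(** One term of the exponential series, y^(j+2) / (j+2)! <= exp y at y = 1/t. The quadratic decay is
    what kills the difference quotient at 0. *)
Lemma flat_bound j t : flat j t <= (j.+2)`!%:R * t ^+ 2.
Proof.
rewrite /flat; case: ifPn => [t0|_]; last by rewrite mulr_ge0// sqr_ge0.
have y0 : 0 < t^-1 by rewrite invr_gt0.
have : t^-1 ^+ j.+2 / (j.+2)`!%:R <= expR (t^-1).
  by apply: le_trans (expR_ge1Dxn j.+1 (ltW y0)); rewrite ler_wpDl.
have e0 : 0 < expR (t^-1) by rewrite expR_gt0.
have fact_gt0R : 0 < (j.+2)`!%:R :> R by rewrite ltr0n fact_gt0.
rewrite expRN ler_pdivrMr// => h.
rewrite ler_pdivrMr// (_ : t^-1 ^+ j = t ^+ 2 * t^-1 ^+ j.+2).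
  by rewrite -[leRHS]mulrA [leRHS]mulrCA ler_wpM2l ?[_ * expR _]mulrC// exprn_ge0// ltW.
by rewrite -(addn2 j) exprD mulrCA -exprMn mulfV ?gt_eqF// expr1n mulr1.
Qed.

Lemma is_derive_flat j (t : R) : is_derive t (1 : R) (flat j) (flat j.+2 t - j%:R * flat j.+1 t).
Proof.
have [t0|t0|->] := ltgtP t 0.
- rewrite !flat_le0 ?(ltW t0)// mulr0 subr0.
  apply: (near_eq_is_derive _ (is_derive_cst 0 t 1)).
  near=> x; rewrite flat_le0//; apply: ltW; near: x.
  exact: lt_nbhsl.
- have tn0 : t != 0 by rewrite lt0r_neq0.
  have dV : is_derive t (1 : R) (fun t => t^-1) (- t ^- 2).
    by apply: (is_derive_eq (is_deriveV tn0 (is_derive_id _ _))); rewrite /GRing.scale/= mulr1.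
  have dX : is_derive t (1 : R) (fun t => t^-1 ^+ j) (j%:R * t^-1 ^+ j.-1 * (- t ^- 2)).
    have := is_deriveX j dV; rewrite exprfctE => dX; apply: (is_derive_eq dX).
    by rewrite /GRing.scale/=; ring.
  have dN : is_derive t (1 : R) (fun t => - t^-1) (t ^- 2).
    by apply: (is_derive_eq (is_deriveN dV)); rewrite opprK.
  have dE : is_derive t (1 : R) (fun t => expR (- t^-1)) (expR (- t^-1) * t ^- 2).
    exact: (@is_derive1_comp _ expR (fun x => - x^-1) t _ _ (is_derive_expR _) dN).
  apply: (near_eq_is_derive _ (is_derive_eq (is_deriveM dX dE) _)).
    near=> x; rewrite /flat ifT//; near: x; exact: lt_nbhsr.
  rewrite /flat t0 /GRing.scale/= -exprVn.
  case: j {dX} => [|j] /=; first by rewrite !mul0r !mulr0 subr0 addr0 expr0; ring.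
  by rewrite !exprS; ring.
- rewrite !flat_le0// mulr0 subr0.
  have C0 : 0 < (j.+2)`!%:R :> R by rewrite ltr0n fact_gt0.
  have cv : (fun h => h^-1 *: (flat j (h *: 1 + 0) - flat j 0)) @ 0^' --> (0:R).
    apply/cvgrPdist_lt => e e0; near=> h.
    rewrite sub0r normrN (@flat_le0 j 0)// subr0 addr0 /GRing.scale/= mulr1.
    have h0 : h != 0 by near: h; exact: nbhs_dnbhs_neq.
    rewrite normrM normfV (ger0_norm (flat_ge0 _ _)).
    rewrite ltr_pdivrMl ?normr_gt0//.
    apply: le_lt_trans (flat_bound _ _) _.
    rewrite -[h ^+ 2]real_normK ?num_real// expr2 mulrA mulrC ltr_pM2l ?normr_gt0//.
    rewrite -ltr_pdivlMl//; near: h.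
    apply: cvg_within; apply: (@nbhs0_lt _ R^o).
    by rewrite mulr_gt0// invr_gt0.
  apply: DeriveDef; first by apply/cvg_ex; exists 0.
  by apply/cvg_lim => //.
Unshelve. all: by end_near. Qed.

Lemma smooth_flat j : smooth (flat j).
Proof.
move=> m; elim: m j => // m ih j.
apply: (@times_derivableS _ _ (flat j.+2 \+ (cst (- j%:R) \* flat j.+1))).
  by move=> x; rewrite /= mulNr; exact: is_derive_flat.
by apply: times_derivableD => //; apply: times_derivableM => //;
  exact: times_derivable_cst.
Qed.

(** The denominator is positive because t and 1 - t are never both nonpositive. *)
Definition smooth_step (t : R) : R := flat 0 t / (flat 0 t + flat 0 (1 - t)).

Let step_den t : 0 < flat 0 t + flat 0 (1 - t).
Proof.
have [t0|t0] := leP t 0.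
  by rewrite ltr_wpDl ?flat_ge0// flat_gt0//; lra.
by rewrite ltr_pwDl ?flat_gt0 ?flat_ge0.
Qed.

Lemma smooth_smooth_step : smooth smooth_step.
Proof.
move=> m; apply: times_derivableM; first exact: smooth_flat.
apply: times_derivableV => [x|]; first by rewrite gt_eqF ?step_den.
apply: times_derivableD; first exact: smooth_flat.
rewrite (_ : (fun _ => _) = (fun x => flat 0 ((-1) * x + 1))); last first.
  by apply/funext => x; congr flat; ring.
by apply: times_derivable_affine; exact: smooth_flat.
Qed.

Lemma smooth_step_ge0 t : 0 <= smooth_step t.
Proof. by rewrite divr_ge0 ?flat_ge0// ltW. Qed.

Lemma smooth_step_le1 t : smooth_step t <= 1.
Proof. by rewrite ler_pdivrMr// mul1r lerDl flat_ge0. Qed.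

Lemma smooth_step_eq0 t : t <= 0 -> smooth_step t = 0.
Proof. by move=> t0; rewrite /smooth_step flat_le0// mul0r. Qed.

Lemma smooth_step_eq1 t : 1 <= t -> smooth_step t = 1.
Proof.
move=> t1; rewrite /smooth_step [flat 0 (1 - t)]flat_le0 ?subr_le0// addr0 divff//.
by rewrite gt_eqF// flat_gt0//; lra.
Qed.

(** A smooth substitute for max(t, 0), exact outside ]0, 1[. Being a product it needs no
    antiderivative; in exchange its derivative is only known to be bounded on the transition
    interval. *)
Definition smooth_ramp : R -> R := id \* smooth_step.

Lemma smooth_smooth_ramp : smooth smooth_ramp.
Proof.
by apply: smoothM; [move=> m; exact: times_derivable_id|exact: smooth_smooth_step].
Qed.

Lemma smooth_ramp_le0 t : t <= 0 -> smooth_ramp t = 0.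
Proof. by move=> t0; rewrite /smooth_ramp/= smooth_step_eq0// mulr0. Qed.

Lemma smooth_ramp_ge1 t : 1 <= t -> smooth_ramp t = t.
Proof. by move=> t0; rewrite /smooth_ramp/= smooth_step_eq1// mulr1. Qed.

Lemma derive_smooth_ramp_le0 t : t <= 0 -> (smooth_ramp^`()%classic) t = 0.
Proof.
have lt0 x : x < 0 -> (smooth_ramp^`()%classic) x = 0.
  move=> x0; rewrite derive1E -(@derive_cst _ R^o R^o 0 x 1).
  apply: near_eq_derive; near=> y; rewrite smooth_ramp_le0//.
  by apply/ltW; near: y; exact: lt_nbhsl.
rewrite le_eqVlt => /predU1P[->|]; last exact: lt0.
(* At 0 the ramp agrees with the zero function on one side only, so the value of its continuous
   derivative is read off as a left limit. *)
have c : (smooth_ramp^`()%classic) @ 0^'- --> (smooth_ramp^`()%classic) 0.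
  by apply: cvg_at_left_filter; exact: (smooth_continuous (smooth_derive1 smooth_smooth_ramp)).
rewrite -(cvg_lim _ c)//; apply: lim_near_cst => //.
by near=> x; rewrite lt0.
Unshelve. all: by end_near. Qed.

Lemma derive_smooth_ramp_ge1 t : 1 <= t -> (smooth_ramp^`()%classic) t = 1.
Proof.
have gt1 x : 1 < x -> (smooth_ramp^`()%classic) x = 1.
  move=> x0; rewrite derive1E -[RHS](@derive_id R R^o x 1).
  apply: near_eq_derive; near=> y; rewrite smooth_ramp_ge1//.
  by apply/ltW; near: y; exact: lt_nbhsr.
rewrite le_eqVlt => /predU1P[<-|]; last exact: gt1.
have c : (smooth_ramp^`()%classic) @ 1^'+ --> (smooth_ramp^`()%classic) 1.
  by apply: cvg_at_right_filter; exact: (smooth_continuous (smooth_derive1 smooth_smooth_ramp)).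
rewrite -(cvg_lim _ c)//; apply: lim_near_cst => //.
by near=> x; rewrite gt1.
Unshelve. all: by end_near. Qed.

Lemma derive_smooth_ramp_bounded : exists K, forall t, `|(smooth_ramp^`()%classic) t| <= K.
Proof.
have cont : {within `[0, 1], continuous (fun t => `|(smooth_ramp^`()%classic) t|)}.
  apply: continuous_subspaceT => x; apply: continuous_comp; last exact: norm_continuous.
  exact: (smooth_continuous (smooth_derive1 smooth_smooth_ramp)).
have [c _ Hc] := EVT_max ler01 cont.
exists (`|(smooth_ramp^`()%classic) c| + 1) => t.
have [t0|t0] := leP t 0; first by rewrite derive_smooth_ramp_le0// normr0 addr_ge0.
have [t1|t1] := leP 1 t; first by rewrite derive_smooth_ramp_ge1// normr1 lerDr.
apply: (@le_trans _ _ `|(smooth_ramp^`()%classic) c|); last by rewrite lerDl.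
by apply: Hc; rewrite in_itv/= !ltW.
Qed.

End smooth_functions.

(** * Tensor products of one-variable functions as test functions *)

Section tensor_products.
Context {R : realType} {n : nat}.
Implicit Types (rho : 'I_n -> R -> R) (x : 'rV[R]_n).

Definition tensor rho x : R := \prod_j rho j (x ord0 j).

Definition tensor_set rho (i : 'I_n) (f : R -> R) : 'I_n -> R -> R :=
  fun j => if j == i then f else rho j.

Lemma tensor_setE rho i f x :
  tensor (tensor_set rho i f) x = f (x ord0 i) * \prod_(j | j != i) rho j (x ord0 j).
Proof.
rewrite /tensor (bigD1 i)//= /tensor_set eqxx; congr (_ * _).
by apply: eq_bigr => j /negPf ->.
Qed.

Lemma tensorE rho i x :
  tensor rho x = rho i (x ord0 i) * \prod_(j | j != i) rho j (x ord0 j).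
Proof. by rewrite /tensor (bigD1 i). Qed.

Lemma is_derive_tensor rho i x : derivable (rho i) (x ord0 i) 1 ->
  is_derive x (delta_mx ord0 i) (tensor rho)
    (tensor (tensor_set rho i ((rho i)^`()%classic)) x).
Proof.
move=> dr; pose c := \prod_(j | j != i) rho j (x ord0 j).
have E : (fun h : R => h^-1 *: (tensor rho (h *: delta_mx ord0 i + x) - tensor rho x)) =
    (fun h : R => c *: (h^-1 *: (rho i (h *: (1 : R) + x ord0 i) - rho i (x ord0 i)))).
  apply/funext => h; rewrite !(tensorE _ i) -/c.
  rewrite [in LHS](_ : \prod_(j | j != i) _ = c); last first.
    by apply: eq_bigr => j ji; rewrite !mxE (negPf ji) eqxx/= mulr0 add0r.
  by rewrite !mxE !eqxx /= mulr1 /GRing.scale/= mulr1 -mulrBl; ring.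
have cv : (fun h : R => h^-1 *: (tensor rho (h *: delta_mx ord0 i + x) - tensor rho x))
    @ 0^' --> tensor (tensor_set rho i ((rho i)^`()%classic)) x.
  rewrite E tensor_setE mulrC derive1E; apply: cvgMl_tmp; exact: dr.
by apply: DeriveDef; [apply/cvg_ex; eexists; exact: cv|exact: cvg_lim cv].
Qed.

Lemma continuous_tensor rho : (forall i, continuous (rho i)) ->
  continuous (tensor rho).
Proof.
move=> cr x; rewrite /tensor; apply: (@cvg_big _ _ _ _ _ _ _ (nbhs x)) => [z|i _].
  exact: mul_continuous.
apply: (@continuous_comp _ _ _ (fun x : 'rV[R]_n => x ord0 i) (rho i)).
  exact: coord_continuous.
exact: cr.
Qed.

Lemma continuously_differentiable_tensor m rho : (forall i, smooth (rho i)) ->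
  continuously_differentiable m (tensor rho).
Proof.
elim: m rho => [|m ih] rho sr.
  by apply: continuous_tensor => i; exact: smooth_continuous.
split=> [|i]; first by apply: continuous_tensor => i; exact: smooth_continuous.
have dt x := is_derive_tensor (@smooth_derivable _ _ (sr i) (x ord0 i)).
split=> [x|]; first by case: (dt x).
rewrite (_ : partial i (tensor rho) =
  tensor (tensor_set rho i ((rho i)^`()%classic))); last first.
  by apply/funext => x; exact: (@derive_val _ _ _ _ _ _ _ (dt x)).
apply: ih => j; rewrite /tensor_set; case: eqVneq => // _; exact: smooth_derive1.
Qed.

(** One vanishing factor kills the product, so the support lies in the compact cube of half-side
    [M]. *)
Lemma test_function_tensor rho : (forall i, smooth (rho i)) ->
  (exists M, forall i t, M < `|t| -> rho i t = 0) ->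
  test_function (tensor rho).
Proof.
move=> sr [M HM]; split=> [m|]; first exact: continuously_differentiable_tensor.
have cK := @rV_compact R n (fun=> `[- M, M]%classic) (fun=> @segment_compact _ _ _).
apply: (subclosed_compact _ cK); first exact: closed_closure.
have clK : closed [set v : 'rV[R]_n | forall i : 'I_n, `[- M, M]%classic (v ord0 i)].
  by apply: compact_closed => //; exact: norm_hausdorff.
rewrite closureE => v; apply; split => // w /= rw i.
rewrite in_itv/= -ler_norml leNgt; apply/negP => /HM r0.
by move: rw; rewrite (tensorE _ i) r0 mul0r eqxx.
Qed.

Lemma partial_tensor rho i x : derivable (rho i) (x ord0 i) 1 ->
  partial i (tensor rho) x = tensor (tensor_set rho i ((rho i)^`()%classic)) x.
Proof. by move=> dr; have [_] := is_derive_tensor dr. Qed.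

End tensor_products.

(** * The gradient measure *)

Local Notation tvar := Defs.total_variation.

Lemma coord_le_enorm {R : realType} {n : nat} (v : 'rV[R]_n) i : `|v ord0 i| <= enorm v.
Proof.
rewrite /enorm -sqrtr_sqr ler_wsqrtr// (bigD1 i)//= lerDl.
by apply: sumr_ge0 => j _; rewrite sqr_ge0.
Qed.

Lemma enorm_le_sum {R : realType} {n : nat} (v : 'rV[R]_n) : enorm v <= \sum_i `|v ord0 i|.
Proof.
rewrite {1}(row_sum_delta v); apply: le_trans (ler_enorm_sum _ _) _.
apply: ler_sum => i _; rewrite /enorm (bigD1 i)//= big1 => [|j ji].
  by rewrite !mxE !eqxx/= mulr1 addr0 sqrtr_sqr.
by rewrite !mxE eqxx (negPf ji)/= mulr0 expr0n.
Qed.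

Section charges.
Context d {T : measurableType d} {R : realType}.

(* The positive and negative parts are taken on a Hahn decomposition, so their
   sum on A is |nu (A `&` P)| + |nu (A `&` N)|. *)
Lemma charge_variation_dominates {n : nat} (D : 'I_n -> {charge set T -> \bar R})
    (i : 'I_n) P N (PN : hahn_decomposition (D i) P N) (A : set T) :
  measurable A -> (charge_variation PN A <= tvar D A)%E.
Proof.
move=> mA; have [[mP posP] [mN negN] PNT PN0] := PN.
pose F (j : 'I_2) := if j == ord0 then A `&` P else A `&` N.
have mF j : measurable (F j).
  by rewrite /F; case: ifP => _; exact: measurableI.
apply: (@le_trans _ _ (\sum_(j < 2) enorm (vector_charge D (F j)))%:E); last first.
  apply: ereal_sup_ubound; exists 2%N, F; split=> //.
  - move=> a b _ _ [x [Fa Fb]]; apply/eqP/negPn/negP => ab.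
    suff : (P `&` N) x by rewrite PN0.
    move: Fa Fb; rewrite /F.
    have [a0|a0] := eqVneq a ord0; have [b0|b0] := eqVneq b ord0 => /=.
    + by rewrite a0 b0 eqxx in ab.
    + by move=> [_ ?] [_ ?].
    + by move=> [_ ?] [_ ?].
    + move: ab => /eqP[]; apply: val_inj; move: a0 b0; clear.
      by case: a b => -[|[|//]] ? [[|[|//]]].
  - by move=> x [j _]; rewrite /F; case: ifP => _ [].
rewrite 2!big_ord_recl big_ord0 addr0 /F/= EFinD.
rewrite /charge_variation jordan_posE jordan_negE cjordan_posE cjordan_negE.
rewrite /crestr0 mem_set// /crestr.
have fin_nu B : measurable B -> D i B \is a fin_num by exact: fin_num_measure.
apply: leeD.
  rewrite -(fineK (fin_nu _ (measurableI _ _ mA mP))) lee_fin.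
  by rewrite (le_trans (ler_norm _))// (le_trans _ (coord_le_enorm _ i))// mxE.
rewrite -(fineK (fin_nu _ (measurableI _ _ mA mN))) lee_fin.
by rewrite (le_trans (ler_norm _))// (le_trans _ (coord_le_enorm _ i))// mxE normrN.
Qed.

(** The Euclidean norm is at most the sum of the coordinates, and on a disjoint family each
    coordinate sums to at most the variation of one finite charge. *)
Lemma tvar_fin {n : nat} (D : 'I_n -> {charge set T -> \bar R}) :
  fin_num_fun (tvar D).
Proof.
have /choice[P HP] i := Hahn_decomposition (D i).
have /choice[N HN] i := HP i.
have V_fin i : charge_variation (HN i) setT \is a fin_num by exact: fin_num_measure.
move=> A mA; rewrite ge0_fin_numE ?measure_ge0//.
apply: (@le_lt_trans _ _ (\sum_(i < n) charge_variation (HN i) setT)%E); last first.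
  by rewrite -ge0_fin_numE ?sume_ge0//; apply/sum_fin_numP => i _ _.
apply: ge_ereal_sup => _ [m [F [mF tF FA ->]]].
apply: (@le_trans _ _ (\sum_(j < m) \sum_(i < n) charge_variation (HN i) (F j))%E).
  rewrite -sumEFin; apply: lee_sum => j _.
  apply: (@le_trans _ _ (\sum_(i < n) `|D i (F j)|)%E).
    apply: (@le_trans _ _ (\sum_(i < n) `|fine (D i (F j))|)%:E).
      rewrite lee_fin; apply: le_trans (enorm_le_sum _) _.
      by apply: ler_sum => i _; rewrite mxE.
    rewrite -sumEFin; apply: lee_sum => i _.
    by rewrite -[in leRHS](@fineK _ (D i (F j))) ?fin_num_measure.
  by apply: lee_sum => i _; exact: abse_charge_variation.
rewrite exchange_big/=; apply: lee_sum => i _.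
have -> : (\sum_(j < m) charge_variation (HN i) (F j) =
    charge_variation (HN i) (\big[setU/set0]_(j < m) F j))%E.
  by rewrite measure_semi_additive_ord//; exact: bigsetU_measurable.
by apply: le_measure => //; rewrite inE//; exact: bigsetU_measurable.
Qed.

End charges.

Section finite_tvar.
Context d {T : measurableType d} {R : realType} {n : nat}.
Variable D : 'I_n -> {charge set T -> \bar R}.

HB.instance Definition _ := @Measure_isFinite.Build _ _ _ (tvar D) (tvar_fin D).

End finite_tvar.

Section finite_charge_variation.
Context d {T : measurableType d} {R : realType}.
Variables (nu : {charge set T -> \bar R}) (P N : set T).
Variable PN : hahn_decomposition nu P N.

Let charge_variation_fin : fin_num_fun (charge_variation PN).
Proof. by move=> A mA; rewrite fin_numD !fin_num_measure. Qed.

HB.instance Definition _ := @Measure_isFinite.Build _ _ _ (charge_variation PN)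
  charge_variation_fin.

End finite_charge_variation.

Section gradient.
Context {R : realType} {n : nat}.
Implicit Types (phi psi : 'rV[R]_n -> R).

(** The Hahn decomposition is quantified existentially because [charge_integral] is computed on one
    that was chosen abstractly. *)
Lemma charge_integral_le (nu : {charge set 'rV[R]_n -> \bar R}) :
  exists P N (PN : hahn_decomposition nu P N), forall f : 'rV[R]_n -> \bar R,
    measurable_fun setT f ->
    (`|charge_integral nu f| <= \int[charge_variation PN]_x `|f x|)%E.
Proof.
rewrite /charge_integral; case: cid => P hP; case: cid => N PN.
exists P, N, PN => f mf.
apply: le_trans (lee_abs_sub _ _) _.
rewrite (_ : charge_variation PN = measure_add (jordan_pos PN) (jordan_neg PN)).
  rewrite ge0_integral_measure_add//; last exact: measurableT_comp.
  by apply: leeD; exact: le_abse_integral.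
by apply/funext => A; rewrite /charge_variation/= measure_addE.
Qed.

(** This trades the vector measure for positive finite measures, the variations of its components.
    The estimates on boxes and cubes use D phi only through these two properties. *)
Lemma BV_gradient_bound phi : BV phi -> exists m : 'I_n -> {finite_measure set 'rV[R]_n -> \bar R},
  (forall i A, measurable A -> (m i A <= tvar (gradient_measure phi) A)%E) /\
  forall i psi, test_function psi -> measurable_fun setT psi ->
    (`|\int[lebesgue_rV n]_x (phi x * partial i psi x)%:E| <=
     \int[m i]_x `|psi x|%:E)%E.
Proof.
move=> [_ [D0 hD0]]; rewrite /gradient_measure; case: pselect => [h|]; last by case; exists D0.
case: cid => D /= hD.
have /choice[P HP] i := charge_integral_le (D i).
have /choice[N HN] i := HP i.
pose PN i := sval (cid (HN i)).
have HPN i := svalP (cid (HN i)).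
exists (fun i => charge_variation (PN i) : {finite_measure set 'rV[R]_n -> \bar R}).
split=> [i A|i psi tpsi mpsi]; first exact: charge_variation_dominates.
rewrite hD// abseN; apply: HPN.
exact/measurable_EFinP.
Qed.

End gradient.

(** * Lebesgue measure on row vectors *)

Section lebesgue_rV_theory.
Context {R : realType}.

Lemma lebesgue_measure_shift (z : R) (A : set R) : measurable A ->
  lebesgue_measure ((fun x => x + z) @^-1` A) = lebesgue_measure A.
Proof.
move=> mA.
have mz : measurable_fun setT ((fun x => x + z) : R -> measurableTypeR R).
  by apply: measurable_funD => //; exact: measurable_cst.
rewrite -[LHS]/(pushforward (@lebesgue_measure R)
  ((fun x => x + z) : R -> measurableTypeR R) A).
apply/esym/lebesgue_measure_unique => // _ [[a b]] _ <-.
rewrite [RHS](_ : _ = lebesgue_measure ((fun x => x + z) @^-1` `]a, b]%classic))//.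
rewrite (_ : _ @^-1` _ = `]a - z, b - z]%classic).
  rewrite !lebesgue_measure_itv/= !lte_fin ltrD2r; case: ifP => // _.
  by rewrite -!EFinB; congr EFin; ring.
by apply/seteqP; split => x /=; rewrite !in_itv/= ltrBlDr lerBrDr.
Qed.

(** The open ball of the sup norm, of side 2 r: as a product of intervals it has an explicit
    volume. *)
Definition cube {n} (a : 'rV[R]_n) (r : R) : set 'rV[R]_n :=
  [set x | forall j, `|x ord0 j - a ord0 j| < r].

Lemma measurable_addrV {d} {T : measurableType d} {n} (f g : T -> 'rV[R]_n) :
  measurable_fun setT f -> measurable_fun setT g ->
  measurable_fun setT (fun x => f x + g x).
Proof.
move=> mf mg; apply: measurable_fun_rV => i; under eq_fun do rewrite mxE.
by apply: measurable_funD; exact: (measurableT_comp (measurable_coord i)).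
Qed.

Lemma measurable_opprV {d} {T : measurableType d} {n} (f : T -> 'rV[R]_n) :
  measurable_fun setT f -> measurable_fun setT (fun x => - f x).
Proof.
move=> mf; apply: measurable_fun_rV => i; under eq_fun do rewrite mxE.
by apply: measurableT_comp => //; exact: (measurableT_comp (measurable_coord i)).
Qed.

Lemma measurable_enorm {n} : measurable_fun setT (@enorm R n).
Proof.
rewrite /enorm; apply: (measurableT_comp (@continuous_measurable_fun _ _ (@sqrt_continuous R))).
by apply: measurable_sum => i; apply: measurable_funX; exact: measurable_coord.
Qed.

Lemma measurable_addr_cst {n} (z : 'rV[R]_n) : measurable_fun setT (fun x : 'rV[R]_n => x + z).
Proof. by apply: measurable_addrV => //; exact: measurable_id. Qed.

Lemma consrV_rsubmx n (v : 'rV[R]_n.+1) :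
  consrV (v ord0 ord0, @rsubmx R 1 1 n v) = v.
Proof.
rewrite /consrV/= (_ : const_mx (v ord0 ord0) = @lsubmx R 1 1 n v).
  exact: (@hsubmxK R 1 1 n v).
by apply/rowP => i; rewrite !mxE (ord1 i); congr (v _ _); exact: val_inj.
Qed.

(** Induction on the dimension by slicing along the first coordinate: the induction hypothesis
    translates the slices, one-dimensional invariance translates the integral of their measures. *)
Lemma lebesgue_rV_shift n (z : 'rV[R]_n) (A : set 'rV[R]_n) : measurable A ->
  lebesgue_rV n ((fun x => x + z) @^-1` A) = lebesgue_rV n A.
Proof.
elim: n z A => [z A mA|n ih z A mA].
  rewrite (_ : (fun x => x + z) = id)// ; apply/funext => x.
  by rewrite !(thinmx0 _ : _ = 0); apply: thinmx0.
pose z1 := z ord0 ord0; pose z2 := @rsubmx R 1 1 n z.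
have zE : consrV (z1, z2) = z by exact: consrV_rsubmx.
have consrVD (t u : R) (v w : 'rV[R]_n) : consrV (t, v) + consrV (u, w) = consrV (t + u, v + w).
  rewrite /consrV/= (@add_row_mx R 1 1 n) -[const_mx (t + u)](_ : const_mx t + const_mx u = _)//.
  by apply/rowP => i; rewrite !mxE.
have mB : measurable (consrV @^-1` A).
  by rewrite -[X in measurable X]setTI; exact: measurable_consrV.
pose g := lebesgue_rV n \o xsection (consrV @^-1` A).
have mg : measurable_fun setT g by exact: measurable_fun_xsection.
transitivity (\int[lebesgue_measure]_t (g (t + z1)%R))%E.
  rewrite [LHS]/= /lebesgue_rV_step /pushforward /product_measure1.
  apply: eq_integral => t _ /=; rewrite /g /=.
  rewrite -[RHS](ih z2); last exact: measurable_xsection.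
  congr (lebesgue_rV n _); apply/seteqP; split => v;
    rewrite /xsection/= !inE/= -zE consrVD//.
transitivity (\int[lebesgue_measure]_t g t)%E => //.
pose phi : R -> measurableTypeR R := fun t => t + z1.
have mphi : measurable_fun setT phi.
  by apply: measurable_funD => //; exact: measurable_cst.
transitivity (\int[pushforward lebesgue_measure phi]_t g t)%E.
  by rewrite ge0_integral_pushforward.
by apply: eq_measure_integral => B mB' _; exact: lebesgue_measure_shift.
Qed.

Lemma ge0_integral_shift n (z : 'rV[R]_n) (f : 'rV[R]_n -> \bar R) :
  measurable_fun setT f -> (forall x, 0 <= f x)%E ->
  (\int[lebesgue_rV n]_x f (x + z)%R = \int[lebesgue_rV n]_x f x)%E.
Proof.
move=> mf f0.
rewrite -[LHS]/(\int[_]_(t in (fun t : 'rV[R]_n => t + z)%R @^-1` setT)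
  (f \o (fun t => t + z)%R) t)%E.
rewrite -ge0_integral_pushforward//; last exact: measurable_addr_cst.
apply: eq_measure_integral => [|mz B mB' _]; first exact: measurable_addr_cst.
exact: lebesgue_rV_shift.
Qed.

Lemma ge0_integral_shift_on n (w : 'rV[R]_n) (A : set 'rV[R]_n) (f : 'rV[R]_n -> \bar R) :
  measurable A -> measurable_fun setT f -> (forall x, 0 <= f x)%E ->
  (\int[lebesgue_rV n]_(x in A) f (x + w)%R =
   \int[lebesgue_rV n]_(x in (fun y => y - w)%R @^-1` A) f x)%E.
Proof.
move=> mA mf f0.
have mA' : measurable ((fun y : 'rV[R]_n => y - w)%R @^-1` A).
  by rewrite -[X in measurable X]setTI; exact: measurable_addr_cst.
rewrite integral_mkcond [RHS]integral_mkcond.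
rewrite -[RHS](ge0_integral_shift w).
- apply: eq_integral => x _; rewrite !patchE.
  rewrite (_ : (x + w \in _) = (x \in A))//.
  by apply/idP/idP; rewrite !inE/= addrK.
- exact/(measurable_restrictT _ mA')/measurable_funTS.
- by move=> x; rewrite patchE; case: ifP.
Qed.

Lemma integrable_shift n (z : 'rV[R]_n) (f : 'rV[R]_n -> \bar R) :
  (lebesgue_rV n).-integrable setT f ->
  (lebesgue_rV n).-integrable setT (fun x => f (x + z)).
Proof.
move=> /integrableP[mf fi]; apply/integrableP; split.
  exact: (measurableT_comp mf (measurable_addr_cst z)).
rewrite (@ge0_integral_shift n z (fun x => `|f x|)%E)//.
exact: measurableT_comp.
Qed.

Lemma integral_shift n (z : 'rV[R]_n) (f : 'rV[R]_n -> \bar R) :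
  (lebesgue_rV n).-integrable setT f ->
  (\int[lebesgue_rV n]_x f (x + z)%R = \int[lebesgue_rV n]_x f x)%E.
Proof.
move=> fi; have mf := measurable_int _ fi.
rewrite -[LHS]/(\int[_]_(t in (fun t : 'rV[R]_n => t + z)%R @^-1` setT)
  (f \o (fun t => t + z)%R) t)%E.
rewrite -integral_pushforward//; first last.
- by rewrite preimage_setT; exact: integrable_shift.
- exact: measurable_addr_cst.
apply: eq_measure_integral => [|mz B mB' _]; first exact: measurable_addr_cst.
exact: lebesgue_rV_shift.
Qed.

Lemma measurable_cube n (a : 'rV[R]_n) r : measurable (cube a r).
Proof.
rewrite (_ : cube a r = \bigcap_(j in [set: 'I_n])
   ((fun v : 'rV[R]_n => v ord0 j) @^-1` ball (a ord0 j) r)).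
  apply: fin_bigcap_measurable => // i _.
  rewrite -[X in measurable X]setTI; apply: measurable_coord => //; exact: measurable_ball.
by apply/seteqP; split => [x h j _|x h j]; have := h j; rewrite -ball_normE/= distrC//; apply.
Qed.

Lemma lebesgue_rV_cube n (a : 'rV[R]_n) r : 0 <= r ->
  lebesgue_rV n (cube a r) = ((2 * r) ^+ n)%:E.
Proof.
move=> r0; elim: n a => [a|n ih a].
  by rewrite expr0 /= diracE mem_set// => -[].
rewrite (_ : cube a r =
  consrV @` (ball (a ord0 ord0) r `*` cube (@rsubmx R 1 1 n a) r)).
  rewrite lebesgue_rV_consrV; [|exact: measurable_ball|exact: measurable_cube].
  by rewrite ih lebesgue_measure_ball// -EFinM exprS mulr2n; congr (_ * _)%:E; ring.
apply/seteqP; split => [x xa|_ [[t v] /= [ta va] <-] j].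
  exists (x ord0 ord0, @rsubmx R 1 1 n x) => /=.
    split; first by rewrite -ball_normE/= distrC; exact: xa.
    by move=> j; rewrite !mxE; exact: xa.
  exact: consrV_rsubmx.
rewrite /consrV/=; case: (@split_ordP 1 n j) => i ->.
  rewrite (@row_mxEl R 1 1 n) mxE (ord1 i).
  move: ta; rewrite -ball_normE/= distrC.
  by rewrite (_ : lshift n ord0 = ord0)//; exact: val_inj.
rewrite (@row_mxEr R 1 1 n); have := va i; rewrite !mxE//.
Qed.

Lemma lebesgue_rV_cube_gt0 n (a : 'rV[R]_n) r : 0 < r ->
  (0 < lebesgue_rV n (cube a r))%E.
Proof. by move=> r0; rewrite lebesgue_rV_cube ?ltW// lte_fin exprn_gt0// mulr_gt0. Qed.

Lemma lebesgue_rV_cube_lty n (a : 'rV[R]_n) r : 0 <= r -> (lebesgue_rV n (cube a r) < +oo)%E.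
Proof. by move=> r0; rewrite lebesgue_rV_cube// ltry. Qed.

End lebesgue_rV_theory.

Lemma continuous_measurable_rV {R : realType} {n : nat} (f : 'rV[R]_n -> R) :
  continuous f -> measurable_fun setT f.
Proof.
move=> cf; apply: (measurability _ (RGenOpens.measurableE R)) => _ [_ [a [b ->]] <-].
rewrite setTI; apply: open_measurable_rV.
by apply: open_comp; [move=> x _; exact: cf|exact: interval_open].
Qed.

(** * Smooth approximations of half-line indicators and of positive parts *)

Section smooth_approximation.
Context {R : realType}.
Implicit Types (c t : R) (k : nat).

(** The transition takes place on [c, c + 1/(k+1)], to the right of c, so the limits of
    [approx_step] and [approx_ramp'] are 0 at c itself. This yields the half-open intervals ]a,
    b]. *)
Definition approx_step k c t : R := smooth_step (k.+1%:R * (t - c)).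
Definition approx_ramp k c t : R := smooth_ramp (k.+1%:R * (t - c)) / k.+1%:R.
Definition approx_ramp' k c t : R := (smooth_ramp^`()%classic) (k.+1%:R * (t - c)).

Let affineE k c t : k.+1%:R * (t - c) = k.+1%:R * t + - (k.+1%:R * c).
Proof. by rewrite mulrBr. Qed.

Lemma smooth_affine (f : R -> R) k c : smooth f ->
  smooth (fun t => f (k.+1%:R * (t - c))).
Proof.
move=> sf m; rewrite (_ : (fun t => _) = (fun t => f (k.+1%:R * t + - (k.+1%:R * c)))).
  exact: times_derivable_affine.
by apply/funext => t; rewrite affineE.
Qed.

Lemma smooth_approx_step k c : smooth (approx_step k c).
Proof. exact/smooth_affine/smooth_smooth_step. Qed.

Lemma smooth_approx_ramp k c : smooth (approx_ramp k c).
Proof.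
apply: smoothM; first exact/smooth_affine/smooth_smooth_ramp.
by move=> m; exact: times_derivable_cst.
Qed.

Lemma is_derive_approx_ramp k c t :
  is_derive t (1 : R) (approx_ramp k c) (approx_ramp' k c t).
Proof.
have dg : is_derive t (1 : R) (fun x : R => k.+1%:R * (x - c)) k.+1%:R.
  by apply: is_derive_eq; rewrite /GRing.scale/= ?subr0 ?mulr0 ?addr0 ?mulr1//.
have df : is_derive (k.+1%:R * (t - c)) (1 : R) smooth_ramp
    ((smooth_ramp^`()%classic) (k.+1%:R * (t - c))).
  exact: (times_derivable_is_derive (smooth_smooth_ramp 1%N)).
have dfg := @is_derive1_comp _ smooth_ramp (fun x : R => k.+1%:R * (x - c)) t _ _ df dg.
have := is_deriveZ (k.+1%:R^-1) dfg.
rewrite /GRing.scale/= mulrCA mulVf ?pnatr_eq0// mulr1.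
by rewrite (_ : _ \*: _ = approx_ramp k c)//; apply/funext => x; rewrite /approx_ramp mulrC.
Qed.

Lemma approx_step_bound k c d t : `|approx_step k c t - approx_step k d t| <= 1.
Proof.
rewrite ler_norml /approx_step.
set u := smooth_step _; set v := smooth_step _.
have := smooth_step_ge0 (k.+1%:R * (t - c)); have := smooth_step_le1 (k.+1%:R * (t - c)).
have := smooth_step_ge0 (k.+1%:R * (t - d)); have := smooth_step_le1 (k.+1%:R * (t - d)).
by rewrite -/u -/v => ? ? ? ?; apply/andP; split; lra.
Qed.

Let k0 k : 0 < k.+1%:R :> R. Proof. by rewrite ltr0n. Qed.

Lemma approx_step_le0 k c t : t <= c -> approx_step k c t = 0.
Proof.
by move=> tc; rewrite /approx_step smooth_step_eq0// pmulr_rle0// subr_le0.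
Qed.

Lemma approx_step_ge1 k c t : c + 1 <= t -> approx_step k c t = 1.
Proof.
move=> tc; rewrite /approx_step smooth_step_eq1//.
have k1 : 1 <= k.+1%:R :> R by rewrite ler1n.
by rewrite -[leLHS]mul1r ler_pM// lerBrDl.
Qed.

Lemma approx_ramp_le0 k c t : t <= c -> approx_ramp k c t = 0.
Proof.
by move=> tc; rewrite /approx_ramp smooth_ramp_le0 ?mul0r// pmulr_rle0// subr_le0.
Qed.

Lemma approx_ramp_ge1 k c t : c + 1 <= t -> approx_ramp k c t = t - c.
Proof.
move=> tc; have k1 : 1 <= k.+1%:R :> R by rewrite ler1n.
rewrite /approx_ramp smooth_ramp_ge1 ?[_%:R * _]mulrC ?mulfK ?gt_eqF//.
by rewrite -[leLHS]mul1r ler_pM// lerBrDl.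
Qed.

Lemma approx_ramp_dist k c t : `|approx_ramp k c t - Num.max (t - c) 0| <= k.+1%:R^-1.
Proof.
have [tc|tc] := leP t c.
  rewrite approx_ramp_le0// max_r ?subr_le0// subr0 normr0 invr_ge0 ltW//.
rewrite max_l; last by rewrite subr_ge0 ltW.
rewrite /approx_ramp.
have [t1|t1] := leP 1 (k.+1%:R * (t - c)).
  by rewrite smooth_ramp_ge1// [_%:R * _]mulrC mulfK ?gt_eqF// subrr normr0 invr_ge0 ltW.
set x := k.+1%:R * (t - c) in t1 *.
have -> : t - c = x / k.+1%:R by rewrite /x [_%:R * _]mulrC mulfK ?gt_eqF.
have x0 : 0 <= x by rewrite mulr_ge0// ?subr_ge0 ltW.
rewrite -mulrBl normrM [X in _ * X]gtr0_norm ?invr_gt0// -[leRHS]mul1r.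
rewrite ler_pM2r ?invr_gt0// /smooth_ramp/= ler_norml.
have := smooth_step_ge0 x; have := smooth_step_le1 x => s1 s0.
by apply/andP; split; nra.
Qed.

Lemma cvg_approx_step c t : (fun k => approx_step k c t) @ \oo --> ((c < t)%R%:R : R).
Proof.
have [tc|tc] := leP t c.
  rewrite (_ : (fun k => _) = cst 0); first exact: cvg_cst.
  by apply/funext => k; rewrite approx_step_le0.
apply: cvg_near_cst; near=> k; rewrite /approx_step smooth_step_eq1//.
rewrite -ler_pdivrMr ?subr_gt0// (@le_trans _ _ k%:R) ?ler_nat//.
by near: k; exact: nbhs_infty_ger.
Unshelve. all: by end_near. Qed.

Lemma cvg_approx_ramp' c t : (fun k => approx_ramp' k c t) @ \oo --> ((c < t)%R%:R : R).
Proof.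
have [tc|tc] := leP t c.
  rewrite (_ : (fun k => _) = cst 0); first exact: cvg_cst.
  by apply/funext => k; rewrite /approx_ramp' derive_smooth_ramp_le0// pmulr_rle0// subr_le0.
apply: cvg_near_cst; near=> k; rewrite /approx_ramp' derive_smooth_ramp_ge1//.
rewrite -ler_pdivrMr ?subr_gt0// (@le_trans _ _ k%:R) ?ler_nat//.
by near: k; exact: nbhs_infty_ger.
Unshelve. all: by end_near. Qed.

Lemma cvg_approx_ramp c t : (fun k => approx_ramp k c t) @ \oo --> Num.max (t - c) 0.
Proof.
apply/cvgrPdist_le => e e0; near=> k; rewrite distrC.
apply: le_trans (approx_ramp_dist _ _ _) _.
apply: ltW; near: k; exact: (near_infty_natSinv_lt (PosNum e0)).
Unshelve. all: by end_near. Qed.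

End smooth_approximation.

(** * Difference quotients on boxes *)

Section trapezoid.
Context {R : realDomainType}.
Implicit Types a b h t : R.

(* For a <= b and 0 <= h, the length of ]a, b] intersected with [t - h, t[. *)
Definition trapezoid a b h t : R :=
  Num.max (t - a) 0 - Num.max (t - b) 0 -
    (Num.max (t - (h + a)) 0 - Num.max (t - (h + b)) 0).

Variant max0_spec t : R -> Type :=
| Max0Pos of 0 <= t : max0_spec t t
| Max0Neg of t <= 0 : max0_spec t 0.

Lemma max0P t : max0_spec t (Num.max t 0).
Proof.
have [t0|t0] := leP t 0; first exact: Max0Neg.
by apply: Max0Pos; exact: ltW.
Qed.

Lemma trapezoid_ge0 a b h t : a <= b -> 0 <= h -> 0 <= trapezoid a b h t.
Proof.
by move=> ab h0; rewrite /trapezoid; case: max0P => ?; case: max0P => ?;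
  case: max0P => ?; case: max0P => ?; lra.
Qed.

Lemma trapezoid_le a b h t : a <= b -> 0 <= h ->
  trapezoid a b h t <= 2 * (b - a).
Proof.
by move=> ab h0; rewrite /trapezoid; case: max0P => ?; case: max0P => ?;
  case: max0P => ?; case: max0P => ?; lra.
Qed.

(** The right-hand side is the length of [l, u[, which consists of tau in [0, h] with a < t - tau <=
    b up to endpoints. *)
Lemma trapezoid_length a b h t : a <= b -> 0 <= h ->
  trapezoid a b h t <=
  let l := Num.max (t - b) 0 in let u := Num.min h (t - a) in
  if l < u then u - l else 0.
Proof.
move=> ab h0 /=; rewrite /trapezoid minEle.
case: (max0P (t - b)) => ?; case: (max0P (t - a)) => ?;
  case: (max0P (t - (h + a))) => ?; case: (max0P (t - (h + b))) => ?;
  case: (leP h (t - a)) => ?; case: ltP => ?; lra.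
Qed.

Lemma ler_norm4 K (x y z w : R) : `|x| <= K -> `|y| <= K -> `|z| <= K ->
  `|w| <= K -> `|x - y - (z - w)| <= 4 * K.
Proof.
move=> xK yK zK wK; rewrite (le_trans (ler_normB _ _))//.
have := ler_normB x y; have := ler_normB z w; lra.
Qed.

End trapezoid.

Section box_difference.
Context {R : realType} {n : nat}.
Implicit Types a b x : 'rV[R]_n.

Definition box a b : set 'rV[R]_n :=
  [set x | forall j, a ord0 j < x ord0 j <= b ord0 j].

Lemma measurable_box a b : measurable (box a b).
Proof.
rewrite (_ : box a b = \bigcap_(j in [set: 'I_n])
   ((fun v : 'rV[R]_n => v ord0 j) @^-1` `]a ord0 j, b ord0 j]%classic)).
  apply: fin_bigcap_measurable => // i _.
  by rewrite -[X in measurable X]setTI; apply: measurable_coord => //; exact: measurable_itv.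
apply/seteqP; split => [x h j _|x h j] /=.
  by rewrite in_itv/=; exact: h.
by have := h j I; rewrite /= in_itv/=.
Qed.

Lemma indic_boxE a b x :
  \1_(box a b) x = \prod_j (a ord0 j < x ord0 j <= b ord0 j)%R%:R :> R.
Proof.
rewrite indicE; case: (asboolP (box a b x)) => h.
  by rewrite mem_set// big1// => j _; rewrite h.
rewrite memNset//.
have [j hj] : exists j, ~~ (a ord0 j < x ord0 j <= b ord0 j).
  by apply/not_existsP => H; apply: h => j; exact/negPn/negP/H.
by rewrite (bigD1 j)//= (negPf hj) mul0r.
Qed.

(* The measure of A is the integral over tau in [0, h] of the translates
   m (A + tau e_i). *)
Definition sweep (m : {finite_measure set 'rV[R]_n -> \bar R}) (i : 'I_n) (h : R)
    : set 'rV[R]_n -> \bar R :=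
  fun A => (m \x (@lebesgue_measure R))%E
    [set z | [/\ A (z.1 - z.2 *: delta_mx ord0 i) & 0 <= z.2 <= h]].

Section sweep_measure.
Variables (m : {finite_measure set 'rV[R]_n -> \bar R}) (i : 'I_n) (h : R).

Let trans (z : 'rV[R]_n * R) : 'rV[R]_n := z.1 - z.2 *: delta_mx ord0 i.

Let mtrans : measurable_fun setT trans.
Proof.
apply: measurable_fun_rV => j; rewrite /trans; under eq_fun do rewrite !mxE.
apply: measurable_funB.
  exact: (measurableT_comp (measurable_coord j) measurable_fst).
by apply: measurable_funM; [exact: measurable_snd|exact: measurable_cst].
Qed.

Let strip : set ('rV[R]_n * R) := setT `*` `[0, h]%classic.

Let mstrip : measurable strip.
Proof. by apply: measurableX => //; exact: measurable_itv. Qed.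

Let sweepE A : [set z : 'rV[R]_n * R | [/\ A (z.1 - z.2 *: delta_mx ord0 i) & 0 <= z.2 <= h]]
  = trans @^-1` A `&` strip.
Proof.
by apply/seteqP; split => -[y t] /=; rewrite /strip/= in_itv/= => -[Ay];
  [move=> th|case=> _ th]; split.
Qed.

Let mpre A : measurable A -> measurable (trans @^-1` A `&` strip).
Proof.
by move=> mA; apply: measurableI => //; rewrite -[X in measurable X]setTI; exact: mtrans.
Qed.

Let sweep0 : sweep m i h set0 = 0%E.
Proof. by rewrite /sweep sweepE preimage_set0 set0I measure0. Qed.

Let sweep_ge0 A : (0 <= sweep m i h A)%E.
Proof. exact: measure_ge0. Qed.

Let sweep_sigma_additive : semi_sigma_additive (sweep m i h).
Proof.
move=> F mF tF mUF; rewrite /sweep sweepE.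
under eq_fun do under eq_bigr do rewrite sweepE.
rewrite preimage_bigcup setI_bigcupl.
apply: measure_semi_sigma_additive.
- by move=> j; exact: mpre.
- apply/trivIsetP => /= j l _ _ jl; rewrite setIACA setIid -preimage_setI.
  by move/trivIsetP : tF => /(_ _ _ _ _ jl) ->//; rewrite preimage_set0 set0I.
- by apply: bigcupT_measurable => j; exact: mpre.
Qed.

HB.instance Definition _ := isMeasure.Build _ _ _ (sweep m i h)
  sweep0 sweep_ge0 sweep_sigma_additive.

Lemma sweep_le A B : 0 <= h -> measurable A -> measurable B ->
  (forall x t, A x -> 0 <= t <= h -> B (x + t *: delta_mx ord0 i)) ->
  (sweep m i h A <= m B * h%:E)%E.
Proof.
move=> h0 mA mB AB; rewrite /sweep sweepE.
apply: (@le_trans _ _ ((m \x (@lebesgue_measure R)) (B `*` `[0%R, h]%classic))%E).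
  apply: le_measure; rewrite ?inE//.
  - exact: mpre.
  - by apply: measurableX => //; exact: measurable_itv.
  - move=> [y t] /= [Ay []]; rewrite in_itv/= => _ th; split => //.
    by have := AB _ _ Ay th; rewrite subrK.
rewrite product_measure1E//=.
rewrite lebesgue_measure_itv/= lte_fin.
by case: ltgtP h0 => // [h0 _|<- _]; rewrite ?subr0 ?oppr0 ?adde0//.
Qed.

Lemma sweep_fin : fin_num_fun (sweep m i h).
Proof.
move=> A mA; rewrite ge0_fin_numE ?measure_ge0//.
have [h0|h0] := leP 0 h.
  apply: le_lt_trans (sweep_le h0 mA measurableT _) _ => //.
  by rewrite -ge0_fin_numE ?mule_ge0// fin_numM// fin_num_measure.
rewrite /sweep [X in (_ \x _)%E X](_ : _ = set0) ?measure0//.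
apply/seteqP; split => // -[y t] /= [_ /andP[t0 th]].
by have := le_lt_trans (le_trans t0 th) h0; rewrite ltxx.
Qed.

HB.instance Definition _ := @Measure_isFinite.Build _ _ _ (sweep m i h) sweep_fin.

(** By definition of the product measure the translation parameter is integrated first. For fixed x
    the admissible tau fill an interval whose length is governed by the i-th coordinate, while the
    other coordinates only decide whether it is empty. *)
Lemma sweep_box a b : (forall j, a ord0 j <= b ord0 j) -> 0 <= h ->
  (\int[m]_x (trapezoid (a ord0 i) (b ord0 i) h (x ord0 i) *
     \prod_(j | j != i) (a ord0 j < x ord0 j <= b ord0 j)%R%:R)%:E
  <= sweep m i h (box a b))%E.
Proof.
move=> ab h0.
have mS : measurable (trans @^-1` box a b `&` strip) by apply: mpre; exact: measurable_box.
rewrite /sweep sweepE /product_measure1.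
have mci (c : R) : measurable_fun setT (fun x : 'rV[R]_n => Num.max (x ord0 i - c) 0).
  apply: measurable_maxr => //; apply: measurable_funB => //; exact: measurable_coord.
apply: ge0_le_integral => //.
- by move=> x _; rewrite lee_fin mulr_ge0 ?trapezoid_ge0// prodr_ge0.
- apply/measurable_EFinP/measurable_funM.
    by apply: measurable_funB; apply: measurable_funB; exact: mci.
  under eq_fun do rewrite big_mkcond/=.
  apply: measurable_prod => j _ /=.
  have [_|ji] := eqVneq j i; first exact: measurable_cst.
  rewrite (_ : (fun x => _) =
      \1_((fun v : 'rV[R]_n => v ord0 j) @^-1` `]a ord0 j, b ord0 j]%classic)).
    apply: measurable_indic; rewrite -[X in measurable X]setTI.
    by apply: measurable_coord => //; exact: measurable_itv.
  apply/funext => x; rewrite indicE; congr (nat_of_bool _)%:R.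
  by apply/idP/idP; rewrite inE/= in_itv.
- exact: measurable_fun_xsection.
- move=> x _ /=.
  have [/forallP H|/forallPn[j]] :=
      boolP [forall j, (j != i) ==> (a ord0 j < x ord0 j <= b ord0 j)]; last first.
    rewrite negb_imply => /andP[ji hj].
    by rewrite (bigD1 j)//= (negPf hj) mul0r mulr0 measure_ge0.
  rewrite big1 => [|j ji]; last by have := H j; rewrite ji/= => ->.
  rewrite mulr1.
  pose l := Num.max (x ord0 i - b ord0 i) 0; pose u := Num.min h (x ord0 i - a ord0 i).
  apply: (@le_trans _ _ (lebesgue_measure `[l, u[%classic)); last first.
    apply: le_measure; rewrite ?inE//.
    + exact: measurable_xsection.
    + move=> t /=; rewrite in_itv/= /l /u ge_max lt_min => /andP[/andP[tb t0] /andP[th ta]].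
      rewrite /xsection/= inE /trans/=; split; last by split=> //; rewrite /= in_itv/= t0 ltW.
      move=> j; rewrite !mxE eqxx/=.
      have [->|ji] := eqVneq j i; first by rewrite mulr1; apply/andP; split; lra.
      by rewrite mulr0 subr0; have := H j; rewrite ji.
  rewrite lebesgue_measure_itv/= lte_fin.
  have := trapezoid_length (x ord0 i) (ab i) h0; rewrite /= -/u -/l.
  by case: ifP => _; rewrite -?EFinB lee_fin.
Qed.

End sweep_measure.
End box_difference.

Section box_difference.
Context {R : realType} {n : nat}.
Variables (phi : 'rV[R]_n -> R) (m : {finite_measure set 'rV[R]_n -> \bar R}).
Variable i : 'I_n.
Hypothesis iphi : (lebesgue_rV n).-integrable setT (EFin \o phi).
Hypothesis Hm : forall psi, test_function psi -> measurable_fun setT psi ->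
  (`|\int[lebesgue_rV n]_x (phi x * partial i psi x)%:E| <= \int[m]_x `|psi x|%:E)%E.
Variables (a b : 'rV[R]_n) (h : R).
Hypotheses (ab : forall j, a ord0 j <= b ord0 j) (h0 : 0 <= h).

(** [rho] tends to the indicator of ]a_j, b_j], [sigma] to the trapezoid, and [sigma'] to the
    indicator of ]a_i, b_i] minus its translate by h. Hence [psi] approximates the swept box and
    [psi'] the difference of the indicators of the box and of its translate. *)
Let rho (k : nat) (j : 'I_n) (t : R) : R :=
  approx_step k (a ord0 j) t - approx_step k (b ord0 j) t.
Let sigma (k : nat) (t : R) : R :=
  approx_ramp k (a ord0 i) t - approx_ramp k (b ord0 i) t -
  (approx_ramp k (h + a ord0 i) t - approx_ramp k (h + b ord0 i) t).
Let sigma' (k : nat) (t : R) : R :=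
  approx_ramp' k (a ord0 i) t - approx_ramp' k (b ord0 i) t -
  (approx_ramp' k (h + a ord0 i) t - approx_ramp' k (h + b ord0 i) t).
Let psi k := tensor (tensor_set (rho k) i (sigma k)).
Let psi' k := tensor (tensor_set (rho k) i (sigma' k)).

Let trap := trapezoid (a ord0 i) (b ord0 i) h.

Let smoothB (f g : R -> R) : smooth f -> smooth g -> smooth (fun t => f t - g t).
Proof.
move=> sf sg; rewrite (_ : (fun t => _) = f \+ (cst (-1) \* g)).
  apply: smoothD => //; apply: smoothM => // k; exact: times_derivable_cst.
by apply/funext => t /=; rewrite mulN1r.
Qed.

Let smooth_sigma k : smooth (sigma k).
Proof. by apply: smoothB; apply: smoothB; exact: smooth_approx_ramp. Qed.

Let smooth_rho k j : smooth (rho k j).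
Proof. by apply: smoothB; exact: smooth_approx_step. Qed.

Let is_derive_sigma k (t : R) : is_derive t (1 : R) (sigma k) (sigma' k t).
Proof.
exact: (is_deriveB (is_deriveB (is_derive_approx_ramp k (a ord0 i) t)
  (is_derive_approx_ramp k (b ord0 i) t)) (is_deriveB
  (is_derive_approx_ramp k (h + a ord0 i) t) (is_derive_approx_ramp k (h + b ord0 i) t))).
Qed.

Let partial_psi k : partial i (psi k) = psi' k.
Proof.
apply/funext => x; rewrite partial_tensor; last first.
  by rewrite /tensor_set eqxx; have [] := is_derive_sigma k (x ord0 i).
rewrite /psi' !tensor_setE; congr (_ * _).
  rewrite /tensor_set eqxx derive1E.
  by have [_ ->] := is_derive_sigma k (x ord0 i).
by apply: eq_bigr => j /negPf ji; rewrite /tensor_set ji.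
Qed.

Let cpsi k : continuous (psi k).
Proof.
apply: continuous_tensor => j; rewrite /tensor_set; case: ifP => _;
  exact: smooth_continuous.
Qed.

Let sigma'E k : sigma' k = (sigma k)^`()%classic.
Proof.
apply/funext => t; rewrite derive1E.
by have [_ ->] := is_derive_sigma k t.
Qed.

Let cpsi' k : continuous (psi' k).
Proof.
apply: continuous_tensor => j; rewrite /tensor_set; case: ifP => _.
  by rewrite sigma'E; apply/smooth_continuous/smooth_derive1.
exact: smooth_continuous.
Qed.

Let test_psi k : test_function (psi k).
Proof.
apply: test_function_tensor => [j|].
  by rewrite /tensor_set; case: ifP.
pose c := \sum_j (`|a ord0 j| + `|b ord0 j|).
have c0 j : `|a ord0 j| + `|b ord0 j| <= c.
  by rewrite /c (bigD1 j)//= lerDl sumr_ge0// => l _; rewrite addr_ge0.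
have ac j : - c <= a ord0 j <= c.
  by rewrite -ler_norml (le_trans _ (c0 j))// lerDl.
have bc j : - c <= b ord0 j <= c.
  by rewrite -ler_norml (le_trans _ (c0 j))// lerDr.
(* All transitions start between -c and c + h and have width at most 1. *)
clear c0; exists (c + h + 1) => j t tc; move: (ac j) (bc j) (ac i) (bc i) h0.
clearbody c; move=> /andP[? ?] /andP[? ?] /andP[? ?] /andP[? ?] h_ge0.
have /orP[tl|tl] : (t <= - c) || (c + h + 1 <= t).
  move: tc; rewrite real_ltr_normr ?num_real// => /orP[?|?]; apply/orP; [right|left]; lra.
- rewrite /tensor_set /rho /sigma; case: ifP => _.
    rewrite !approx_ramp_le0 ?subrr//; lra.
  rewrite !approx_step_le0 ?subrr//; lra.
(* Beyond the last transition the four ramps are affine and cancel exactly. *)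
- rewrite /tensor_set /rho /sigma; case: ifP => _.
    rewrite !approx_ramp_ge1; lra.
  rewrite !approx_step_ge1 ?subrr//; lra.
Qed.

Let prod_rho_le1 k (x : 'rV[R]_n) : `|\prod_(j | j != i) rho k j (x ord0 j)| <= 1.
Proof.
rewrite normr_prod; apply: prodr_ile1 => j _; rewrite normr_ge0/=.
exact: approx_step_bound.
Qed.

Let ind (x : 'rV[R]_n) : R := \prod_(j | j != i) (a ord0 j < x ord0 j <= b ord0 j)%R%:R.

Let step_diff (c d t : R) : c <= d -> (c < t)%R%:R - (d < t)%R%:R = (c < t <= d)%R%:R :> R.
Proof.
move=> cd; case: (ltP d t) => dt; case: (ltP c t) => ct /=; rewrite ?subrr ?subr0//.
by have := lt_le_trans dt (le_trans ct cd); rewrite ltxx.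
Qed.

Let cvg_prod_rho (x : 'rV[R]_n) :
  (fun k => \prod_(j | j != i) rho k j (x ord0 j)) @ \oo --> (ind x : R).
Proof.
rewrite /ind; apply: cvg_big => [z|j _]; first exact: mul_continuous.
by rewrite -step_diff//; apply: cvgB; exact: cvg_approx_step.
Qed.

Let cvg_psi (x : 'rV[R]_n) : (fun k => psi k x) @ \oo --> (trap (x ord0 i) * ind x : R).
Proof.
rewrite /psi; under eq_fun do rewrite tensor_setE.
apply: cvgM; last exact: cvg_prod_rho.
by apply: cvgB; apply: cvgB; exact: cvg_approx_ramp.
Qed.

Let hi : 'rV[R]_n := h *: delta_mx ord0 i.

Let cvg_psi' (x : 'rV[R]_n) :
  (fun k => psi' k x) @ \oo --> (\1_(box a b) x - \1_(box a b) (x - hi) : R).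
Proof.
rewrite /psi'; under eq_fun do rewrite tensor_setE.
rewrite !indic_boxE (bigD1 i)//= [X in _ - X](bigD1 i)//=.
rewrite [X in _ - _ * X](_ : _ = ind x); last first.
  by apply: eq_bigr => j ji; rewrite !mxE (negPf ji) andbF mulr0 subr0.
rewrite -mulrBl; apply: cvgM; last exact: cvg_prod_rho.
rewrite !mxE !eqxx/= mulr1 ltrBrDl lerBlDl -!step_diff//; last by rewrite lerD2l.
by apply: cvgB; apply: cvgB; exact: cvg_approx_ramp'.
Qed.

Let bound_psi : exists K, forall k x, `|psi k x| <= K.
Proof.
(* The first summand bounds the trapezoid; the 4 collects the errors of the four ramps, each at most
   1. *)
exists (2 * (b ord0 i - a ord0 i) + 4) => k x.
rewrite /psi tensor_setE normrM -[leRHS]mulr1 ler_pM//.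
set t := x ord0 i.
have k1 : k.+1%:R^-1 <= 1 :> R by rewrite invf_le1// ler1n.
have rd c := le_trans (approx_ramp_dist k c t) k1.
have := ler_norm4 (rd (a ord0 i)) (rd (b ord0 i)) (rd (h + a ord0 i)) (rd (h + b ord0 i)).
rewrite (_ : _ - _ = sigma k t - trap t); last by rewrite /sigma /trap /trapezoid; ring.
rewrite mulr1 => H; rewrite -[X in `|X|](subrK (trap t)) (le_trans (ler_normD _ _))//.
by rewrite addrC lerD// ger0_norm ?trapezoid_le// trapezoid_ge0.
Qed.

Let bound_psi' : exists K, 0 <= K /\ forall k x, `|psi' k x| <= K.
Proof.
have [K HK] := @derive_smooth_ramp_bounded R.
have K0 : 0 <= K by apply: le_trans (HK 0).
exists (4 * K); split=> [|k x]; first by rewrite mulr_ge0.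
rewrite /psi' tensor_setE normrM -[leRHS]mulr1 ler_pM//.
by apply: ler_norm4; exact: HK.
Qed.

Let trap_ge0 t : 0 <= trap t. Proof. exact: trapezoid_ge0. Qed.

Let cvg_rhs : (fun k => \int[m]_x `|psi k x|%:E)%E @ \oo -->
  (\int[m]_x (trap (x ord0 i) * ind x)%:E)%E.
Proof.
have [K HK] := bound_psi.
have K0 : 0 <= K by apply: le_trans (HK 0%N 0).
apply: (@dominated_cvg _ _ _ m setT _ (fun k x => `|psi k x|%:E) _ (cst K%:E)) => //.
- by move=> k; apply/measurable_EFinP/measurableT_comp => //;
    exact: (continuous_measurable_rV (@cpsi k)).
- move=> x _; apply: cvg_EFin; first exact: nearW.
  rewrite -[X in _ --> X]ger0_norm; last by rewrite mulr_ge0// prodr_ge0.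
  by apply: cvg_norm; exact: cvg_psi.
- exact: finite_measure_integrable_cst.
- by move=> k x _; rewrite /= lee_fin normr_id.
Qed.

Let mphi : measurable_fun setT phi.
Proof. by apply/measurable_EFinP; exact: measurable_int iphi. Qed.

Let cvg_lhs : (fun k => \int[lebesgue_rV n]_x (phi x * partial i (psi k) x)%:E)%E @ \oo -->
  (\int[lebesgue_rV n]_x (phi x * (\1_(box a b) x - \1_(box a b) (x - hi)))%:E)%E.
Proof.
have [K [K0 HK]] := bound_psi'.
apply: (@dominated_cvg _ _ _ (lebesgue_rV n) setT _
  (fun k x => (phi x * partial i (psi k) x)%:E) _ (fun x => (K * `|phi x|)%:E)) => //.
- move=> k; rewrite partial_psi; apply/measurable_EFinP/measurable_funM => //.
  exact: (continuous_measurable_rV (@cpsi' k)).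
- move=> x _; apply: cvg_EFin; first exact: nearW.
  apply: cvgMl_tmp; under eq_fun do rewrite partial_psi.
  exact: cvg_psi'.
- under eq_fun do rewrite EFinM; apply: integrableZl => //.
  exact: (integrable_abse iphi).
- move=> k x _; rewrite /= lee_fin normrM mulrC partial_psi.
  by rewrite ler_wpM2r.
Qed.

(** Translation invariance turns the left side into the integral of phi against the limit of [psi'].
    The inequality then passes to the limit from the test functions [psi]: dominated by a multiple
    of |phi| on the left, by a constant for the finite measure m on the right. *)
Lemma box_difference :
  (`|\int[lebesgue_rV n]_(x in box a b) (phi (x + hi) - phi x)%:E| <= sweep m i h (box a b))%E.
Proof.
have mbox := measurable_box a b.
have -> : (\int[lebesgue_rV n]_(x in box a b) (phi (x + hi)%R - phi x)%:E =
    - (\int[lebesgue_rV n]_x (phi x * (\1_(box a b) x - \1_(box a b) (x - hi)%R))%:E))%E.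
  have i1 : (lebesgue_rV n).-integrable setT (fun x => (phi x * \1_(box a b) x)%:E).
    apply: (le_integrable _ _ _ iphi) => //.
      by apply/measurable_EFinP/measurable_funM.
    move=> x _; rewrite /= lee_fin normrM -[leRHS]mulr1 ler_wpM2l//.
    by rewrite indicE; case: (_ \in _); rewrite ?normr1 ?normr0.
  have i2 : (lebesgue_rV n).-integrable setT (fun x => (phi x * \1_(box a b) (x - hi))%:E).
    apply: (le_integrable _ _ _ iphi) => //.
      apply/measurable_EFinP/measurable_funM => //.
      exact: (measurableT_comp (measurable_indic mbox) (measurable_addr_cst _)).
    move=> x _; rewrite /= lee_fin normrM -[leRHS]mulr1 ler_wpM2l//.
    by rewrite indicE; case: (_ \in _); rewrite ?normr1 ?normr0.
  have i3 := integrable_shift hi i2.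
  under [in RHS]eq_integral do rewrite mulrBr EFinB.
  have i23 := integral_shift hi i2.
  rewrite (integralB measurableT i1 i2) -i23.
  rewrite fin_num_oppeB; last exact: integrable_fin_num.
  rewrite addeC -integralB//.
  rewrite [LHS]integral_mkcond; apply: eq_integral => x _ /=.
  rewrite patchE addrK indicE; case: ifP => _ /=; rewrite ?mulr1 ?mulr0 ?EFinB ?sube0//.
rewrite abseN.
have /(_ _) H1 := cvg_abse cvg_lhs.
rewrite -(cvg_lim _ H1)//; apply: le_trans _ (sweep_box m i ab h0).
rewrite -[leRHS](cvg_lim _ cvg_rhs)//; apply: lee_lim.
- by apply/cvg_ex; eexists; exact: H1.
- by apply/cvg_ex; eexists; exact: cvg_rhs.
- apply: nearW => k /=; apply: Hm; first exact: test_psi.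
  exact: (continuous_measurable_rV (@cpsi k)).
Qed.

End box_difference.

(** * From boxes to Borel sets *)

Section approximation_by_algebra.
Context d {T : measurableType d} {R : realType}.
Variable mu : {measure set T -> \bar R}.
Hypothesis mu_fin : (mu setT < +oo)%E.
Variable G : set (set T).
Hypothesis mG : G `<=` measurable.
Hypothesis G0 : G set0.
Hypothesis GC : forall A, G A -> G (~` A).
Hypothesis GU : forall A B, G A -> G B -> G (A `|` B).

Definition approximable (E : set T) : Prop := measurable E /\
  forall e : R, 0 < e -> exists2 A, G A & (mu ((E `\` A) `|` (A `\` E)) < e%:E)%E.

Let msd (E A : set T) : measurable E -> measurable A -> measurable ((E `\` A) `|` (A `\` E)).
Proof. by move=> mE mA; apply: measurableU; exact: measurableD. Qed.

Let approximableU E F : approximable E -> approximable F -> approximable (E `|` F).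
Proof.
move=> [mE HE] [mF HF]; split=> [|e e0]; first exact: measurableU.
have e2 : 0 < e / 2 by rewrite divr_gt0.
have [A GA HA] := HE _ e2; have [B GB HB] := HF _ e2.
exists (A `|` B); first exact: GU.
have mA := mG GA; have mB := mG GB.
apply: (@le_lt_trans _ _ (mu (((E `\` A) `|` (A `\` E)) `|` ((F `\` B) `|` (B `\` F))))).
  apply: le_measure; rewrite ?inE.
  - by apply: msd; exact: measurableU.
  - by apply: measurableU; exact: msd.
  - move=> x [[EF nAB]|[AB nEF]].
      case: EF => Ex; [left|right]; left; split=> // ?; apply: nAB; [by left|by right].
    case: AB => Ax; [left|right]; right; split=> // ?; apply: nEF; [by left|by right].
apply: le_lt_trans (measureU2 _ (msd mE mA) (msd mF mB)) _.
by rewrite [e]splitr EFinD lteD.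
Qed.

(** Only countable unions need finiteness of mu: by continuity from above a finite partial union
    already exhausts the union up to e/2, and finite unions are approximated termwise. *)
Lemma sigma_algebra_approximable : sigma_algebra setT approximable.
Proof.
have a0 : approximable set0.
  split=> // e e0; exists set0 => //.
  by rewrite setDv setU0 measure0 lte_fin.
split=> //.
- move=> E [mE HE]; rewrite setTD; split=> [|e e0]; first exact: measurableC.
  have [A GA HA] := HE _ e0; exists (~` A); first exact: GC.
  rewrite (_ : _ `|` _ = (E `\` A) `|` (A `\` E))//.
  by rewrite !setDE !setCK setUC; congr (_ `|` _); rewrite setIC.
- move=> F aF.
  have mF i : measurable (F i) by case: (aF i).
  pose B N := \big[setU/set0]_(i < N) F i.
  have aB N : approximable (B N).
    rewrite /B; elim/big_ind : _ => // *; exact: approximableU.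
  have mB N : measurable (B N) by case: (aB N).
  have mU : measurable (\bigcup_i F i) by exact: bigcupT_measurable.
  split=> // e e0; have e2 : 0 < e / 2 by rewrite divr_gt0.
  have BF : \bigcup_N B N = \bigcup_i F i.
    apply/seteqP; split=> [x [N _]|x [i _ Fx]].
      by rewrite /B -bigcup_mkord => -[i iN Fx]; exists i.
    by exists i.+1 => //; rewrite /B -bigcup_mkord; exists i => /=.
  have cv : (fun N => mu ((\bigcup_i F i) `\` B N)) @ \oo --> 0%E.
    rewrite -(measure0 mu) -(_ : \bigcap_N ((\bigcup_i F i) `\` B N) = set0).
      apply: nonincreasing_cvg_mu => //.
      - by apply: le_lt_trans mu_fin; apply: le_measure; rewrite ?inE//; exact: measurableD.
      - by move=> N; exact: measurableD.
      - by apply: bigcapT_measurable => N; exact: measurableD.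
      - move=> N N' NN'; apply/subsetPset => x [Ux nB]; split=> // Bx; apply: nB.
        move: Bx; rewrite /B -!bigcup_mkord => -[j /= jN Fx]; exists j => //=.
        exact: leq_trans jN NN'.
    apply/seteqP; split=> // x h; have [Ux _] := h 0%N I.
    move: (Ux); rewrite -BF => -[N _ BN]; by have [_ ] := h N I.
  have [N HN] : exists N, (mu ((\bigcup_i F i) `\` B N) < (e / 2)%:E)%E.
    have [N _ HN] : \forall N \near \oo, (mu ((\bigcup_i F i) `\` B N) < (e / 2)%:E)%E.
      apply: (cv [set x | (x < (e / 2)%:E)%E]); apply: open_nbhs_nbhs.
      by split; [exact: open_ereal_lt_ereal|rewrite /= lte_fin].
    by exists N; apply: HN => /=.
  have [A GA HA] := (aB N).2 _ e2; exists A => //.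
  have mA := mG GA.
  apply: (@le_lt_trans _ _ (mu (((\bigcup_i F i) `\` B N) `|` ((B N `\` A) `|` (A `\` B N))))).
    apply: le_measure; rewrite ?inE.
    - exact: msd.
    - by apply: measurableU; [exact: measurableD|exact: msd].
    - move=> x [[Ux nA]|[Ax nU]].
        by have [Bx|nB] := pselect (B N x); [right; left|left].
      right; right; split=> // Bx; apply: nU; rewrite -BF; by exists N.
  apply: le_lt_trans (measureU2 _ (measurableD mU (mB N)) (msd (mB N) mA)) _.
  by rewrite [e]splitr EFinD lteD.
Qed.

End approximation_by_algebra.

(** * Dyadic sets and domination of signed densities *)

Section dyadic_domination.
Context {R : realType} {n : nat}.
Implicit Types (k : nat) (x y : 'rV[R]_n) (E : set 'rV[R]_n).

(** Ceilings rather than floors make the cells half-open on the left, that is, instances of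
    [box]. *)
Definition same_cell k x y :=
  forall j, Num.ceil (2 ^+ k * x ord0 j) = Num.ceil (2 ^+ k * y ord0 j).

Let same_cell_sym k x y : same_cell k x y -> same_cell k y x.
Proof. by move=> h j; rewrite h. Qed.

Let same_cell_trans k x y z : same_cell k x y -> same_cell k y z -> same_cell k x z.
Proof. by move=> h1 h2 j; rewrite h1 h2. Qed.

Lemma same_cellS k x y : same_cell k.+1 x y -> same_cell k x y.
Proof.
move=> h j; have hj := h j; apply/esym/eqP; rewrite ceil_eq; set m := Num.ceil _.
have : Num.ceil (2 ^+ k * x ord0 j) == m by [].
rewrite ceil_eq => /andP[m1 m2].
have two (t : R) : 2 ^+ k.+1 * t = 2 * (2 ^+ k * t) by rewrite exprS mulrA.
have gt0 : (0 : R) < 2 by [].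
have e1 : (2 * (m - 1) < Num.ceil (2 ^+ k.+1 * y ord0 j))%R.
  by rewrite -hj ceil_gt_int two intrM ltr_pM2l.
have e2 : (Num.ceil (2 ^+ k.+1 * y ord0 j) <= 2 * m)%R.
  by rewrite -hj ceil_le_int two intrM ler_pM2l.
by move: e1 e2; rewrite ceil_gt_int ceil_le_int two !intrM ltr_pM2l// ler_pM2l// => -> ->.
Qed.

Lemma same_cell_leq k k' x y : (k <= k')%N -> same_cell k' x y -> same_cell k x y.
Proof.
move=> kk'; rewrite -(subnK kk'); elim: (_ - _)%N => // l ih h; apply: ih.
exact: same_cellS.
Qed.

Let pow2_gt0 k : (0 : R) < 2 ^+ k. Proof. by rewrite exprn_gt0. Qed.

Lemma same_cell_box k x : [set y | same_cell k x y] =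
  box (\row_j ((Num.ceil (2 ^+ k * x ord0 j) - 1)%:~R / 2 ^+ k))
      (\row_j ((Num.ceil (2 ^+ k * x ord0 j))%:~R / 2 ^+ k)).
Proof.
apply/seteqP; split=> y /= h j; have := h j; rewrite ?mxE.
  move=> /esym/eqP; rewrite ceil_eq ltr_pdivrMr// ler_pdivlMr//.
  by rewrite [_ * 2 ^+ k]mulrC.
by rewrite ltr_pdivrMr// ler_pdivlMr// [_ * 2 ^+ k]mulrC -ceil_eq => /eqP.
Qed.

(** Arbitrary unions of cells of one generation. Since generations refine each other, they form an
    algebra. *)
Definition dyadic_set : set (set 'rV[R]_n) :=
  [set E | exists k, forall x y, same_cell k x y -> E x -> E y].

(** Numbering the cells by natural numbers displays a dyadic set as a disjoint sequence of boxes, as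
    sigma-additivity requires. *)
Let cell_index k x : nat := pickle (\row_j Num.ceil (2 ^+ k * x ord0 j)).

Let cell_indexP k x y : cell_index k x = cell_index k y <-> same_cell k x y.
Proof.
split=> [/(pcan_inj pickleK)/rowP h j|h].
  by have := h j; rewrite !mxE.
by congr pickle; apply/rowP => j; rewrite !mxE h.
Qed.

Let piece k E l := E `&` [set x | cell_index k x = l].

Let pieceE k E l : (forall x y, same_cell k x y -> E x -> E y) ->
  piece k E l = set0 \/
  exists a b : 'rV[R]_n, (forall j, a ord0 j <= b ord0 j) /\ piece k E l = box a b.
Proof.
move=> Ek; have [->|/set0P[x [Ex xl]]] := eqVneq (piece k E l) set0; first by left.
right; exists (\row_j ((Num.ceil (2 ^+ k * x ord0 j) - 1)%:~R / 2 ^+ k)).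
exists (\row_j ((Num.ceil (2 ^+ k * x ord0 j))%:~R / 2 ^+ k)); split.
  by move=> j; rewrite !mxE ler_pM2r ?invr_gt0// ler_int lerBlDr lerDl.
rewrite -same_cell_box; apply/seteqP; split=> y /=.
  by move=> [_ yl]; apply/cell_indexP; rewrite yl.
move=> xy; split; first exact: Ek xy Ex.
by rewrite /= -xl; apply/cell_indexP; exact: same_cell_sym.
Qed.

Let piece_bigcup k E : \bigcup_l piece k E l = E.
Proof.
apply/seteqP; split=> [x [l _ []]//|x Ex]; by exists (cell_index k x).
Qed.

Let piece_trivIset k E : trivIset setT (piece k E).
Proof. by move=> l l' _ _ [x [[_ <-] [_ <-]]]. Qed.

Let measurable_piece k E l : (forall x y, same_cell k x y -> E x -> E y) ->
  measurable (piece k E l).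
Proof.
by move=> /(@pieceE _ _ l)[->//|[a [b [_ ->]]]]; exact: measurable_box.
Qed.

Lemma measurable_dyadic_set : dyadic_set `<=` measurable.
Proof.
move=> E [k Ek]; rewrite -(piece_bigcup k E); apply: bigcupT_measurable => l.
exact: measurable_piece.
Qed.

(** [V k] is the union of the generation-k cells contained in U; these exhaust U because the cells
    shrink. *)
Lemma open_dyadic_set (U : set 'rV[R]_n) : open U -> <<s dyadic_set >> U.
Proof.
move=> oU; pose V k := [set x | forall y, same_cell k x y -> U y].
rewrite (_ : U = \bigcup_k V k).
  apply: sigma_algebra_bigcup => k; apply: sub_sigma_algebra; exists k => x y xy Vx z yz.
  exact/Vx/(same_cell_trans xy yz).
apply/seteqP; split=> [x Ux|x [k _ Vx]]; last exact: Vx.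
have [e /= e0 eU] := (nbhs_ballP _ _).1 (open_nbhs_nbhs (conj oU Ux)).
have [k _ Hk] := near_infty_natSinv_expn_lt (PosNum e0).
exists k => //= y; rewrite -[X in X -> _]/([set y | same_cell k x y] y) same_cell_box => hy.
apply: eU; split=> // i j; rewrite (ord1 i).
have := hy j; rewrite !mxE ltr_pdivrMr// ler_pdivlMr//.
have := ceil_itv (2 ^+ k * x ord0 j); set m := Num.ceil _.
rewrite intrB => /andP[m1 m2] /andP[m3 m4].
have ek : 1 < e * 2 ^+ k.
  by have := Hk k (leqnn k); rewrite /= ltr_pdivrMr.
rewrite -ball_normE/= -(ltr_pM2r (pow2_gt0 k)) (le_lt_trans _ ek)//.
rewrite -[X in _ * X](gtr0_norm (pow2_gt0 k)) -normrM ler_norml mulrBl.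
by apply/andP; split; move: m1 m2 m3 m4; rewrite [2 ^+ k * _]mulrC; lra.
Qed.

(** The signed measure nu = f dx is compared with m on boxes, then on dyadic sets by
    sigma-additivity, then on Borel sets by approximation. *)
Lemma integral_le_of_box (f : 'rV[R]_n -> \bar R) (m : {finite_measure set 'rV[R]_n -> \bar R}) :
  (lebesgue_rV n).-integrable setT f ->
  (forall a b : 'rV[R]_n, (forall j, a ord0 j <= b ord0 j) ->
    (\int[lebesgue_rV n]_(x in box a b) f x <= m (box a b))%E) ->
  forall E, measurable E -> (\int[lebesgue_rV n]_(x in E) f x <= m E)%E.
Proof.
move=> fi fm.
pose nu : {charge set 'rV[R]_n -> \bar R} := induced_charge fi.
have dyad E : dyadic_set E -> (nu E <= m E)%E.
  move=> [k Ek]; rewrite -(piece_bigcup k E).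
  have mp l := @measurable_piece k E l Ek.
  have mE : measurable (\bigcup_l piece k E l) by exact: bigcupT_measurable.
  have c1 : (fun N => \sum_(0 <= l < N) nu (piece k E l))%E @ \oo -->
      nu (\bigcup_l piece k E l).
    by apply: charge_semi_sigma_additive.
  have c2 : (fun N => \sum_(0 <= l < N) m (piece k E l))%E @ \oo -->
      m (\bigcup_l piece k E l).
    by apply: measure_semi_sigma_additive.
  rewrite -(cvg_lim _ c1)// -(cvg_lim _ c2)//; apply: lee_lim.
  - by apply/cvg_ex; eexists; exact: c1.
  - by apply/cvg_ex; eexists; exact: c2.
  - apply: nearW => N; apply: lee_sum => l _.
    have [->|[a [b [ab ->]]]] := @pieceE k E l Ek; first by rewrite charge0 measure0.
    exact: fm.
have fi' := integrable_abse fi.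
have nu'_ge0 A : (0 <= induced_charge fi' A)%E by apply: integral_ge0 => x _; rewrite abse_ge0.
pose nu' := measure_of_charge (induced_charge fi') nu'_ge0.
have nu_le A : measurable A -> (`|nu A| <= nu' A)%E.
  move=> mA; apply: le_abse_integral => //.
  exact: measurable_funTS (measurable_int _ fi).
(* Approximating with respect to the sum of m and |f| dx lets one dyadic set control the errors of m
   and of nu together. *)
pose mu := measure_add m nu'.
have muE A : mu A = (m A + nu' A)%E by rewrite /mu measure_addE.
have mu_fin : (mu setT < +oo)%E.
  rewrite muE lte_add_pinfty//; first by rewrite -ge0_fin_numE// fin_num_measure.
  by have := (integrableP _ _ _ fi).2.
have sig : sigma_algebra setT (approximable mu dyadic_set).
  apply: sigma_algebra_approximable => //.
  - exact: measurable_dyadic_set.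
  - by exists 0%N.
  - by move=> A [k Ak]; exists k => x y xy nAx Ay; apply/nAx/(Ak _ _ _ Ay)/same_cell_sym.
  - move=> A B [k Ak] [l Bl]; exists (maxn k l) => x y xy [Ax|Bx]; [left|right].
      exact: Ak (same_cell_leq (leq_maxl _ _) xy) Ax.
    exact: Bl (same_cell_leq (leq_maxr _ _) xy) Bx.
have ap E : measurable E -> approximable mu dyadic_set E.
  suff : <<s @open 'rV[R]_n >> `<=` approximable mu dyadic_set by exact.
  apply: smallest_sub => [|U oU]; first exact: sig.
  have := open_dyadic_set oU; apply: smallest_sub; first exact: sig.
  move=> A GA; split; first exact: measurable_dyadic_set.
  by move=> e e0; exists A => //; rewrite setDv setU0 measure0 lte_fin.
move=> E mE; apply/lee_addgt0Pr => e e0.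
have [_ /(_ _ e0)[A GA]] := ap E mE.
have mA := measurable_dyadic_set GA.
have mEA := measurableD mE mA; have mAE := measurableD mA mE.
rewrite measureU//; last first.
  by apply/seteqP; split=> x //= [[? ?] [? ?]].
move=> small0.
have {small0} small : ((m (E `\` A) + nu' (E `\` A)) + (m (A `\` E) + nu' (A `\` E)) < e%:E)%E.
  by rewrite -!muE.
have nuE : (nu E = nu (E `&` A) + nu (E `\` A))%E.
  rewrite -chargeU//; [|exact: measurableI|by rewrite setDE setIACA setICr setI0].
  by rewrite setUIDK.
have nuA : (nu A = nu (E `&` A) + nu (A `\` E))%E.
  rewrite setIC -chargeU//; [|exact: measurableI|by rewrite setDE setIACA setICr setI0].
  by rewrite setUIDK.
have mAle : (m A <= m E + m (A `\` E))%E.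
  rewrite -measureU//; last by rewrite setDE setICA setICr setI0.
  apply: le_measure; rewrite ?inE//; first exact: measurableU.
  by move=> x Ax; have [Ex|nE] := pselect (E x); [left|right].
have := dyad A GA; have := nu_le _ mEA; have := nu_le _ mAE.
have finm B : measurable B -> m B \is a fin_num by exact: fin_num_measure.
have finnu B : measurable B -> nu B \is a fin_num by exact: fin_num_measure.
have finnu' B : measurable B -> nu' B \is a fin_num.
  by move=> mB; exact: (@fin_num_measure _ _ _ (induced_charge fi')).
(* What remains is arithmetic on finite values: nu(E) = nu(A) - nu(A \ E) + nu(E \ A) and m(A) <=
   m(E) + m(A \ E), with all errors absorbed by [small]. *)
suff H : ((`|nu (A `\` E)| <= nu' (A `\` E)) -> (`|nu (E `\` A)| <= nu' (E `\` A)) ->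
  (nu A <= m A) -> (nu E <= m E + e%:E))%E by exact: H.
rewrite nuE; have p0 : 0 <= fine (m (E `\` A)) by rewrite fine_ge0.
move: nuA mAle small.
have fin B : measurable B -> [/\ m B = (fine (m B))%:E, nu B = (fine (nu B))%:E &
    nu' B = (fine (nu' B))%:E] by move=> mB; rewrite !fineK ?finm ?finnu ?finnu'.
have [-> _ _] := fin _ mE; have [-> -> _] := fin _ mA.
have [-> -> ->] := fin _ mEA; have [-> -> ->] := fin _ mAE.
have [_ -> _] := fin _ (measurableI _ _ mE mA).
rewrite -!EFinD !abse_EFin !lee_fin !lte_fin !ler_norml => -[E0].
have {}E0 : fine (nu A) = fine (nu (E `&` A)) + fine (nu (A `\` E)) := E0.
move=> ? ? /andP[? ?] /andP[? ?] ?; lra.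
Qed.

(** E is cut along the sign of f, and the one-sided comparison is applied to f on one piece and to
    -f on the other. *)
Lemma abs_integral_le_of_box (f : 'rV[R]_n -> R) (m : {finite_measure set 'rV[R]_n -> \bar R}) :
  (lebesgue_rV n).-integrable setT (EFin \o f) ->
  (forall a b : 'rV[R]_n, (forall j, a ord0 j <= b ord0 j) ->
    (`|\int[lebesgue_rV n]_(x in box a b) (f x)%:E| <= m (box a b))%E) ->
  forall E, measurable E -> (\int[lebesgue_rV n]_(x in E) `|f x|%:E <= m E)%E.
Proof.
move=> fi fm E mE.
have mf : measurable_fun setT f by apply/measurable_EFinP; exact: measurable_int fi.
have mP : measurable [set x | 0 <= f x].
  rewrite -[X in measurable X]setTI -[X in _ `&` X]/(f @^-1` [set r | 0 <= r]).
  apply: mf => //; rewrite (_ : [set r | _] = `[0, +oo[%classic); first exact: measurable_itv.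
  by apply/seteqP; split=> r /=; rewrite in_itv/= andbT.
pose E1 := E `&` [set x | 0 <= f x]; pose E2 := E `\` [set x | 0 <= f x].
have mE1 : measurable E1 by exact: measurableI.
have mE2 : measurable E2 by exact: measurableD.
have E12 : E1 `|` E2 = E by rewrite /E1 /E2 setUIDK.
have d12 : E1 `&` E2 = set0 by rewrite /E1 /E2 setDE setIACA setICr setI0.
have fiN : (lebesgue_rV n).-integrable setT (fun x => - (f x)%:E)%E by exact: integrableN.
have H1 := @integral_le_of_box _ m fi (fun a b ab => le_trans (lee_abs _) (fm a b ab)) _ mE1.
have H2 : (\int[lebesgue_rV n]_(x in E2) (- (f x)%:E) <= m E2)%E.
  apply: integral_le_of_box => // a b ab.
  rewrite integralN; last first.
    apply: integrable_add_def; first exact: measurable_box.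
    exact: (integrableS measurableT (measurable_box a b) (@subsetT _ _) fi).
  by apply: le_trans (lee_abs _) _; rewrite abseN; exact: fm.
rewrite -E12 ge0_integral_setU//; first last.
- exact/disj_set2P.
- apply/measurable_funTS/measurable_EFinP; exact: measurableT_comp.
rewrite measureU//; apply: leeD.
  apply: le_trans H1; rewrite le_eqVlt; apply/orP; left; apply/eqP.
  by apply: eq_integral => x; rewrite inE => -[_ /= fx]; rewrite ger0_norm.
apply: le_trans H2; rewrite le_eqVlt; apply/orP; left; apply/eqP.
apply: eq_integral => x; rewrite inE => -[_ /= /negP]; rewrite -ltNge => fx.
by rewrite ltr0_norm.
Qed.

End dyadic_domination.

(** * Oscillation on cubes *)

Section tonelli_on_sets.
Context d1 d2 {T1 : measurableType d1} {T2 : measurableType d2} {R : realType}.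
Variables (m1 : {sigma_finite_measure set T1 -> \bar R})
  (m2 : {sigma_finite_measure set T2 -> \bar R}).
Variables (A : set T1) (B : set T2) (f : T1 * T2 -> \bar R).
Hypotheses (mA : measurable A) (mB : measurable B).
Hypotheses (mf : measurable_fun (A `*` B) f) (f0 : forall z, (0 <= f z)%E).

Let mAB : measurable (A `*` B). Proof. exact: measurableX. Qed.
Let g := f \_ (A `*` B).
Let mg : measurable_fun setT g. Proof. exact/(measurable_restrictT _ mAB). Qed.
Let g0 z : (0 <= g z)%E. Proof. by rewrite /g patchE; case: ifP. Qed.

Let inner1 : (fun x => \int[m2]_y g (x, y))%E =
  (fun x => \int[m2]_(y in B) f (x, y))%E \_ A.
Proof.
apply/funext => x; rewrite patchE; case: ifPn => xA.
  rewrite [RHS]integral_mkcond; apply: eq_integral => y _.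
  by rewrite /g !patchE in_setX /= xA.
rewrite integral0_eq// => y _; rewrite /g patchE in_setX/= (negPf xA)//.
Qed.

Let inner2 : (fun y => \int[m1]_x g (x, y))%E =
  (fun y => \int[m1]_(x in A) f (x, y))%E \_ B.
Proof.
apply/funext => y; rewrite patchE; case: ifPn => yB.
  rewrite [RHS]integral_mkcond; apply: eq_integral => x _.
  by rewrite /g !patchE in_setX /= yB andbT.
rewrite integral0_eq// => x _; rewrite /g patchE in_setX/= (negPf yB) andbF//.
Qed.

Lemma measurable_integral_on :
  measurable_fun A (fun x => \int[m2]_(y in B) f (x, y))%E.
Proof.
by apply/(measurable_restrictT _ mA); rewrite -inner1; exact: measurable_fun_fubini_tonelli_F.
Qed.

Lemma measurable_integral_on2 :
  measurable_fun B (fun y => \int[m1]_(x in A) f (x, y))%E.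
Proof.
by apply/(measurable_restrictT _ mB); rewrite -inner2; exact: measurable_fun_fubini_tonelli_G.
Qed.

Lemma tonelli_on : (\int[m1]_(x in A) \int[m2]_(y in B) f (x, y) =
  \int[m2]_(y in B) \int[m1]_(x in A) f (x, y))%E.
Proof.
rewrite [LHS]integral_mkcond -inner1 [RHS]integral_mkcond -inner2.
exact: fubini_tonelli.
Qed.

Lemma integral_setX : (\int[m1 \x m2]_(z in A `*` B) f z =
  \int[m1]_(x in A) \int[m2]_(y in B) f (x, y))%E.
Proof.
rewrite [LHS]integral_mkcond [RHS]integral_mkcond -inner1.
exact: fubini_tonelli1.
Qed.

End tonelli_on_sets.

(** If F exceeded k on all of Q, then F - k would be positive with integral 0, making Q a null
    set. *)
Lemma exists_le_average d {T : measurableType d} {R : realType}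
    (mu : {measure set T -> \bar R}) (Q : set T) (F : T -> \bar R) (k : R) :
  measurable Q -> (0 < mu Q < +oo)%E -> measurable_fun Q F -> 0 <= k ->
  (\int[mu]_(x in Q) F x <= k%:E * mu Q)%E -> exists2 x, Q x & (F x <= k%:E)%E.
Proof.
move=> mQ /andP[Q0 Qfin] mF k0 Fk; apply: contrapT => H.
have kF x : Q x -> (k%:E < F x)%E.
  by move=> Qx; rewrite ltNge; apply/negP => Fx; apply: H; exists x.
have H0 x : Q x -> (0 <= F x - k%:E)%E by move=> Qx; rewrite sube_ge0// ltW ?kF.
have mH : measurable_fun Q (fun x => F x - k%:E)%E.
  by apply: emeasurable_funB => //; exact: measurable_cst.
have FE : (\int[mu]_(x in Q) F x = \int[mu]_(x in Q) (F x - k%:E) + k%:E * mu Q)%E.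
  rewrite -integral_cst// -ge0_integralD//.
  by apply: eq_integral => x _; rewrite subeK.
have kfin : (k%:E * mu Q)%E \is a fin_num.
  by rewrite fin_numM// ge0_fin_numE.
have I0 : (\int[mu]_(x in Q) (F x - k%:E) = 0)%E.
  apply/eqP; rewrite eq_le integral_ge0// andbT.
  by move: Fk; rewrite FE -leeBrDr// subee.
have : ae_eq mu Q (fun x => F x - k%:E)%E (cst 0%E).
  apply/(ae_eq_integral_abs mu mQ mH).
  rewrite -[RHS]I0; apply: eq_integral => x; rewrite inE => Qx.
  by rewrite gee0_abs// H0.
move=> [N [mN N0 HN]].
have QN : Q `<=` N.
  move=> x Qx; apply: HN => /= /(_ Qx) E.
  by have := kF x Qx; rewrite -sube_gt0 E ltxx.
have QN0 : (mu Q <= mu N)%E by apply: le_measure; rewrite ?inE.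
by move: QN0; rewrite N0 leNgt Q0.
Qed.

Section cube_oscillation.
Context {R : realType} {n : nat}.
Variables (phi : 'rV[R]_n -> R) (m : 'I_n -> {finite_measure set 'rV[R]_n -> \bar R}).
Variable tv : {measure set 'rV[R]_n -> \bar R}.
Hypothesis iphi : (lebesgue_rV n).-integrable setT (EFin \o phi).
Hypothesis m_tv : forall i A, measurable A -> (m i A <= tv A)%E.
Hypothesis Hm : forall i psi, test_function psi -> measurable_fun setT psi ->
  (`|\int[lebesgue_rV n]_x (phi x * partial i psi x)%:E| <= \int[m i]_x `|psi x|%:E)%E.

Let mphi : measurable_fun setT phi.
Proof. by apply/measurable_EFinP; exact: measurable_int iphi. Qed.

Lemma shift_estimate i (h : R) (A B : set 'rV[R]_n) : 0 <= h ->
  measurable A -> measurable B ->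
  (forall x t, A x -> 0 <= t <= h -> B (x + t *: delta_mx ord0 i)) ->
  (\int[lebesgue_rV n]_(x in A) `|phi (x + h *: delta_mx ord0 i)%R - phi x|%:E
    <= h%:E * tv B)%E.
Proof.
move=> h0 mA mB AB.
apply: (@le_trans _ _ (sweep (m i) i h A)); last first.
  apply: le_trans (sweep_le (m i) h0 mA mB AB) _.
  by rewrite muleC lee_wpmul2l ?lee_fin// m_tv.
apply: (@abs_integral_le_of_box _ _ (fun x => phi (x + h *: delta_mx ord0 i) - phi x)) => //.
  have i1 := integrable_shift (h *: delta_mx ord0 i) iphi.
  exact: (integrableB measurableT i1 iphi).
by move=> a b ab; apply: box_difference => // psi; exact: Hm.
Qed.

(** The corners of the path from 0 to z that follows the coordinate axes in order. *)
Let zpart (z : 'rV[R]_n) (l : nat) : 'rV[R]_n := \row_j (if (j < l)%N then z ord0 j else 0).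

(** The shift is decomposed into n shifts along the axes. Coordinates of z are nonnegative because
    single shifts are estimated for h >= 0 only; the path stays within r + 4 r of c in each
    coordinate, whence the radius 5 r. *)
Lemma shift_cube_estimate (c z : 'rV[R]_n) (r : R) :
  (forall j, 0 <= z ord0 j <= 4 * r) ->
  (\int[lebesgue_rV n]_(x in cube c r) `|phi (x + z)%R - phi x|%:E
    <= (n%:R * (4 * r))%:E * tv (cube c (5 * r)))%E.
Proof.
move=> z4; have mQ := measurable_cube c r.
have z0 : zpart z 0 = 0 by apply/rowP => j; rewrite !mxE.
have zn : zpart z n = z by apply/rowP => j; rewrite !mxE ltn_ord.
have zS (i : 'I_n) : zpart z i.+1 = zpart z i + z ord0 i *: delta_mx ord0 i.
  apply/rowP => j; rewrite !mxE eqxx/= ltnS leq_eqVlt.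
  have [->|ji] := eqVneq j i; first by rewrite eqxx ltnn mulr1 add0r.
  by rewrite (_ : (j == i :> nat) = false) ?mulr0 ?addr0//; apply/negbTE.
have mshift (w : 'rV[R]_n) : measurable_fun setT (fun x : 'rV[R]_n => phi (x + w)).
  exact: (measurableT_comp mphi (measurable_addr_cst w)).
have mnorm (w v : 'rV[R]_n) :
    measurable_fun setT (fun x : 'rV[R]_n => `|phi (x + w) - phi (x + v)|%:E).
  apply/measurable_EFinP/measurableT_comp => //.
  by apply: measurable_funB; exact: mshift.
have step (i : 'I_n) : (\int[lebesgue_rV n]_(x in cube c r)
      `|phi (x + zpart z i.+1)%R - phi (x + zpart z i)%R|%:E
    <= (4 * r)%:E * tv (cube c (5 * r)))%E.
  have /andP[zi0 zi4] := z4 i.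
  pose g (x : 'rV[R]_n) := `|phi (x + z ord0 i *: delta_mx ord0 i)%R - phi x|%:E.
  rewrite (_ : (\int[_]_(x in _) _)%E =
      (\int[lebesgue_rV n]_(x in cube c r) g (x + zpart z i)%R)%E); last first.
    by apply: eq_integral => x _; rewrite /g zS addrA.
  have mg : measurable_fun setT g.
    by have := mnorm (z ord0 i *: delta_mx ord0 i) 0; under eq_fun do rewrite addr0.
  rewrite ge0_integral_shift_on//; last by move=> x; rewrite lee_fin.
  apply: (@le_trans _ _ ((z ord0 i)%:E * tv (cube c (5 * r)))%E); last first.
    by apply: lee_wpmul2r => //; rewrite lee_fin.
  apply: shift_estimate => //.
  - by rewrite -[X in measurable X]setTI; exact: measurable_addr_cst.
  - exact: measurable_cube.
  - move=> x t /= Qx /andP[t0 tz] j; have := Qx j; have /andP[zj0 zj4] := z4 j.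
    rewrite !mxE !ltr_norml eqxx/=.
    have [->|ji] := eqVneq j i.
      by rewrite ltnn mulr1 => /andP[? ?]; apply/andP; split; lra.
    by rewrite mulr0; case: ifP => _ /andP[? ?]; apply/andP; split; lra.
have telescope l : (l <= n)%N -> (\int[lebesgue_rV n]_(x in cube c r)
      `|phi (x + zpart z l)%R - phi x|%:E
    <= (l%:R * (4 * r))%:E * tv (cube c (5 * r)))%E.
  elim: l => [_|l ih ln].
    rewrite integral0_eq ?mul0r ?mul0e// => x _.
    by rewrite z0 addr0 subrr normr0.
  have m1 := mnorm (zpart z l.+1) (zpart z l).
  have m2 : measurable_fun setT (fun x : 'rV[R]_n => `|phi (x + zpart z l) - phi x|%:E).
    by have := mnorm (zpart z l) 0; under eq_fun do rewrite addr0.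
  apply: (@le_trans _ _ (\int[lebesgue_rV n]_(x in cube c r)
      (`|phi (x + zpart z l.+1)%R - phi (x + zpart z l)%R|%:E +
       `|phi (x + zpart z l)%R - phi x|%:E))%E).
    apply: ge0_le_integral => //.
    - by have := mnorm (zpart z l.+1) 0; under eq_fun do rewrite addr0; exact: measurable_funTS.
    - by apply: emeasurable_funD; exact: measurable_funTS.
    - by move=> x _; rewrite -EFinD lee_fin ler_distD.
  rewrite ge0_integralD//; [|exact: measurable_funTS|exact: measurable_funTS].
  rewrite -(addn1 l) natrD mulrDl EFinD ge0_muleDl ?lee_fin ?mulr_ge0//; first last.
  - by have /andP[a b] := z4 (Ordinal ln); have := le_trans a b; lra.
  - by have /andP[a b] := z4 (Ordinal ln); have := le_trans a b; lra.
  rewrite addeC mul1r; apply: leeD; first exact/ih/ltnW.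
  by rewrite addn1; exact: (step (Ordinal ln)).
by have := telescope n (leqnn n); rewrite zn.
Qed.

(** The constant is the value of phi at a point x of an auxiliary cube Q, chosen so that the mean
    over shifts z in Z of |phi(x + z) - phi(x)| is at most average. The factor 2^n is the ratio of
    the volumes of Z and Q. *)
Lemma cube_oscillation (a : 'rV[R]_n) (r : R) : 0 < r -> (tv setT < +oo)%E ->
  exists c, (\int[lebesgue_rV n]_(x in cube a r) `|phi x - c|%:E
    <= (2 ^+ n * (n%:R * (4 * r)))%:E * tv (cube a (7 * r)))%E.
Proof.
move=> r0 tvfin.
(* Q is moved down by 2 r in every coordinate so that y - x has coordinates in ]0, 4 r[ for x in Q
   and y in [cube a r]. The shifts then stay in the cube of radius 5 r around a - e, inside the one
   of radius 7 r around a. *)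
pose e : 'rV[R]_n := const_mx (2 * r).
pose Q := cube (a - e) r; pose Z := cube e (2 * r).
have mQ : measurable Q := measurable_cube _ _.
have mZ : measurable Z := measurable_cube _ _.
pose f (w : 'rV[R]_n * 'rV[R]_n) := `|phi (w.1 + w.2) - phi w.1|%:E.
have mf : measurable_fun setT f.
  apply/measurable_EFinP/measurableT_comp => //; apply: measurable_funB.
    apply: (measurableT_comp mphi); apply: measurable_addrV.
      exact: measurable_fst.
    exact: measurable_snd.
  exact: (measurableT_comp mphi measurable_fst).
have f0 w : (0 <= f w)%E by rewrite lee_fin.
have tv7 : tv (cube a (7 * r)) \is a fin_num.
  rewrite ge0_fin_numE//; apply: le_lt_trans tvfin.
  by apply: le_measure; rewrite ?inE//; exact: measurable_cube.
pose K := n%:R * (4 * r) * fine (tv (cube a (7 * r))).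
have K0 : 0 <= K by rewrite mulr_ge0 ?fine_ge0// mulr_ge0// mulr_ge0// ltW.
have KE : (K%:E = (n%:R * (4 * r))%:E * tv (cube a (7 * r)))%E by rewrite /K EFinM fineK.
have inner z : Z z -> (\int[lebesgue_rV n]_(x in Q) f (x, z) <= K%:E)%E.
  move=> Zz; apply: (@le_trans _ _ ((n%:R * (4 * r))%:E * tv (cube (a - e) (5 * r)))%E).
    apply: shift_cube_estimate => j; have := Zz j; rewrite mxE ltr_norml.
    by move=> /andP[? ?]; apply/andP; split; lra.
  rewrite KE; apply: lee_wpmul2l.
    by rewrite lee_fin mulr_ge0// mulr_ge0// ltW.
  apply: le_measure; rewrite ?inE; [exact: measurable_cube|exact: measurable_cube|].
  move=> x Hx j; have := Hx j; rewrite !mxE !ltr_norml => /andP[? ?].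
  by apply/andP; split; lra.
have total : (\int[lebesgue_rV n]_(x in Q) \int[lebesgue_rV n]_(z in Z) f (x, z)
    <= (2 ^+ n * K)%:E * lebesgue_rV n Q)%E.
  rewrite tonelli_on//; last exact: measurable_funTS.
  apply: (@le_trans _ _ (\int[lebesgue_rV n]_(z in Z) K%:E)%E).
    apply: ge0_le_integral => //.
    - by move=> z _; exact: integral_ge0.
    - by apply: measurable_integral_on2 => //; exact: measurable_funTS.
  have EZ : lebesgue_rV n Z = ((2 * (2 * r)) ^+ n)%:E by apply: lebesgue_rV_cube; lra.
  have -> : (\int[lebesgue_rV n]_(z in Z) K%:E = K%:E * ((2 * (2 * r)) ^+ n)%:E)%E.
    by rewrite integral_cst//; congr (_ * _)%E.
  rewrite (@lebesgue_rV_cube _ _ (a - e)); last lra.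
  by rewrite -!EFinM lee_fin exprMn; lra.
have [x Qx Fx] : exists2 x, Q x &
    (\int[lebesgue_rV n]_(z in Z) f (x, z) <= (2 ^+ n * K)%:E)%E.
  apply: (exists_le_average mQ _ _ _ total).
  - apply/andP; split; first exact: lebesgue_rV_cube_gt0.
    exact: lebesgue_rV_cube_lty (ltW r0).
  - by apply: measurable_integral_on => //; exact: measurable_funTS.
  - by rewrite mulr_ge0// exprn_ge0.
exists (phi x); rewrite EFinM -muleA -KE -EFinM.
apply: le_trans Fx.
pose g (y : 'rV[R]_n) := `|phi y - phi x|%:E.
have mg : measurable_fun setT g.
  by apply/measurable_EFinP/measurableT_comp => //; apply: measurable_funB.
have g0 y : (0 <= g y)%E by rewrite lee_fin.
rewrite (_ : (\int[_]_(z in Z) _)%E = (\int[lebesgue_rV n]_(z in Z) g (z + x)%R)%E); last first.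
  by apply: eq_integral => z _; rewrite /f/= [x + z]addrC.
rewrite ge0_integral_shift_on//; apply: ge0_subset_integral => //.
- exact: measurable_cube.
- by rewrite -[X in measurable X]setTI; exact: measurable_addr_cst.
- exact: measurable_funTS.
- move=> y ya j; have := ya j; have := Qx j; rewrite !mxE !ltr_norml.
  by move=> /andP[? ?] /andP[? ?]; apply/andP; split; lra.
Qed.

End cube_oscillation.

(** * Riesz potentials *)

Section riesz_kernel.
Context {R : realType} {n : nat}.
Implicit Types x y a : 'rV[R]_n.

Lemma enormN x : enorm (- x) = enorm x.
Proof. by rewrite /enorm; congr Num.sqrt; apply: eq_bigr => i _; rewrite mxE sqrrN. Qed.

Lemma enorm_distC x y : enorm (x - y) = enorm (y - x).
Proof. by rewrite -enormN opprB. Qed.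

Lemma enorm_eq0 x : (enorm x == 0) = (x == 0).
Proof.
apply/eqP/eqP => [x0|->]; last exact: enorm0.
apply/rowP => i; rewrite mxE; apply/eqP; rewrite -normr_le0 -x0; exact: coord_le_enorm.
Qed.

Lemma enorm_gt0 x : (0 < enorm x) = (x != 0).
Proof. by rewrite lt0r enorm_eq0 enorm_ge0 andbT. Qed.

Lemma enorm_cube a r y : 0 <= r -> cube a r y -> enorm (a - y) <= n%:R * r.
Proof.
move=> r0 ya; apply: le_trans (enorm_le_sum _) _.
rewrite mulr_natl -[X in _ *+ X]card_ord -sumr_const; apply: ler_sum => i _.
by rewrite !mxE distrC; exact/ltW/ya.
Qed.

Lemma measurable_enormB d (T : measurableType d) (f g : T -> 'rV[R]_n) :
  measurable_fun setT f -> measurable_fun setT g ->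
  measurable_fun setT (fun t => enorm (f t - g t)).
Proof.
move=> mf mg; apply: (measurableT_comp measurable_enorm).
by apply: measurable_addrV => //; exact: measurable_opprV.
Qed.

Lemma measurable_riesz_kernel (e : R) : measurable_fun setT
  (fun z : 'rV[R]_n * 'rV[R]_n => if z.1 == z.2 then +oo%E else (enorm (z.1 - z.2) `^ e)%:E).
Proof.
have mB : measurable_fun setT (fun z : 'rV[R]_n * 'rV[R]_n => enorm (z.1 - z.2)).
  by apply: measurable_enormB; [exact: measurable_fst|exact: measurable_snd].
apply: measurable_fun_ifT.
- rewrite (_ : (fun z => _) = (fun z : 'rV[R]_n * 'rV[R]_n => enorm (z.1 - z.2) == 0)).
    by apply: measurable_fun_eqr => //; exact: measurable_cst.
  by apply/funext => z; rewrite enorm_eq0 subr_eq0.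
- exact: measurable_cst.
- by apply/measurable_EFinP; exact: (measurableT_comp (measurable_powR e) mB).
Qed.

Lemma ler_powR_neg (e x y : R) : e <= 0 -> 0 < x -> x <= y -> y `^ e <= x `^ e.
Proof.
move=> e0 x0 xy; have y0 := lt_le_trans x0 xy.
rewrite -[e]opprK (powRN y) (powRN x) lef_pV2 ?posrE ?powR_gt0//.
by apply: ge0_ler_powR; rewrite ?nnegrE ?oppr_ge0//; exact: ltW.
Qed.

Lemma riesz_potential_ge0 e (m : {measure set 'rV[R]_n -> \bar R}) x :
  (0 <= riesz_potential e m x)%E.
Proof. by apply: integral_ge0 => y _; case: ifP => // _; rewrite lee_fin powR_ge0. Qed.

(** The exponent e - n is nonpositive, so on the cube the kernel is at least its value at distance n
    r; at y = a it is +oo. *)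
Lemma cube_le_riesz_potential (e : R) (m : {measure set 'rV[R]_n -> \bar R}) a r :
  (0 < n)%N -> 0 < r -> e <= n%:R ->
  (((n%:R * r) `^ (e - n%:R))%:E * m (cube a r) <= riesz_potential e m a)%E.
Proof.
move=> n0 r0 en.
pose k y := if a == y then +oo%E else (enorm (a - y) `^ (e - n%:R))%:E.
have mk : measurable_fun setT k.
  exact: (measurableT_comp (measurable_riesz_kernel (e - n%:R)) (measurable_pair1 a)).
have k0 y : (0 <= k y)%E by rewrite /k; case: ifP => // _; rewrite lee_fin powR_ge0.
have mQ := measurable_cube a r.
apply: (@le_trans _ _ (\int[m]_(y in cube a r) k y)%E); last first.
  by apply: ge0_subset_integral.
rewrite -integral_cst//; apply: ge0_le_integral => //.
- by move=> y _; rewrite lee_fin powR_ge0.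
- exact: measurable_funTS.
- move=> y Qy; rewrite /k; case: eqVneq => [_|ay]; first by rewrite leey.
  rewrite lee_fin; apply: ler_powR_neg; first by rewrite subr_le0.
    by rewrite enorm_gt0 subr_eq0.
  exact: enorm_cube (ltW r0) Qy.
Qed.

End riesz_kernel.

(** With t_j the tail of the geometric series, the intervals [c_j - t_j, c_j + t_j] are nested, and
    the supremum of their left ends lies in all of them. *)
Lemma geometric_increments {R : realType} (c : nat -> R) (K q : R) :
  0 <= K -> 0 <= q < 1 -> (forall j, `|c j.+1 - c j| <= K * q ^+ j) ->
  exists l, forall j, `|c j - l| <= K / (1 - q) * q ^+ j.
Proof.
move=> K0 /andP[q0 q1] cK.
have q1' : 0 < 1 - q by rewrite subr_gt0.
pose t j := K / (1 - q) * q ^+ j.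
have tS j : t j - t j.+1 = K * q ^+ j.
  by rewrite /t exprS; field; rewrite gt_eqF.
have t0 j : 0 <= t j by rewrite /t mulr_ge0 ?exprn_ge0// divr_ge0// ltW.
have up j l : (j <= l)%N -> c j - t j <= c l - t l.
  move=> jl; rewrite -(subnK jl); elim: (l - j)%N => // m ih.
  apply: le_trans ih _; rewrite addSn; have := cK (m + j)%N; have := tS (m + j)%N.
  by rewrite ler_norml => ? /andP[? ?]; lra.
have dn j l : (j <= l)%N -> c l + t l <= c j + t j.
  move=> jl; rewrite -(subnK jl); elim: (l - j)%N => // m ih.
  apply: le_trans _ ih; rewrite addSn; have := cK (m + j)%N; have := tS (m + j)%N.
  by rewrite ler_norml => ? /andP[? ?]; lra.
have cross j l : c j - t j <= c l + t l.
  have := up j _ (leq_maxl j l); have := dn l _ (leq_maxr j l).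
  by have := t0 (maxn j l); lra.
exists (sup (range (fun j => c j - t j))) => j.
have hs : has_sup (range (fun j => c j - t j)).
  split; first by exists (c 0%N - t 0%N); exists 0%N.
  by exists (c 0%N + t 0%N) => _ [l _ <-].
have h1 : c j - t j <= sup (range (fun j => c j - t j)).
  by apply: sup_upper_bound => //; exists j.
have h2 : sup (range (fun j => c j - t j)) <= c j + t j.
  by apply: ge_sup; [exact: hs.1|move=> _ [l _ <-]; exact: cross].
by rewrite -/(t j) ler_norml; apply/andP; split; lra.
Qed.

Lemma dyadic_scale {R : realType} (r rho : R) : 0 < rho <= r ->
  exists j : nat, rho <= r / 2 ^+ j <= 2 * rho.
Proof.
move=> /andP[rho0 rhor].
have ex : exists j : nat, r / 2 ^+ j < rho.
  have e0 : 0 < rho / r by rewrite divr_gt0// (lt_le_trans rho0).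
  have [j _ Hj] := near_infty_natSinv_expn_lt (PosNum e0).
  exists j; have := Hj j (leqnn j); rewrite /= ltr_pdivlMr ?(lt_le_trans rho0)//.
  by rewrite div1r mulrC.
case: (ex_minnP ex) => -[|j] jr jmin.
  by move: jr; rewrite expr0 divr1 ltNge rhor.
exists j; apply/andP; split.
  by rewrite leNgt; apply/negP => /jmin; rewrite ltnn.
move: jr; rewrite exprS invfM mulrCA ltr_pdivrMl// => /ltW; exact.
Qed.

(** * Lebesgue points *)

Lemma powR_exprn {R : realType} (x a : R) (j : nat) : 0 <= x -> (x ^+ j) `^ a = (x `^ a) ^+ j.
Proof.
move=> x0; elim: j => [|j ih]; first by rewrite !expr0 powR1.
by rewrite !exprS powRM ?exprn_ge0// ih.
Qed.

Lemma half_powR_lt1 {R : realType} (a : R) : 0 < a -> 2^-1 `^ a < 1 :> R.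
Proof.
move=> a0; have := @gt0_ltr_powR R a a0 2^-1 1.
by rewrite powR1; apply; rewrite ?nnegrE ?invr_ge0// invf_lt1// ltr1n.
Qed.

(** The first two factors are those of [cube_oscillation]; the power of 7 n comes from the lower
    bound of the kernel on the cube of radius 7 r. *)
Definition oscillation_cst {R : realType} (n : nat) (s : R) : R :=
  2 ^+ n * (n%:R * 4) * (n%:R * 7) `^ (n%:R - (1 - s)).

(** Inside the parentheses, 1 is the oscillation at one dyadic radius and 2 / (1 - 2^(-s)) the sum
    of the later increments, each comparing two oscillations. The remaining powers of 2 come from
    volumes and from replacing a radius by a dyadic one at most twice as large. *)
Definition lebesgue_point_cst {R : realType} (n : nat) (s : R) : R :=
  oscillation_cst n s * (1 + 2 / (1 - 2^-1 `^ s)) * 2 `^ s * 2 ^+ n.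

Section lebesgue_points.
Context {R : realType} {n : nat}.
Hypothesis n0 : (0 < n)%N.
Variables (phi : 'rV[R]_n -> R) (s : R).
Hypothesis bv : BV phi.
Hypothesis s01 : 0 < s < 1.

Local Notation tv := (tvar (gradient_measure phi)).
Local Notation U := (gradient_potential phi s).

Let iphi : (lebesgue_rV n).-integrable setT (EFin \o phi). Proof. by case: bv. Qed.

Let mphi : measurable_fun setT phi.
Proof. by apply/measurable_EFinP; exact: measurable_int iphi. Qed.

Let mdist c : measurable_fun setT (fun x => `|phi x - c|%:E).
Proof. by apply/measurable_EFinP/measurableT_comp => //; exact: measurable_funB. Qed.

Let dist_ge0 c x : (0 <= `|phi x - c|%:E)%E. Proof. by rewrite lee_fin. Qed.

Let C0 : R := oscillation_cst n s.

Let C0_ge0 : 0 <= C0. Proof. by rewrite mulr_ge0 ?powR_ge0// mulr_ge0// exprn_ge0. Qed.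

Let u a := fine (U a).

Let u_ge0 a : 0 <= u a. Proof. by rewrite fine_ge0// riesz_potential_ge0. Qed.

Let oscillation a r : (U a < +oo)%E -> 0 < r -> exists c,
  (\int[lebesgue_rV n]_(x in cube a r) `|phi x - c|%:E <= (C0 * u a * r `^ s * r ^+ n)%:E)%E.
Proof.
move=> Ua r0; have /andP[s0 s1] := s01.
have [m [m_tv Hm]] := BV_gradient_bound bv.
have tvfin : (tv setT < +oo)%E by rewrite -ge0_fin_numE ?measure_ge0//; exact: fin_num_measure.
have [c Hc] := cube_oscillation iphi m_tv Hm a r0 tvfin.
exists c; apply: le_trans Hc _.
have r7 : 0 < 7 * r by rewrite mulr_gt0.
have en : 1 - s <= n%:R.
  by apply: (@le_trans _ _ 1); [rewrite lerBlDr lerDl ltW|rewrite ler1n].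
have tv7 : tv (cube a (7 * r)) \is a fin_num by apply: fin_num_measure; exact: measurable_cube.
have Ufin : U a \is a fin_num by rewrite ge0_fin_numE ?riesz_potential_ge0.
pose t := fine (tv (cube a (7 * r))).
have tu : (n%:R * (7 * r)) `^ (1 - s - n%:R) * t <= u a.
  rewrite -lee_fin EFinM /t /u (fineK tv7) (fineK Ufin).
  exact: cube_le_riesz_potential.
suff : ((2 ^+ n * (n%:R * (4 * r)))%:E * t%:E <= (C0 * u a * r `^ s * r ^+ n)%:E)%E.
  by rewrite /t (fineK tv7).
rewrite -EFinM lee_fin; move: tu.
rewrite -[1 - s - n%:R]opprB powRN ler_pdivrMl; last first.
  by rewrite powR_gt0// mulr_gt0// ltr0n.
move=> tu.
apply: (@le_trans _ _ (2 ^+ n * (n%:R * (4 * r)) * ((n%:R * (7 * r)) `^ (n%:R - (1 - s)) * u a))).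
  by rewrite ler_wpM2l// mulr_ge0 ?exprn_ge0// mulr_ge0// mulr_ge0// ltW.
have E : r `^ s * r ^+ n = r * r `^ (n%:R - (1 - s)).
  rewrite -powR_mulrn ?ltW// -{3}[r]powRr1 ?ltW// -!powRD; last 2 first.
  - by rewrite (gt_eqF r0) implybT.
  - by rewrite (gt_eqF r0) implybT.
  by congr powR; ring.
rewrite le_eqVlt; apply/orP; left; apply/eqP.
rewrite -[RHS]mulrA E /C0 /oscillation_cst [n%:R * (7 * r)]mulrA.
rewrite (_ : (n%:R * 7 * r) `^ _ =
    (n%:R * 7) `^ (n%:R - (1 - s)) * r `^ (n%:R - (1 - s))); last first.
  by apply: powRM; [rewrite mulr_ge0|exact: ltW].
move: (r `^ _) ((n%:R * 7) `^ _) (u a) (2 ^+ n) => X Y Z W; ring.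
Qed.

Let cst_cube a r (c : R) : 0 <= r ->
  (\int[lebesgue_rV n]_(x in cube a r) c%:E = (c * (2 * r) ^+ n)%:E)%E.
Proof.
move=> r0; rewrite integral_cst; last exact: measurable_cube.
by rewrite EFinM; congr (_ * _)%E; exact: lebesgue_rV_cube.
Qed.

(* Two constants that are both close to phi in mean on a cube are close. *)
Let cst_dist a r (c d E F : R) : 0 <= r ->
  (\int[lebesgue_rV n]_(x in cube a r) `|phi x - c|%:E <= E%:E)%E ->
  (\int[lebesgue_rV n]_(x in cube a r) `|phi x - d|%:E <= F%:E)%E ->
  `|c - d| * (2 * r) ^+ n <= E + F.
Proof.
move=> r0 cE dF; rewrite -lee_fin -(cst_cube a)// EFinD.
apply: le_trans (leeD cE dF).
rewrite -ge0_integralD//; [|exact: measurable_cube|exact: measurable_funTS|exact: measurable_funTS].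
apply: ge0_le_integral => //.
- exact: measurable_cube.
- by apply: emeasurable_funD; exact: measurable_funTS.
- by move=> x _; rewrite -EFinD lee_fin [X in _ <= X + _]distrC ler_distD.
Qed.

Let C1 : R := lebesgue_point_cst n s.

Let half_lt1 : 0 <= (2^-1 : R) `^ s < 1.
Proof. by rewrite powR_ge0 half_powR_lt1//; case/andP: s01. Qed.

Let C1_ge0 : 0 <= C1.
Proof.
have /andP[_ q1] := half_lt1.
rewrite /C1 /lebesgue_point_cst mulr_ge0 ?exprn_ge0// mulr_ge0 ?powR_ge0//.
by rewrite mulr_ge0// addr_ge0// divr_ge0// subr_ge0 ltW.
Qed.

(** The limit l of the dyadic constants is independent of rho; for a given rho the estimate is taken
    from the dyadic cube of radius between rho and 2 rho. *)
Let mean_limit a r : (U a < +oo)%E -> 0 < r -> exists l, forall rho, 0 < rho <= r ->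
  (\int[lebesgue_rV n]_(x in cube a rho) `|phi x - l|%:E <=
    (C1 * u a * rho `^ s * rho ^+ n)%:E)%E.
Proof.
move=> Ua r0; have /andP[s0 s1] := s01.
have rj0 j : 0 < r / 2 ^+ j by rewrite divr_gt0// exprn_gt0.
have /choice[c Hc] j := oscillation Ua (rj0 j).
pose q : R := 2^-1 `^ s.
have rjs j : (r / 2 ^+ j) `^ s = r `^ s * q ^+ j.
  rewrite powRM ?(ltW r0) ?invr_ge0 ?exprn_ge0//; congr (_ * _).
  by rewrite -exprVn; apply: powR_exprn; rewrite invr_ge0.
have subcube b p p' : p <= p' -> cube b p `<=` cube b p'.
  by move=> pp x h j; exact: lt_le_trans (h j) pp.
have incr j : `|c j.+1 - c j| <= (2 * C0 * u a * r `^ s) * q ^+ j.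
  (* The smaller cube has side r_j, so its volume r_j^n cancels the same power in both oscillation
     bounds. *)
  have rjS : 2 * (r / 2 ^+ j.+1) = r / 2 ^+ j by rewrite exprS invfM mulrCA mulVKf.
  have rjSle : r / 2 ^+ j.+1 <= r / 2 ^+ j by have := rj0 j.+1; lra.
  have E1 : (\int[lebesgue_rV n]_(x in cube a (r / 2 ^+ j.+1)) `|phi x - c j|%:E <=
      (C0 * u a * (r / 2 ^+ j) `^ s * (r / 2 ^+ j) ^+ n)%:E)%E.
    apply: le_trans (Hc j); apply: ge0_subset_integral => //.
    - exact: measurable_cube.
    - exact: measurable_cube.
    - exact: measurable_funTS.
    - exact: subcube.
  have E2 : (\int[lebesgue_rV n]_(x in cube a (r / 2 ^+ j.+1)) `|phi x - c j.+1|%:E <=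
      (C0 * u a * (r / 2 ^+ j) `^ s * (r / 2 ^+ j) ^+ n)%:E)%E.
    apply: le_trans (Hc j.+1) _; rewrite lee_fin ler_pM//.
    - by rewrite mulr_ge0 ?powR_ge0// mulr_ge0.
    - by rewrite exprn_ge0// ltW.
    - rewrite ler_wpM2l ?mulr_ge0//; apply: ge0_ler_powR; rewrite ?nnegrE//; exact: ltW.
    - by rewrite lerXn2r ?nnegrE//; exact: ltW.
  have := cst_dist (ltW (rj0 j.+1)) E2 E1; rewrite rjS -mulrDl ler_pM2r ?exprn_gt0// rjs.
  by move=> h; apply: le_trans h _; rewrite le_eqVlt; apply/orP; left; apply/eqP; ring.
have K0 : 0 <= 2 * C0 * u a * r `^ s by rewrite mulr_ge0 ?powR_ge0// mulr_ge0// mulr_ge0.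
have [l Hl] := geometric_increments K0 half_lt1 incr.
exists l => rho /[dup] rhor /andP[rho0 _].
have [j /andP[j1 j2]] := dyadic_scale rhor.
have q1 : 0 < 1 - q by have /andP[_ ?] := half_lt1; rewrite subr_gt0.
set rj := r / 2 ^+ j in j1 j2.
have rjs2 : rj `^ s <= 2 `^ s * rho `^ s.
  rewrite -powRM ?(ltW rho0)//; apply: ge0_ler_powR; rewrite ?nnegrE ?(ltW s0)//.
    exact/ltW/rj0.
  by rewrite mulr_ge0// ltW.
have rjn2 : rj ^+ n <= 2 ^+ n * rho ^+ n.
  by rewrite -exprMn lerXn2r ?nnegrE ?mulr_ge0// ltW//; exact: rj0.
apply: (@le_trans _ _ (\int[lebesgue_rV n]_(x in cube a rho)
    (`|phi x - c j|%:E + `|c j - l|%:E))%E).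
  apply: ge0_le_integral => //.
  - exact: measurable_cube.
  - exact: measurable_funTS.
  - by apply: emeasurable_funD => //; exact: measurable_funTS.
  - by move=> x _; rewrite -EFinD lee_fin ler_distD.
rewrite ge0_integralD//; [|exact: measurable_cube|exact: measurable_funTS].
rewrite cst_cube; last exact: ltW.
apply: (@le_trans _ _ ((C0 * u a * rj `^ s * rj ^+ n)%:E +
    (2 * C0 * u a / (1 - q) * rj `^ s * (2 * rho) ^+ n)%:E)%E).
  apply: leeD.
    apply: le_trans (Hc j); apply: ge0_subset_integral => //.
    - exact: measurable_cube.
    - exact: measurable_cube.
    - exact: measurable_funTS.
    - exact: subcube.
  rewrite lee_fin ler_wpM2r ?exprn_ge0 ?mulr_ge0 ?(ltW rho0)//.
  apply: le_trans (Hl j) _; rewrite rjs -/q le_eqVlt; apply/orP; left; apply/eqP; ring.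
rewrite -EFinD lee_fin.
have A1 : C0 * u a * rj `^ s * rj ^+ n <= C0 * u a * (2 `^ s * rho `^ s) * (2 ^+ n * rho ^+ n).
  rewrite ler_pM// ?mulr_ge0 ?powR_ge0 ?exprn_ge0 ?(ltW (rj0 j))//.
  by rewrite ler_wpM2l// mulr_ge0.
have A2 : 2 * C0 * u a / (1 - q) * rj `^ s * (2 * rho) ^+ n <=
    2 * C0 * u a / (1 - q) * (2 `^ s * rho `^ s) * (2 ^+ n * rho ^+ n).
  rewrite exprMn ler_wpM2r ?mulr_ge0 ?exprn_ge0 ?(ltW rho0)//.
  by rewrite ler_wpM2l// divr_ge0 ?(ltW q1)// mulr_ge0// mulr_ge0.
apply: le_trans (lerD A1 A2) _.
rewrite le_eqVlt; apply/orP; left; apply/eqP.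
by rewrite /C1 /lebesgue_point_cst -/C0 -/q; field; rewrite gt_eqF.
Qed.

Let measurable_euclidean_ball (a : 'rV[R]_n) (rho : R) : measurable (euclidean_ball a rho).
Proof.
rewrite (_ : euclidean_ball a rho = setT `&` (fun z => enorm (z - a)) @^-1` `]-oo, rho[%classic).
  by apply: measurable_enormB => //; exact: measurable_cst.
by rewrite setTI; apply/seteqP; split=> z /=; rewrite /euclidean_ball/= in_itv.
Qed.

(** Approximate limits are defined with Euclidean balls. The ball lies between the cubes of radius
    rho / (2 n) and rho, so passing to means costs only the factor n^n. *)
Let mean_limit_approximate a r l : 0 < r -> (forall rho, 0 < rho <= r ->
  (\int[lebesgue_rV n]_(x in cube a rho) `|phi x - l|%:E <=
    (C1 * u a * rho `^ s * rho ^+ n)%:E)%E) -> approximate_limit phi a l.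
Proof.
move=> r0 H; have /andP[s0 s1] := s01.
pose K := n%:R ^+ n * C1 * u a.
have cK : ((K * rho `^ s)%:E @[rho --> 0^'+] --> 0%E).
  apply: cvg_EFin; first exact: nearW.
  rewrite -[X in _ --> X](mulr0 K); apply: cvgMl_tmp; exact: powR_cvg0.
apply: (squeeze_cvge _ (cvg_cst 0%E) cK).
near=> rho.
have rho0 : 0 < rho by near: rho; exact: nbhs_right_gt.
have rhor : rho <= r by near: rho; exact: nbhs_right_le.
have nR : 0 < n%:R :> R by rewrite ltr0n.
set B := euclidean_ball a rho.
have mB : measurable B := measurable_euclidean_ball a rho.
have cubeB : cube a (rho / (2 * n%:R)) `<=` B.
  move=> z Hz; rewrite /B /euclidean_ball/= enorm_distC.
  have e0 : 0 < rho / (2 * n%:R) by rewrite divr_gt0// mulr_gt0.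
  apply: le_lt_trans (enorm_cube (ltW e0) Hz) _.
  have -> : n%:R * (rho / (2 * n%:R)) = rho / 2 by field; rewrite gt_eqF.
  by rewrite gtr_pMr// invf_lt1// ltr1n.
have Bcube : B `<=` cube a rho.
  move=> z Hz j; apply: le_lt_trans Hz.
  by have := coord_le_enorm (z - a) j; rewrite !mxE.
have vol_ge : (((rho / n%:R) ^+ n)%:E <= lebesgue_rV n B)%E.
  apply: (@le_trans _ _ (lebesgue_rV n (cube a (rho / (2 * n%:R))))).
    rewrite lebesgue_rV_cube; last by rewrite divr_ge0 ?mulr_ge0// ltW.
    by rewrite invfM [2 * _]mulrCA mulVKf.
  by apply: le_measure; rewrite ?inE//; exact: measurable_cube.
have vol_fin : lebesgue_rV n B \is a fin_num.
  rewrite ge0_fin_numE//; apply: le_lt_trans (lebesgue_rV_cube_lty a (ltW rho0)).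
  by apply: le_measure; rewrite ?inE//; exact: measurable_cube.
have I0 : (0 <= \int[lebesgue_rV n]_(z in B) `|phi z - l|%:E)%E by exact: integral_ge0.
have I1 : (\int[lebesgue_rV n]_(z in B) `|phi z - l|%:E <=
    (C1 * u a * rho `^ s * rho ^+ n)%:E)%E.
  apply: le_trans (H rho _); last by rewrite rho0.
  apply: ge0_subset_integral => //; [exact: measurable_cube|exact: measurable_funTS].
move: vol_ge; rewrite -(fineK vol_fin) lee_fin; set v := fine _ => vge.
have v0 : 0 < v by apply: lt_le_trans vge; rewrite exprn_gt0// divr_gt0.
rewrite inver gt_eqF// mule_ge0//=; last by rewrite lee_fin invr_ge0 ltW.
apply: (@le_trans _ _ ((v^-1)%:E * (C1 * u a * rho `^ s * rho ^+ n)%:E)%E).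
  by apply: lee_wpmul2l => //; rewrite lee_fin invr_ge0 ltW.
rewrite -EFinM lee_fin ler_pdivrMl//.
apply: (@le_trans _ _ ((rho / n%:R) ^+ n * (K * rho `^ s))); last first.
  by rewrite ler_wpM2r// mulr_ge0 ?powR_ge0// /K mulr_ge0// mulr_ge0// exprn_ge0.
rewrite le_eqVlt; apply/orP; left; apply/eqP.
by rewrite /K expr_div_n; field; rewrite expf_neq0// gt_eqF.
Unshelve. all: by end_near. Qed.

Variable phit : 'rV[R]_n -> R.
Hypothesis phi_phit : lebesgue_representative phi phit.

Let mean_representative a r : (U a < +oo)%E -> 0 < r ->
  (\int[lebesgue_rV n]_(x in cube a r) `|phi x - phit a|%:E <=
    (C1 * u a * r `^ s * r ^+ n)%:E)%E.
Proof.
move=> Ua r0; have [l Hl] := mean_limit Ua r0.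
have [_ ->] : measurable_fun setT phit /\ phit a = l.
  split; first exact: phi_phit.1.
  by apply: phi_phit.2; exact: mean_limit_approximate Hl.
by apply: Hl; rewrite r0 lexx.
Qed.

(** With d = |a - b|, the cube of radius d around b lies in that of radius 2 d around a, so both
    values are close to phi in mean on the former. The factor 2 bounds 2^s. *)
Lemma representative_holder (a b : 'rV[R]_n) : (U a < +oo)%E -> (U b < +oo)%E ->
  `|phit a - phit b| <= 2 * lebesgue_point_cst n s * enorm (a - b) `^ s *
    (fine (U a) + fine (U b)).
Proof.
move=> Ua Ub; have /andP[s0 s1] := s01.
have [<-|ab] := eqVneq a b.
  by rewrite !subrr normr0 mulr_ge0 ?addr_ge0 ?u_ge0// mulr_ge0 ?powR_ge0// mulr_ge0.
set d := enorm (a - b).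
have d0 : 0 < d by rewrite enorm_gt0 subr_eq0.
have E1 : (\int[lebesgue_rV n]_(x in cube b d) `|phi x - phit a|%:E <=
    (C1 * u a * (2 * d) `^ s * (2 * d) ^+ n)%:E)%E.
  apply: le_trans (mean_representative Ua _); last by rewrite mulr_gt0.
  apply: ge0_subset_integral => //;
    [exact: measurable_cube|exact: measurable_cube|exact: measurable_funTS|].
  move=> x xb j; rewrite -[X in `|X|](subrKA (b ord0 j)) (le_lt_trans (ler_normD _ _))//.
  rewrite mulr_natl mulr2n ltr_leD//.
  by have := coord_le_enorm (a - b) j; rewrite !mxE distrC.
have E2 := mean_representative Ub d0.
have := cst_dist (ltW d0) E1 E2.
rewrite -ler_pdivlMr ?exprn_gt0 ?mulr_gt0// => H; apply: le_trans H _.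
rewrite ler_pdivrMr ?exprn_gt0 ?mulr_gt0//.
have two : (2 * d) `^ s <= 2 * d `^ s.
  rewrite powRM ?(ltW d0)// ler_wpM2r ?powR_ge0// -[leRHS]powRr1//.
  by rewrite ler_powR// ?ler1n// ltW.
have nd : d ^+ n <= (2 * d) ^+ n by rewrite lerXn2r ?nnegrE ?mulr_ge0 ?(ltW d0)//; lra.
have ds0 := powR_ge0 d s.
have A1 : C1 * u a * (2 * d) `^ s * (2 * d) ^+ n <= C1 * u a * (2 * d `^ s) * (2 * d) ^+ n.
  by rewrite ler_wpM2r ?exprn_ge0 ?mulr_ge0 ?(ltW d0)// ler_wpM2l// mulr_ge0.
have A2 : C1 * u b * d `^ s * d ^+ n <= C1 * u b * (2 * d `^ s) * (2 * d) ^+ n.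
  apply: ler_pM => //.
  - by rewrite mulr_ge0// mulr_ge0.
  - by rewrite exprn_ge0// ltW.
  - apply: ler_wpM2l; first exact: mulr_ge0.
    by rewrite mulr_natl mulr2n lerDl.
apply: le_trans (lerD A1 A2) _.
have alg (A B C D E : R) : A * B * (2 * D) * E + A * C * (2 * D) * E = 2 * A * D * (B + C) * E.
  by ring.
by rewrite alg.
Qed.

End lebesgue_points.

(** The kernel is jointly measurable and the variation measure is finite, so Tonelli's theorem
    applies. *)
Lemma measurable_gradient_potential {R : realType} {n : nat} (phi : 'rV[R]_n -> R) s :
  measurable_fun setT (gradient_potential phi s).
Proof.
pose tv : {finite_measure set 'rV[R]_n -> \bar R} := tvar (gradient_measure phi).
pose K (z : 'rV[R]_n * 'rV[R]_n) :=
  if z.1 == z.2 then +oo%E else (enorm (z.1 - z.2) `^ (1 - s - n%:R))%:E.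
have K0 z : (0 <= K z)%E by rewrite /K; case: ifP => // _; rewrite lee_fin powR_ge0.
exact: (@measurable_fun_fubini_tonelli_F _ _ _ _ R tv K (measurable_riesz_kernel _)).
Qed.

(** * Uniform integrability of the kernel |x - y|^(g - k) *)

Lemma nneseries_geometric_le {R : realType} (a q : R) : 0 <= a -> 0 <= q < 1 ->
  (\sum_(j <oo) (a * q ^+ j)%:E <= (a / (1 - q))%:E)%E.
Proof.
move=> a0 /andP[q0 q1]; have q1' : 0 < 1 - q by rewrite subr_gt0.
apply: lime_le.
  by apply: is_cvg_nneseries => j _ _; rewrite lee_fin mulr_ge0// exprn_ge0.
apply: nearW => N; rewrite sumEFin lee_fin.
have -> : \sum_(0 <= j < N) a * q ^+ j = a * (1 - q ^+ N) / (1 - q).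
  elim: N => [|N ih]; first by rewrite big_geq// expr0 subrr mulr0 mul0r.
  by rewrite big_nat_recr//= ih exprS; field; rewrite gt_eqF.
rewrite ler_wpM2r ?invr_ge0 ?(ltW q1')// -[leRHS]mulr1 ler_wpM2l//.
by rewrite gerBl exprn_ge0.
Qed.

(** The sum over j of the kernel at scale d / 2^j times the volume (4 d / 2^j)^k of a cube of that
    size. The absolute value in the first factor covers both signs of g - k. *)
Definition riesz_kernel_cst {R : realType} (k : nat) (g d : R) : R :=
  2 `^ `|g - k%:R| * 4 ^+ k * d `^ g / (1 - 2^-1 `^ g).

Section riesz_kernel_integral.
Context {R : realType} {k : nat}.
Variables (g d : R).
Hypotheses (g0 : 0 < g) (d0 : 0 < d).

Let q : R := 2^-1 `^ g.

Let q01 : 0 <= q < 1.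
Proof. by rewrite powR_ge0 half_powR_lt1. Qed.

Let rad j : R := d / 2 ^+ j.

Let rad0 j : 0 < rad j. Proof. by rewrite divr_gt0// exprn_gt0. Qed.

Let C : R := 2 `^ `|g - k%:R|.

Let C1 : 1 <= C.
Proof. by rewrite /C -[leLHS](powRr0 2) ler_powR// ler1n. Qed.

Let kernel_scale (x y : 'rV[R]_k) : enorm (x - y) <= d ->
  exists j, cube x (2 * rad j) y /\ enorm (x - y) `^ (g - k%:R) <= C * rad j `^ (g - k%:R).
Proof.
move=> xyd; have [->|xy] := eqVneq x y.
  exists 0%N; split; first by move=> i; rewrite subrr normr0 mulr_gt0.
  (* On the diagonal [powR] gives 1 for the exponent 0 and 0 for every other one. *)
  rewrite subrr enorm0; have [->|gk] := eqVneq (g - k%:R) 0; first by rewrite !powRr0 mulr1.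
  by rewrite powR0// mulr_ge0 ?powR_ge0.
have e0 : 0 < enorm (x - y) by rewrite enorm_gt0 subr_eq0.
have /dyadic_scale[j /andP[j1 j2]] : 0 < enorm (x - y) <= d by rewrite e0.
exists j; split.
  move=> i; apply: le_lt_trans (_ : enorm (x - y) < _).
    by have := coord_le_enorm (x - y) i; rewrite !mxE distrC.
  by apply: le_lt_trans j1 _; rewrite -/(rad j) mulr_natl mulr2n ltrDl.
have [gk|gk] := leP (g - k%:R) 0; last first.
  apply: (@le_trans _ _ (rad j `^ (g - k%:R))).
    by apply: ge0_ler_powR; rewrite ?nnegrE ?enorm_ge0// ltW.
  by apply: ler_peMl; first exact: powR_ge0.
have -> : C * rad j `^ (g - k%:R) = (2^-1 * rad j) `^ (g - k%:R).
  rewrite [RHS]powRM ?invr_ge0 ?(ltW (rad0 j))//; congr (_ * _).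
  by rewrite /C ler0_norm// powRN -[2^-1]powR_inv1// -powRrM mulN1r powRN.
apply: ler_powR_neg => //; first by rewrite mulr_gt0 ?invr_gt0.
by rewrite ler_pdivrMl.
Qed.

(** On G the kernel is dominated by a series of multiples of indicators of concentric dyadic cubes,
    which is integrated term by term; g > 0 makes it geometric. *)
Lemma riesz_kernel_integral_le (G : set 'rV[R]_k) (x : 'rV[R]_k) : measurable G ->
  (forall y, G y -> enorm (x - y) <= d) ->
  (\int[lebesgue_rV k]_(y in G) (enorm (x - y) `^ (g - k%:R))%:E <=
    (riesz_kernel_cst k g d)%:E)%E.
Proof.
move=> mG Gd.
pose t j (y : 'rV[R]_k) : \bar R :=
  ((C * rad j `^ (g - k%:R))%:E * (\1_(cube x (2 * rad j)) y)%:E)%E.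
have c0 j : 0 <= C * rad j `^ (g - k%:R) by rewrite mulr_ge0 ?powR_ge0.
have t0 j y : (0 <= t j y)%E by rewrite mule_ge0 ?lee_fin.
have mt j : measurable_fun setT (t j).
  apply: measurable_funeM; apply/measurable_EFinP/measurable_indic; exact: measurable_cube.
apply: (@le_trans _ _ (\int[lebesgue_rV k]_y \sum_(j <oo) t j y)%E).
  apply: (@le_trans _ _ (\int[lebesgue_rV k]_(y in G) \sum_(j <oo) t j y)%E).
    apply: ge0_le_integral => //.
    - by move=> y _; rewrite lee_fin powR_ge0.
    - apply: measurable_funTS; apply/measurable_EFinP.
      apply: (measurableT_comp (measurable_powR _)).
      by apply: measurable_enormB => //; exact: measurable_cst.
    - by apply: measurable_funTS; apply: ge0_emeasurable_sum => // j y _ _.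
    - move=> y Gy; have [j [yj e_le]] := kernel_scale (Gd y Gy).
      apply: (@le_trans _ _ (t j y)).
        by rewrite /t indicE mem_set// mule1 lee_fin.
      have := @nneseries_lim_ge R (fun j => t j y) xpredT 0%N j.+1.
      move=> /(_ (fun i _ _ => t0 i y)); apply: le_trans.
      by rewrite big_nat_recr//= leeDr// sume_ge0.
  apply: ge0_subset_integral => //.
  - by apply: ge0_emeasurable_sum => // j y _ _.
  - by move=> y _; apply: nneseries_ge0 => j _ _.
rewrite integral_nneseries//.
have tj j : (\int[lebesgue_rV k]_y t j y = (C * 4 ^+ k * d `^ g * q ^+ j)%:E)%E.
  rewrite ge0_integralZl_EFin//; last first.
    by apply/measurable_EFinP/measurable_indic; exact: measurable_cube.
  rewrite integral_indic//; last exact: measurable_cube.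
  rewrite setIT; have E := @lebesgue_rV_cube R k x (2 * rad j).
  transitivity ((C * rad j `^ (g - k%:R))%:E * ((2 * (2 * rad j)) ^+ k)%:E)%E.
    by congr (_ * _)%E; apply: E; rewrite mulr_ge0// ltW.
  rewrite -EFinM; congr EFin.
  have -> : (2 * (2 * rad j)) ^+ k = 4 ^+ k * rad j ^+ k.
    by rewrite -exprMn; congr (_ ^+ _); ring.
  have rk : rad j `^ (g - k%:R) * rad j ^+ k = d `^ g * q ^+ j.
    rewrite -powR_mulrn ?(ltW (rad0 j))// -powRD; last by rewrite (gt_eqF (rad0 j)) implybT.
    rewrite subrK /rad powRM ?(ltW d0) ?invr_ge0 ?exprn_ge0// -exprVn.
    by rewrite powR_exprn// invr_ge0.
  have alg (a b c e f : R) : b * c = e * f -> C * b * (a * c) = C * a * e * f.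
    by move=> H; rewrite mulrACA H; ring.
  exact: alg.
rewrite (eq_eseriesr (fun j _ => tj j)).
apply: nneseries_geometric_le => //.
by apply: mulr_ge0; [apply: mulr_ge0; [exact: powR_ge0|exact: exprn_ge0]|exact: powR_ge0].
Qed.

End riesz_kernel_integral.

Lemma riesz_kernel_cst_gt0 {R : realType} (k : nat) (g d : R) : 0 < g -> 0 < d ->
  0 < riesz_kernel_cst k g d.
Proof.
move=> g0 d0; have q1 := half_powR_lt1 g0.
rewrite /riesz_kernel_cst divr_gt0 ?subr_gt0//.
by apply: mulr_gt0; [apply: mulr_gt0; [exact: powR_gt0|exact: exprn_gt0]|exact: powR_gt0].
Qed.

(** * Hoelder and kernel inequalities *)

Lemma hoelder_on d {T : measurableType d} {R : realType} (m : {measure set T -> \bar R})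
    (D : set T) (F G : T -> R) (a : R) : measurable D ->
  measurable_fun setT F -> measurable_fun setT G ->
  (forall x, 0 <= F x) -> (forall x, 0 <= G x) -> 0 < a < 1 ->
  (\int[m]_(x in D) (F x `^ a * G x `^ (1 - a))%:E <=
    (\int[m]_(x in D) (F x)%:E) `^ a * (\int[m]_(x in D) (G x)%:E) `^ (1 - a))%E.
Proof.
move=> mD mF mG F0 G0 /andP[a0 a1].
have b0 : 0 < 1 - a by rewrite subr_gt0.
pose f x := (F x `^ a) * \1_D x : R; pose g x := (G x `^ (1 - a)) * \1_D x : R.
have mf : measurable_fun setT f.
  apply: measurable_funM; last exact: measurable_indic.
  exact: (measurableT_comp (measurable_powR _)).
have mg : measurable_fun setT g.
  apply: measurable_funM; last exact: measurable_indic.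
  exact: (measurableT_comp (measurable_powR _)).
have indic (h : T -> R) x : (h x * \1_D x)%:E = ((EFin \o h) \_ D) x.
  by rewrite indicE patchE; case: ifPn => _; rewrite ?mulr1 ?mulr0.
have norm (h : T -> R) (e : R) : (0 < e)%R -> (forall x, 0 <= h x) ->
    ('N[m]_(e^-1)%:E [EFin \o (fun x => (h x `^ e * \1_D x)%R)] =
     (\int[m]_(x in D) (h x)%:E) `^ e)%E.
  move=> e0 h0; rewrite unlock invrK [in RHS]integral_mkcond; congr poweR.
  apply: eq_integral => x _; rewrite -[RHS](indic h) /=.
  rewrite ger0_norm ?mulr_ge0 ?powR_ge0//; congr EFin.
  rewrite indicE; case: (x \in D); rewrite ?mulr1 ?mulr0.
    by rewrite -powRrM mulfV ?gt_eqF// powRr1.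
  by rewrite powR0// invr_neq0// gt_eqF.
have := hoelder m mf mg _ _ _; rewrite Lnorm1.
move=> /(_ a^-1 (1 - a)^-1); rewrite !invrK !invr_gt0 => /(_ a0 b0).
rewrite [a + _]addrC subrK => /(_ erefl).
rewrite (norm F a)// (norm G (1 - a))//; apply: le_trans.
rewrite integral_mkcond le_eqVlt; apply/orP; left; apply/eqP; apply: eq_integral => x _.
rewrite -[LHS](indic (fun x => F x `^ a * G x `^ (1 - a))) /= /f /g.
rewrite ger0_norm; last by rewrite !mulr_ge0 ?powR_ge0.
by rewrite indicE; case: (x \in D); rewrite ?mulr1 ?mulr0 ?mul0r.
Qed.

(** Hoelder's inequality for the powers F^p and 1 with weight t/p. The case t = p is split off
    because the weight must be less than 1. *)
Lemma le_integral_powR d {T : measurableType d} {R : realType} (m : {measure set T -> \bar R})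
    (D : set T) (F : T -> R) (t p : R) : measurable D -> measurable_fun setT F ->
  (forall x, 0 <= F x) -> 0 < t <= p ->
  ((\int[m]_(x in D) (F x `^ t)%:E) `^ t^-1 <=
    m D `^ (t^-1 - p^-1) * (\int[m]_(x in D) (F x `^ p)%:E) `^ p^-1)%E.
Proof.
move=> mD mF F0 /andP[t0]; rewrite le_eqVlt => /predU1P[<-|tp].
  by rewrite subrr poweRe0 mul1e.
have p0 : 0 < p := lt_trans t0 tp.
have a01 : 0 < t / p < 1 by rewrite divr_gt0//= ltr_pdivrMr// mul1r.
have mFp : measurable_fun setT (fun x => F x `^ p) by exact: (measurableT_comp (measurable_powR _)).
have := @hoelder_on _ _ _ m D _ (cst 1) _ mD mFp (measurable_cst _) (fun x => powR_ge0 _ _)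
  (fun=> ler01) a01.
under eq_integral.
  move=> x _; rewrite powR1 mulr1 -powRrM mulrC divfK ?gt_eqF//.
  over.
rewrite [X in (_ * X `^ (1 - _))%E](integral_cst m mD 1) mul1e => H.
have t1 : 0 <= t^-1 by rewrite invr_ge0 ltW.
have J0 : (0 <= \int[m]_(x in D) (F x `^ t)%:E)%E.
  by apply: integral_ge0 => x _; rewrite lee_fin powR_ge0.
apply: (le_trans (gt0_ler_poweR t1 _ _ H)).
- by rewrite in_itv/= J0 leey.
- by rewrite in_itv/= mule_ge0 ?poweR_ge0// leey.
rewrite poweRM ?poweR_ge0// -!poweRrM muleC.
have -> : t / p * t^-1 = p^-1 by field; rewrite !gt_eqF.
have -> // : (1 - t / p) * t^-1 = t^-1 - p^-1 by field; rewrite !gt_eqF.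
Qed.

Lemma powRD_le {R : realType} (t a b : R) : 0 <= t -> 0 <= a -> 0 <= b ->
  (a + b) `^ t <= 2 `^ t * (a `^ t + b `^ t).
Proof.
move=> t0; have H x y : 0 <= x -> 0 <= y -> x <= y -> (x + y) `^ t <= 2 `^ t * (x `^ t + y `^ t).
  move=> x0 y0 xy; apply: (@le_trans _ _ ((2 * y) `^ t)).
    by apply: ge0_ler_powR => //; rewrite ?nnegrE ?mulr_ge0 ?addr_ge0// mulr_natl mulr2n lerD2r.
  by rewrite powRM// ler_wpM2l ?powR_ge0// lerDr powR_ge0.
move=> a0 b0; have [ab|/ltW ba] := leP a b; first exact: H.
by rewrite addrC [_ `^ _ + _]addrC; exact: H.
Qed.

Section energy_kernel.
Context {R : realType} {k : nat}.
Local Notation leb := (lebesgue_rV k).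
Variables (g d t : R) (D : set 'rV[R]_k) (v : 'rV[R]_k -> R).
Hypotheses (g0 : 0 < g) (d0 : 0 < d) (t0 : 0 <= t) (mD : measurable D).
Hypothesis diamD : forall x y, D x -> D y -> enorm (x - y) <= d.
Hypotheses (mv : measurable_fun setT v) (v0 : forall x, 0 <= v x).

Let K : R := riesz_kernel_cst k g d.

Let ker (x y : 'rV[R]_k) : R := enorm (x - y) `^ (g - k%:R).

Let mker : measurable_fun setT (fun z : 'rV[R]_k * 'rV[R]_k => ker z.1 z.2).
Proof.
apply: (measurableT_comp (measurable_powR _)).
by apply: measurable_enormB; [exact: measurable_fst|exact: measurable_snd].
Qed.

Let mvt : measurable_fun setT (fun x => v x `^ t).
Proof. exact: (measurableT_comp (measurable_powR _)). Qed.

Let one_sided : (\int[leb]_(x in D) \int[leb]_(y in D) (v x `^ t * ker x y)%:E <=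
  K%:E * \int[leb]_(x in D) (v x `^ t)%:E)%E.
Proof.
have mkerx x : measurable_fun setT (fun y => (ker x y)%:E).
  by apply/measurable_EFinP; exact: (measurableT_comp mker (measurable_pair1 x)).
rewrite -ge0_integralZl_EFin//; last 3 first.
- by move=> x _; rewrite lee_fin powR_ge0.
- by apply/measurable_EFinP; exact: measurable_funTS.
- exact/ltW/riesz_kernel_cst_gt0.
apply: ge0_le_integral => //.
- by move=> x _; apply: integral_ge0 => y _; rewrite lee_fin mulr_ge0 ?powR_ge0.
- have := @measurable_integral_on _ _ _ _ R leb D D (fun z => (v z.1 `^ t * ker z.1 z.2)%:E) mD mD.
  apply; last by move=> z; rewrite lee_fin mulr_ge0 ?powR_ge0.
  apply: measurable_funTS; apply/measurable_EFinP/measurable_funM => //.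
  by apply: (measurableT_comp mvt); exact: measurable_fst.
- by apply: measurable_funTS; apply: measurable_funeM; exact/measurable_EFinP.
- move=> x Dx; rewrite muleC.
  under eq_integral do rewrite EFinM.
  rewrite ge0_integralZl_EFin ?powR_ge0//; last 2 first.
  + by move=> y _; rewrite lee_fin powR_ge0.
  + exact: measurable_funTS.
  apply: lee_wpmul2l; first by rewrite lee_fin powR_ge0.
  by apply: riesz_kernel_integral_le => // y Dy; exact: diamD.
Qed.

(** After splitting the power of the sum, the two terms are exchanged by the symmetry of the kernel;
    in each, the inner integral is that of the kernel alone, bounded uniformly in the outer
    variable. *)
Lemma energy_kernel_le :
  (\int[leb \x leb]_(z in D `*` D)
      ((v z.1 + v z.2) `^ t * enorm (z.1 - z.2) `^ (g - k%:R))%:E <=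
   (2 `^ t * 2 * K)%:E * \int[leb]_(x in D) (v x `^ t)%:E)%E.
Proof.
have mDD : measurable (D `*` D) by exact: measurableX.
pose f1 (z : 'rV[R]_k * 'rV[R]_k) := (v z.1 `^ t * ker z.1 z.2)%:E.
pose f2 (z : 'rV[R]_k * 'rV[R]_k) := (v z.2 `^ t * ker z.1 z.2)%:E.
have f10 z : (0 <= f1 z)%E by rewrite lee_fin mulr_ge0// powR_ge0.
have f20 z : (0 <= f2 z)%E by rewrite lee_fin mulr_ge0// powR_ge0.
have mf1 : measurable_fun setT f1.
  apply/measurable_EFinP/measurable_funM => //.
  by apply: (measurableT_comp mvt); exact: measurable_fst.
have mf2 : measurable_fun setT f2.
  apply/measurable_EFinP/measurable_funM => //.
  by apply: (measurableT_comp mvt); exact: measurable_snd.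
apply: (@le_trans _ _ (\int[leb \x leb]_(z in D `*` D) ((2 `^ t)%:E * (f1 z + f2 z)))%E).
  apply: ge0_le_integral => //.
  - by move=> z _; rewrite lee_fin mulr_ge0 ?powR_ge0.
  - apply: measurable_funTS; apply/measurable_EFinP/measurable_funM => //.
    apply: (measurableT_comp (measurable_powR _)); apply: measurable_funD.
      by apply: (measurableT_comp mv); exact: measurable_fst.
    by apply: (measurableT_comp mv); exact: measurable_snd.
  - by apply: measurable_funTS; apply: measurable_funeM; exact: emeasurable_funD.
  - move=> z _; rewrite -EFinD -EFinM lee_fin -mulrDl mulrA ler_wpM2r ?powR_ge0//.
    exact: powRD_le.
rewrite ge0_integralZl_EFin//; last 2 first.
- by move=> z _; rewrite adde_ge0.
- by apply: measurable_funTS; exact: emeasurable_funD.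
rewrite ge0_integralD//; [|exact: measurable_funTS|exact: measurable_funTS].
rewrite !integral_setX//; [|exact: measurable_funTS|exact: measurable_funTS].
rewrite -mulrA EFinM -muleA; apply: lee_wpmul2l; first by rewrite lee_fin powR_ge0.
have K0 : (0 <= K%:E)%E by rewrite lee_fin; exact/ltW/riesz_kernel_cst_gt0.
rewrite mulr_natl mulr2n EFinD ge0_muleDl//.
apply: leeD; first exact: one_sided.
apply: le_trans one_sided; rewrite le_eqVlt; apply/orP; left; apply/eqP.
transitivity (\int[leb]_(y in D) \int[leb]_(x in D) f2 (x, y))%E.
  by apply: tonelli_on => //; exact: measurable_funTS.
apply: eq_integral => y _; apply: eq_integral => x _.
by rewrite /f2 /= /ker enorm_distC.
Qed.

End energy_kernel.

(** * Energy estimates *)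

Section pointwise_identities.
Context {R : realType}.
Implicit Types C a b e s r q k theta beta : R.

(** Here a stands for |u x - u y|, b for the sum of potentials and e for |x - y|. The two equations
    match the powers of a and b; matching the powers of e then forces (theta s - beta) t - k in the
    second factor. *)
Lemma interpolation_identity C a b e k s theta beta r q t A :
  0 <= C -> 0 <= a -> 0 <= b -> 0 < e -> q * A = s * r -> t * (1 - A) = r ->
  (C * a `^ s * b) `^ r / e `^ (k + beta * r) =
  C `^ r * ((a `^ q / e `^ (k + theta * q)) `^ A *
    (b `^ t * e `^ ((theta * s - beta) * t - k)) `^ (1 - A)).
Proof.
move=> C0 a0 b0 e0 qA tA.
rewrite -!powRN !powRM ?mulr_ge0 ?powR_ge0// -!powRrM qA tA.
have -> : - (k + beta * r) = - (k + theta * q) * A + ((theta * s - beta) * t - k) * (1 - A).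
  have -> : - (k + theta * q) * A + ((theta * s - beta) * t - k) * (1 - A) =
    - k - theta * (q * A) + (theta * s - beta) * (t * (1 - A)) by ring.
  by rewrite qA tA; ring.
rewrite powRD; last by rewrite (gt_eqF e0) implybT.
have alg (x1 x2 x3 x4 x5 : R) : x1 * x2 * x3 * (x4 * x5) = x1 * (x2 * x4 * (x3 * x5)) by ring.
exact: alg.
Qed.

Lemma lipschitz_identity C H b e k s theta beta r :
  0 <= C -> 0 <= H -> 0 <= b -> 0 < e ->
  (C * (H * e `^ theta) `^ s * b) `^ r / e `^ (k + beta * r) =
  (C `^ r * H `^ (s * r)) * (b `^ r * e `^ ((theta * s - beta) * r - k)).
Proof.
move=> C0 H0 b0 e0.
rewrite -!powRN !powRM ?mulr_ge0 ?powR_ge0// -!powRrM.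
have -> : (theta * s - beta) * r - k = theta * (s * r) + - (k + beta * r) by ring.
rewrite powRD; last by rewrite (gt_eqF e0) implybT.
rewrite -mulrA.
have alg (x1 x2 x3 x4 x5 : R) : x1 * (x2 * x3) * (x4 * x5) = x1 * x2 * (x4 * (x3 * x5)) by ring.
exact: alg.
Qed.

Lemma bounded_identity C a b e k s theta beta r :
  0 <= C -> 0 <= a -> 0 <= b -> 0 < e ->
  (C * a `^ s * b) `^ r / e `^ (k + beta * r) =
  (C `^ r * b `^ r * e `^ ((theta * s - beta) * r)) * (a `^ (s * r) / e `^ (k + theta * (s * r))).
Proof.
move=> C0 a0 b0 e0.
rewrite -!powRN !powRM ?mulr_ge0 ?powR_ge0// -!powRrM.
have -> : - (k + beta * r) = (theta * s - beta) * r + - (k + theta * (s * r)) by ring.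
rewrite powRD; last by rewrite (gt_eqF e0) implybT.
have alg (x1 x2 x3 x4 x5 : R) : x1 * x2 * x3 * (x4 * x5) = x1 * x3 * x4 * (x2 * x5) by ring.
exact: alg.
Qed.

End pointwise_identities.

Lemma measurable_powR_fun d {T : measurableType d} {R : realType} (f : T -> R) a :
  measurable_fun setT f -> measurable_fun setT (fun z => f z `^ a).
Proof. by move=> mf; exact: (measurableT_comp (measurable_powR _)). Qed.

Lemma measurable_powR_div d {T : measurableType d} {R : realType} (f g : T -> R) a b :
  measurable_fun setT f -> measurable_fun setT g ->
  measurable_fun setT (fun z => f z `^ a / g z `^ b).
Proof.
move=> mf mg; apply: measurable_funM; first exact: measurable_powR_fun.
rewrite (_ : (fun z => _) = (fun z => g z `^ (- b))); first exact: measurable_powR_fun.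
by apply/funext => z; rewrite powRN.
Qed.

Section composition_energy.
Context {R : realType} {k n : nat}.
Local Notation leb := (lebesgue_rV k).
Variables (D : set 'rV[R]_k) (w : 'rV[R]_k -> R) (u : 'rV[R]_k -> 'rV[R]_n) (v : 'rV[R]_k -> R).
Variables (C s theta beta r : R).
Hypotheses (mD : measurable D) (mw : measurable_fun setT w) (mu : measurable_fun setT u)
  (mv : measurable_fun setT v) (v0 : forall x, 0 <= v x) (C0 : 0 <= C) (s0 : 0 <= s)
  (r0 : 0 < r).
Hypothesis wuv : forall x y, D x -> D y ->
  `|w x - w y| <= C * enorm (u x - u y) `^ s * (v x + v y).

(** A single integral for the product measure, so that Hoelder's inequality acts on pairs; no root
    is taken yet. *)
Definition slobodeckij_energy {E : zmodType} (N : E -> R) (delta l : R) (f : 'rV[R]_k -> E) :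
    \bar R :=
  (\int[leb \x leb]_(z in D `*` D)
    (N (f z.1 - f z.2) `^ l / enorm (z.1 - z.2) `^ (k%:R + delta * l))%:E)%E.

Let menorm : measurable_fun setT (fun z : 'rV[R]_k * 'rV[R]_k => enorm (z.1 - z.2)).
Proof. by apply: measurable_enormB; [exact: measurable_fst|exact: measurable_snd]. Qed.

Let mwB : measurable_fun setT (fun z : 'rV[R]_k * 'rV[R]_k => `|w z.1 - w z.2|).
Proof.
apply: (measurableT_comp (@normr_measurable _ _)); apply: measurable_funB.
  by apply: (measurableT_comp mw); exact: measurable_fst.
by apply: (measurableT_comp mw); exact: measurable_snd.
Qed.

Let muB : measurable_fun setT (fun z : 'rV[R]_k * 'rV[R]_k => enorm (u z.1 - u z.2)).
Proof.
apply: measurable_enormB.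
  by apply: (measurableT_comp mu); exact: measurable_fst.
by apply: (measurableT_comp mu); exact: measurable_snd.
Qed.

Let mvD : measurable_fun setT (fun z : 'rV[R]_k * 'rV[R]_k => v z.1 + v z.2).
Proof.
apply: measurable_funD.
  by apply: (measurableT_comp mv); exact: measurable_fst.
by apply: (measurableT_comp mv); exact: measurable_snd.
Qed.

(* Away from the diagonal, where the integrand vanishes, it suffices to bound
   the quotient formed with the right-hand side of wuv. *)
Let energy_le (h : 'rV[R]_k * 'rV[R]_k -> R) : measurable_fun setT h -> (forall z, 0 <= h z) ->
  (forall x y, D x -> D y -> x != y ->
    (C * enorm (u x - u y) `^ s * (v x + v y)) `^ r / enorm (x - y) `^ (k%:R + beta * r) <=
      h (x, y)) ->
  (slobodeckij_energy Num.norm beta r w <= \int[leb \x leb]_(z in D `*` D) (h z)%:E)%E.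
Proof.
move=> mh h0 H; apply: ge0_le_integral.
- exact: measurableX.
- by move=> z _; rewrite lee_fin mulr_ge0 ?invr_ge0 ?powR_ge0.
- by apply: measurable_funTS; apply/measurable_EFinP; exact: measurable_powR_div.
- by apply: measurable_funTS; exact/measurable_EFinP.
- move=> [x y] [/= Dx Dy]; rewrite lee_fin.
  have [->|xy] := eqVneq x y; first by rewrite subrr normr0 powR0 ?gt_eqF// mul0r.
  apply: le_trans (H x y Dx Dy xy); rewrite ler_wpM2r ?invr_ge0 ?powR_ge0//.
  by apply: ge0_ler_powR; rewrite ?nnegrE ?(ltW r0)// ?wuv// (le_trans _ (wuv Dx Dy)).
Qed.

(* Hoelder's inequality with exponents 1/A and 1/(1 - A); for A = s r / q the powers of
   |u x - u y| and of |x - y| on both sides match. *)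
Lemma energy_interpolation (d q t A : R) : 0 < d ->
  (forall x y, D x -> D y -> enorm (x - y) <= d) ->
  0 < A < 1 -> q * A = s * r -> t * (1 - A) = r -> beta < theta * s ->
  (slobodeckij_energy Num.norm beta r w <=
    (C `^ r)%:E * (slobodeckij_energy enorm theta q u `^ A *
    ((2 `^ t * 2 * riesz_kernel_cst k ((theta * s - beta) * t) d)%:E *
      \int[leb]_(x in D) (v x `^ t)%:E) `^ (1 - A)))%E.
Proof.
move=> d0 diamD A01 qA tA bts; have /andP[A0 A1] := A01.
have t0 : 0 < t by rewrite -(pmulr_lgt0 t (_ : 0 < 1 - A)) ?tA// subr_gt0.
have g0 : 0 < (theta * s - beta) * t by rewrite mulr_gt0// subr_gt0.
pose F (z : 'rV[R]_k * 'rV[R]_k) :=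
  enorm (u z.1 - u z.2) `^ q / enorm (z.1 - z.2) `^ (k%:R + theta * q).
pose G (z : 'rV[R]_k * 'rV[R]_k) :=
  (v z.1 + v z.2) `^ t * enorm (z.1 - z.2) `^ ((theta * s - beta) * t - k%:R).
have F0 z : 0 <= F z by rewrite mulr_ge0 ?invr_ge0 ?powR_ge0.
have G0 z : 0 <= G z by rewrite mulr_ge0 ?powR_ge0.
have mF : measurable_fun setT F by exact: measurable_powR_div.
have mG : measurable_fun setT G by apply: measurable_funM; exact: measurable_powR_fun.
have mFG : measurable_fun setT (fun z => F z `^ A * G z `^ (1 - A)).
  by apply: measurable_funM; exact: measurable_powR_fun.
apply: (@le_trans _ _
    (\int[leb \x leb]_(z in D `*` D) (C `^ r * (F z `^ A * G z `^ (1 - A)))%:E)%E).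
  apply: energy_le.
  - by apply: measurable_funM => //; exact: measurable_cst.
  - by move=> z; rewrite !mulr_ge0 ?powR_ge0.
  - move=> x y Dx Dy xy; rewrite (@interpolation_identity _ _ _ _ _ _ _ theta _ _ q t A)//.
    + exact: enorm_ge0.
    + exact: addr_ge0.
    + by rewrite enorm_gt0 subr_eq0.
under eq_integral do rewrite EFinM.
rewrite ge0_integralZl_EFin//; last 4 first.
- exact: measurableX.
- by move=> z _; rewrite lee_fin mulr_ge0 ?powR_ge0.
- by apply: measurable_funTS; exact/measurable_EFinP.
- exact: powR_ge0.
apply: lee_wpmul2l; first by rewrite lee_fin powR_ge0.
have mDD : measurable (D `*` D) by exact: measurableX.
apply: (le_trans (hoelder_on (leb \x leb)%E mDD mF mG F0 G0 A01)).
apply: lee_wpmul2l; first exact: poweR_ge0.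
have A1' : 0 <= 1 - A by rewrite subr_ge0 ltW.
have E := energy_kernel_le g0 d0 (ltW t0) mD diamD mv v0.
have I0 : (0 <= \int[leb \x leb]_(z in D `*` D) (G z)%:E)%E.
  by apply: integral_ge0 => z _; rewrite lee_fin.
apply: (gt0_ler_poweR A1' _ _ E); rewrite in_itv/= leey andbT//.
exact: le_trans E.
Qed.

(** The counterpart for q = +oo: the increment of u is replaced pointwise by its Hoelder bound, and
    only the potential with its kernel remains under the integral. *)
Lemma energy_lipschitz (d H : R) : 0 < d -> 0 <= H ->
  (forall x y, D x -> D y -> enorm (x - y) <= d) ->
  (forall x y, D x -> D y -> enorm (u x - u y) <= H * enorm (x - y) `^ theta) ->
  beta < theta * s ->
  (slobodeckij_energy Num.norm beta r w <=
    (C `^ r * H `^ (s * r))%:E *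
    ((2 `^ r * 2 * riesz_kernel_cst k ((theta * s - beta) * r) d)%:E *
      \int[leb]_(x in D) (v x `^ r)%:E))%E.
Proof.
move=> d0 H0 diamD uH bts.
have g0 : 0 < (theta * s - beta) * r by rewrite mulr_gt0// subr_gt0.
have mDD : measurable (D `*` D) by exact: measurableX.
pose G (z : 'rV[R]_k * 'rV[R]_k) :=
  (v z.1 + v z.2) `^ r * enorm (z.1 - z.2) `^ ((theta * s - beta) * r - k%:R).
have G0 z : 0 <= G z by rewrite mulr_ge0 ?powR_ge0.
have mG : measurable_fun setT G by apply: measurable_funM; exact: measurable_powR_fun.
apply: (@le_trans _ _ (\int[leb \x leb]_(z in D `*` D) (C `^ r * H `^ (s * r) * G z)%:E)%E).
  apply: energy_le.
  - by apply: measurable_funM => //; exact: measurable_cst.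
  - by move=> z; rewrite !mulr_ge0 ?powR_ge0.
  - move=> x y Dx Dy xy.
    have e0 : 0 < enorm (x - y) by rewrite enorm_gt0 subr_eq0.
    apply: (@le_trans _ _ ((C * (H * enorm (x - y) `^ theta) `^ s * (v x + v y)) `^ r /
        enorm (x - y) `^ (k%:R + beta * r))); last by rewrite lipschitz_identity// addr_ge0.
    have b0 : 0 <= v x + v y by exact: addr_ge0.
    have Cs0 (e : R) : 0 <= C * e `^ s * (v x + v y).
      by apply: mulr_ge0 => //; apply: mulr_ge0 => //; exact: powR_ge0.
    apply: ler_wpM2r; first by rewrite invr_ge0 powR_ge0.
    apply: ge0_ler_powR; rewrite ?nnegrE ?(ltW r0)//.
    apply: ler_wpM2r => //; apply: ler_wpM2l => //.
    apply: ge0_ler_powR => //; rewrite ?nnegrE ?enorm_ge0//; last exact: uH.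
    by apply: mulr_ge0 => //; exact: powR_ge0.
under eq_integral do rewrite EFinM.
rewrite ge0_integralZl_EFin//; last 3 first.
- by move=> z _; rewrite lee_fin.
- by apply: measurable_funTS; exact/measurable_EFinP.
- by rewrite mulr_ge0 ?powR_ge0.
apply: lee_wpmul2l; first by rewrite lee_fin mulr_ge0 ?powR_ge0.
exact: (energy_kernel_le g0 d0 (ltW r0) mD diamD mv v0).
Qed.

(** The counterpart for q = s r, where the energy of u takes the full weight. The leftover power of
    |x - y| is only bounded, which is still possible for beta = theta s with M = 1. *)
Lemma energy_bounded (V M : R) :
  (forall x, D x -> v x <= V) ->
  (forall x y, D x -> D y -> enorm (x - y) `^ ((theta * s - beta) * r) <= M) ->
  (slobodeckij_energy Num.norm beta r w <=
    (C `^ r * (2 * V) `^ r * M)%:E * slobodeckij_energy enorm theta (s * r) u)%E.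
Proof.
move=> vV eM; have mDD : measurable (D `*` D) by exact: measurableX.
(* A point of D is what makes V and M nonnegative. *)
have [D0|/set0P[x0 Dx0]] := eqVneq D set0.
  rewrite /slobodeckij_energy D0 setX0 !integral_set0 mule0//.
have V0 : 0 <= V by exact: le_trans (vV x0 Dx0).
have M0 : 0 <= M by apply: le_trans (eM x0 x0 Dx0 Dx0); exact: powR_ge0.
pose F (z : 'rV[R]_k * 'rV[R]_k) :=
  enorm (u z.1 - u z.2) `^ (s * r) / enorm (z.1 - z.2) `^ (k%:R + theta * (s * r)).
have F0 z : 0 <= F z by rewrite mulr_ge0 ?invr_ge0 ?powR_ge0.
have mF : measurable_fun setT F by exact: measurable_powR_div.
have c0 : 0 <= C `^ r * (2 * V) `^ r * M by rewrite !mulr_ge0 ?powR_ge0.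
apply: (@le_trans _ _ (\int[leb \x leb]_(z in D `*` D) (C `^ r * (2 * V) `^ r * M * F z)%:E)%E).
  apply: energy_le.
  - by apply: measurable_funM => //; exact: measurable_cst.
  - by move=> z; rewrite mulr_ge0.
  - move=> x y Dx Dy xy; have e0 : 0 < enorm (x - y) by rewrite enorm_gt0 subr_eq0.
    rewrite (@bounded_identity _ _ _ _ _ _ _ theta) ?enorm_ge0 ?addr_ge0//.
    apply: ler_wpM2r; first exact: F0 (x, y).
    apply: ler_pM => //; [by rewrite mulr_ge0 ?powR_ge0|exact: powR_ge0| |exact: eM].
    apply: ler_wpM2l; first exact: powR_ge0.
    apply: ge0_ler_powR; rewrite ?nnegrE ?(ltW r0) ?addr_ge0 ?mulr_ge0//.
    by rewrite mulr_natl mulr2n lerD ?vV.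
under eq_integral do rewrite EFinM.
rewrite ge0_integralZl_EFin//.
- by move=> z _; rewrite lee_fin.
- by apply: measurable_funTS; exact/measurable_EFinP.
Qed.

End composition_energy.

(** * Null sets and Hoelder representatives *)

Section bounded_domains.
Context {R : realType} {k : nat}.
Hypothesis k0 : (0 < k)%N.
Implicit Types (G : set 'rV[R]_k) (x : 'rV[R]_k).

Lemma open_cube_subset G x : open G -> G x -> exists2 r, 0 < r & cube x r `<=` G.
Proof.
move=> oG Gx; have [r /= r0 rG] := (nbhs_ballP _ _).1 (open_nbhs_nbhs (conj oG Gx)).
exists r => // y xy; apply: rG; split=> // i j; rewrite (ord1 i).
by rewrite -ball_normE /= distrC; exact: xy.
Qed.

Lemma open_measure_gt0 G : open G -> G !=set0 -> (0 < lebesgue_rV k G)%E.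
Proof.
move=> oG [x Gx]; have [r r0 rG] := open_cube_subset oG Gx.
apply: (lt_le_trans (lebesgue_rV_cube_gt0 x r0)).
apply: le_measure; rewrite ?inE//; first exact: measurable_cube.
exact: open_measurable_rV.
Qed.

(** With two distinct points the supremum defining [holder_quotient] is over a nonempty set, hence
    nonnegative instead of -oo. *)
Lemma open_two_points G : open G -> G !=set0 -> exists x y, [/\ G x, G y & x != y].
Proof.
move=> oG [x Gx]; have [r r0 rG] := open_cube_subset oG Gx.
exists x, (x + const_mx (r / 2)); split=> //.
  apply: rG => j; rewrite !mxE [_ + r / 2]addrC addrK ger0_norm ?divr_ge0 ?(ltW r0)//.
  by rewrite gtr_pMr// invf_lt1// ltr1n.
apply/eqP => /rowP/(_ (Ordinal k0)); rewrite !mxE => /esym/eqP.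
by rewrite -subr_eq0 [_ + r / 2]addrC addrK gt_eqF// divr_gt0.
Qed.

End bounded_domains.

Lemma measurable_extension d (T : measurableType d) {R : realType} {n : nat} (G : set T)
    (u : T -> 'rV[R]_n) : measurable G -> measurable_fun G u ->
  exists2 u' : T -> 'rV[R]_n, measurable_fun setT u' & forall x, G x -> u' x = u x.
Proof.
move=> mG mu; exists (fun x => if x \in G then u x else 0); last first.
  by move=> x Gx; rewrite mem_set.
apply: measurable_fun_if => //.
- rewrite (_ : (fun x => x \in G) = (fun x => (\1_G x : R) == 1)).
    by apply: measurable_fun_eqr; [exact: measurable_indic|exact: measurable_cst].
  by apply/funext => x; rewrite indicE; case: (x \in G); rewrite ?eqxx// eq_sym oner_eq0.
- rewrite setTI (_ : _ @^-1` _ = G)//.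
  by apply/seteqP; split=> x /=; [move/set_mem|move/mem_set].
Qed.

Lemma ae_null_set d (T : measurableType d) {R : realType} (m : {measure set T -> \bar R})
    (P : T -> Prop) : {ae m, forall x, P x} ->
  exists N, [/\ measurable N, m N = 0%E & forall x, ~ N x -> P x].
Proof.
move=> [N [mN N0 PN]]; exists N; split=> // x Nx; apply: contrapT => nP.
by apply: Nx; apply: PN.
Qed.

Section null_sets.
Context {R : realType} {k : nat}.
Local Notation leb := (lebesgue_rV k).
Variables (G N : set 'rV[R]_k).
Hypotheses (mG : measurable G) (mN : measurable N) (N0 : leb N = 0%E).

Let mD : measurable (G `\` N). Proof. exact: measurableD. Qed.

Lemma iterated_integral_null_set (f : 'rV[R]_k * 'rV[R]_k -> \bar R) :
  measurable_fun setT f -> (forall z, 0 <= f z)%E ->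
  (\int[leb]_(x in G) \int[leb]_(y in G) f (x, y) =
   \int[leb \x leb]_(z in (G `\` N) `*` (G `\` N)) f z)%E.
Proof.
move=> mf f0.
transitivity (\int[leb]_(x in G `\` N) \int[leb]_(y in G `\` N) f (x, y))%E; last first.
  by apply/esym/integral_setX => //; exact: measurable_funTS.
transitivity (\int[leb]_(x in G) \int[leb]_(y in G `\` N) f (x, y))%E.
  apply: eq_integral => x _; apply: ge0_negligible_integral => //.
  by apply: measurable_funTS; exact: (measurableT_comp mf (measurable_pair1 x)).
apply: ge0_negligible_integral => //.
  by apply: measurable_integral_on => //; exact: measurable_funTS.
by move=> x _; exact: integral_ge0.
Qed.

Lemma gagliardo_energy {E : zmodType} (M : E -> R) (delta l : R) (f f' : 'rV[R]_k -> E) :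
  measurable_fun setT (fun z : 'rV[R]_k * 'rV[R]_k => M (f' z.1 - f' z.2)) ->
  (forall x, G x -> f' x = f x) ->
  gagliardo M delta l G f = (slobodeckij_energy (G `\` N) M delta l f' `^ l^-1)%E.
Proof.
move=> mM ff'; rewrite /gagliardo /slobodeckij_energy; congr poweR.
rewrite -iterated_integral_null_set; last 2 first.
- apply/measurable_EFinP; apply: measurable_powR_div => //.
  by apply: measurable_enormB; [exact: measurable_fst|exact: measurable_snd].
- by move=> z; rewrite lee_fin mulr_ge0 ?invr_ge0 ?powR_ge0.
apply: eq_integral => x /set_mem Gx; apply: eq_integral => y /set_mem Gy /=.
by rewrite !ff'.
Qed.

End null_sets.

(** Extending f by -oo outside G turns the infimum into an essential supremum on the whole space,
    which is attained as a bound. *)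
Lemma ae_le_ereal_inf d (T : measurableType d) {R : realType} (m : {measure set T -> \bar R})
    (G : set T) (f : T -> \bar R) :
  {ae m, forall x, G x -> (f x <= ereal_inf [set a | {ae m, forall x, G x -> (f x <= a)%E}])%E}.
Proof.
pose g x := if x \in G then f x else -oo%E.
have gE a x : (g x <= a)%E <-> (G x -> (f x <= a)%E).
  rewrite /g; case: ifPn => [/set_mem Gx|/negP/mem_set]; first by split => // /(_ Gx).
  move=> nG; split => [_ Gx|_]; last by rewrite leNye.
  by move/set_mem : nG; rewrite mem_set.
have -> : [set a | {ae m, forall x, G x -> (f x <= a)%E}] =
    [set a | {ae m, forall x, (g x <= a)%E}].
  by apply/seteqP; split=> a /=; apply: filterS => x /gE.
have := ess_sup_inf.ess_sup_ge m g; rewrite ess_sup_inf.ess_supEae; apply: filterS => x /gE; exact.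
Qed.

Section holder_classes.
Context {R : realType} {k n : nat}.
Hypothesis k0 : (0 < k)%N.
Local Notation leb := (lebesgue_rV k).
Variables (G : set 'rV[R]_k) (theta : R) (u : 'rV[R]_k -> 'rV[R]_n).
Hypotheses (oG : open G) (G0 : G !=set0).
Local Notation H := (seminorm enorm theta +oo%E G u).

Let holder_quotient_ge0 (v : 'rV[R]_k -> 'rV[R]_n) : (0 <= holder_quotient enorm theta G v)%E.
Proof.
have [x [y [Gx Gy xy]]] := open_two_points k0 oG G0.
apply: (@le_trans _ _ (enorm (v y - v x) / enorm (y - x) `^ theta)%:E).
  by rewrite lee_fin mulr_ge0 ?enorm_ge0// invr_ge0 powR_ge0.
by apply: ereal_sup_ubound; exists x, y.
Qed.

Lemma holder_seminorm_fin : sobolev theta +oo%E G u -> exists2 h, 0 <= h & H = h%:E.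
Proof.
move=> [mu [v [mv vu vfin]]].
have H0 : (0 <= H)%E by apply: le_ereal_inf_tmp => _ [w _ <-]; exact: holder_quotient_ge0.
have Hfin : (H < +oo)%E.
  apply: (@le_lt_trans _ _ (holder_quotient enorm theta G v)).
    by apply: ereal_inf_lbound; exists v.
  apply: le_lt_trans vfin; rewrite leeDr//.
  have [x Gx] := G0; apply: (@le_trans _ _ (enorm (v x))%:E).
    by rewrite lee_fin enorm_ge0.
  by apply: ereal_sup_ubound; exists x.
exists (fine H); first exact: fine_ge0.
by rewrite fineK// ge0_fin_numE.
Qed.

(** The infimum over representatives is approached by a sequence v_j. Off the countable union of the
    exceptional sets every v_j equals u, so u inherits all the bounds h + 1/(j+1). *)
Lemma holder_seminorm_ae h : 0 <= h -> H = h%:E ->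
  exists N, [/\ measurable N, leb N = 0%E & forall x y, (G `\` N) x -> (G `\` N) y ->
    enorm (u x - u y) <= h * enorm (x - y) `^ theta].
Proof.
move=> h0 Hh.
have Hj (j : nat) : exists v : 'rV[R]_k -> 'rV[R]_n,
    {ae leb, forall x, G x -> v x = u x} /\
    (holder_quotient enorm theta G v < (h + j.+1%:R^-1)%:E)%E.
  have Hfin : H \is a fin_num by rewrite Hh.
  have j0 : 0 < j.+1%:R^-1 :> R by rewrite invr_gt0.
  have [_ [v vu <-]] := lb_ereal_inf_adherent j0 Hfin.
  by rewrite -/(seminorm enorm theta +oo%E G u) Hh -EFinD => ?; exists v.
have [v vP] := choice Hj.
have /ae_null_set[N [mN N0 HN]] : {ae leb, forall x, forall j, G x -> v j x = u x}.
  by apply: ae_foralln => j; exact: (vP j).1.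
exists N; split=> // x y [Gx Nx] [Gy Ny].
have [->|xy] := eqVneq x y; first by rewrite !subrr enorm0 mulr_ge0 ?powR_ge0.
have e0 : 0 < enorm (x - y) `^ theta by rewrite powR_gt0// enorm_gt0 subr_eq0.
rewrite -ler_pdivrMr//; apply/ler_addgt0Pr => e e_gt0.
have [j je] : exists j : nat, j.+1%:R^-1 <= e.
  have [j _ Hj'] := near_infty_natSinv_lt (PosNum e_gt0).
  by exists j; apply/ltW/(Hj' j); exact: leqnn.
apply: (@le_trans _ _ (h + j.+1%:R^-1)); last by rewrite lerD2l.
rewrite -lee_fin; apply: le_trans (ltW (vP j).2).
apply: ereal_sup_ubound; exists y, x; split=> //; first by rewrite eq_sym.
by rewrite !(HN _ _ j).
Qed.

End holder_classes.

(** For x = a and x = b one has x <= x^beta (a + b)^(1 - beta); adding the two and dividing gives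
    the claim. *)
Lemma powR_subadditive {R : realType} (a b beta : R) : 0 <= a -> 0 <= b -> 0 < beta <= 1 ->
  (a + b) `^ beta <= a `^ beta + b `^ beta.
Proof.
move=> a0 b0 /andP[beta0 beta1].
have := addr_ge0 a0 b0; rewrite le_eqVlt => /predU1P[<-|c0].
  by rewrite powR0 ?gt_eqF// addr_ge0 ?powR_ge0.
have b1 : 0 <= 1 - beta by rewrite subr_ge0.
have part x : 0 <= x -> x <= a + b -> x <= x `^ beta * (a + b) `^ (1 - beta).
  rewrite le_eqVlt => /predU1P[<-|x0] xc; first by rewrite powR0 ?gt_eqF// mul0r.
  apply: (@le_trans _ _ (x `^ beta * x `^ (1 - beta))).
    rewrite -powRD; last by rewrite (gt_eqF x0) implybT.
    by rewrite addrC subrK powRr1// ltW.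
  apply: ler_wpM2l; first exact: powR_ge0.
  by apply: ge0_ler_powR; rewrite ?nnegrE// ltW.
have c1 : 0 < (a + b) `^ (1 - beta) by exact: powR_gt0.
rewrite -(ler_pM2r c1) -powRD; last by rewrite (gt_eqF c0) implybT.
rewrite [beta + _]addrC subrK powRr1 ?(ltW c0)// mulrDl.
by apply: lerD; apply: part; rewrite // ?lerDl ?lerDr.
Qed.

(* McShane's extension: the infimum of the cones w y + rho x y with vertex y in D. *)
Lemma mcshane_extension {R : realType} (T : Type) (rho : T -> T -> R) (D : set T) (w : T -> R) :
  (forall x, rho x x = 0) -> (forall x y, 0 <= rho x y) -> (forall x y, rho x y = rho y x) ->
  (forall x y z, rho x z <= rho x y + rho y z) ->
  (forall x y, D x -> D y -> `|w x - w y| <= rho x y) ->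
  exists w', (forall x, D x -> w' x = w x) /\ forall x y, `|w' x - w' y| <= rho x y.
Proof.
move=> rho0 rho_ge0 rhoC tri Hw.
have [D0|/set0P[z0 Dz0]] := eqVneq D set0.
  by exists (cst 0); split=> [x|x y]; [rewrite D0|rewrite subrr normr0].
pose S x := [set w y + rho x y | y in D].
have low x y : D x -> lbound (S y) (w x - rho x y).
  move=> Dx _ [z Dz <-]; have := Hw x z Dx Dz; rewrite ler_norml => /andP[_].
  by have := tri x y z; lra.
have hi x : has_inf (S x).
  by split; [exists (w z0 + rho x z0); exists z0|exists (w z0 - rho z0 x); exact: low].
exists (fun x => inf (S x)); split.
  move=> x Dx; apply/eqP; rewrite eq_le; apply/andP; split.
    apply: ge_inf; first exact: (hi x).2.
    by exists x => //; rewrite rho0 addr0.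
  apply: lb_le_inf; first exact: (hi x).1.
  by have := low x x Dx; rewrite rho0 subr0.
have half x y : inf (S x) <= inf (S y) + rho x y.
  rewrite -lerBlDr; apply: lb_le_inf; first exact: (hi y).1.
  move=> _ [z Dz <-]; rewrite lerBlDr.
  apply: (@le_trans _ _ (w z + rho x z)).
    by apply: ge_inf; [exact: (hi x).2|exists z].
  by have := tri x y z; lra.
move=> x y; rewrite ler_norml lerBlDr [_ + inf _]addrC half andbT.
by have := half y x; rewrite (rhoC y); lra.
Qed.

(** * Reduction to a set of full measure *)

Section reduction.
Context {R : realType} {k n : nat}.
Hypotheses (k0 : (0 < k)%N) (n0 : (0 < n)%N).
Local Notation leb := (lebesgue_rV k).
Variables (phi phit : 'rV[R]_n -> R) (s : R).
Hypotheses (bv : BV phi) (s01 : 0 < s < 1) (rep : lebesgue_representative phi phit).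
Local Notation U := (gradient_potential phi s).

(** How the energy is used on the reduced set: an integral of the real-valued v for p finite, a
    bound at every point of D for p = +oo. *)
Definition potential_on (p : \bar R) (G : set 'rV[R]_k) (u : 'rV[R]_k -> 'rV[R]_n)
    (D : set 'rV[R]_k) (v : 'rV[R]_k -> R) : Prop :=
  match p with
  | p'%:E => V_energy phi s p G u = (\int[leb]_(x in D) (v x `^ p')%:E)%E
  | +oo%E => exists V, [/\ 0 <= V, V_energy phi s p G u = V%:E & forall x, D x -> v x <= V]
  | -oo%E => False
  end.

Let U0 x : (0 <= U x)%E. Proof. exact: riesz_potential_ge0. Qed.

(** Finite energy makes the potential finite almost everywhere along u. The conclusion is stated for
    every null set M containing N, so that the exceptional set of the Hoelder bound can be added
    later. *)
Lemma potential_reduction (p : \bar R) (G : set 'rV[R]_k) (u u' : 'rV[R]_k -> 'rV[R]_n) :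
  (1 <= p)%E -> measurable G -> (0 < leb G)%E -> measurable_fun setT u' ->
  (forall x, G x -> u' x = u x) -> (V_energy phi s p G u < +oo)%E ->
  exists N, [/\ measurable N, leb N = 0%E & forall M, measurable M -> leb M = 0%E -> N `<=` M ->
    (forall x, (G `\` M) x -> (U (u' x) < +oo)%E) /\
    potential_on p G u (G `\` M) (fun x => fine (U (u' x)))].
Proof.
move=> p1 mG G0 mu' u'u; case: p p1 => [p||//] p1 /=.
  have p0 : 0 < p by rewrite -lte_fin; exact: lt_le_trans p1.
  have -> : (\int[leb]_(x in G) U (u x) `^ p = \int[leb]_(x in G) U (u' x) `^ p)%E.
    by apply: eq_integral => x /set_mem Gx; rewrite u'u.
  have mUp : measurable_fun setT (fun x => U (u' x) `^ p)%E.
    apply: (measurableT_comp (measurable_poweR p)).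
    exact: (measurableT_comp (measurable_gradient_potential phi s)).
  have Up0 x : (0 <= U (u' x) `^ p)%E by exact: poweR_ge0.
  move=> fin; have /integrable_ae : leb.-integrable G (fun x => U (u' x) `^ p)%E.
    apply/integrableP; split; first exact: measurable_funTS.
    by under eq_integral do rewrite gee0_abs//.
  move=> /(_ mG)/ae_null_set[N [mN N0 HN]]; exists N; split=> // M mM M0 NM.
  have Ufin x : (G `\` M) x -> (U (u' x) < +oo)%E.
    move=> [Gx Mx]; rewrite ltNge leye_eq; apply/negP => /eqP Uoo.
    by have := HN x (fun h => Mx (NM _ h)) Gx; rewrite Uoo poweRyr// gt_eqF.
  split=> //; rewrite (ge0_negligible_integral mM mG)//; last exact: measurable_funTS.
  apply: eq_integral => x /set_mem Dx; rewrite -poweR_EFin fineK//.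
  by rewrite ge0_fin_numE// Ufin.
set V := ereal_inf _ => Vfin.
have /ae_null_set[N [mN N0 HN]] := ae_le_ereal_inf leb G (fun x => U (u x)).
exists N; split=> // M mM M0 NM.
have UV x : (G `\` M) x -> (U (u' x) <= V)%E.
  by move=> [Gx Mx]; rewrite u'u//; apply: HN => // /NM.
split; first by move=> x Dx; exact: le_lt_trans (UV x Dx) Vfin.
(* G has positive measure; a point of the remainder shows that the essential supremum is
   nonnegative. *)
have [x0 Dx0] : (G `\` M) !=set0.
  apply/set0P/eqP => D0; have : (leb G <= leb M)%E.
    apply: le_measure; rewrite ?inE// => x Gx; apply: contrapT => nM.
    by rewrite -[False]/(set0 x) -D0.
  by rewrite leNgt => /negP; apply; move: M0 => /= ->.
have V0 : (0 <= V)%E by apply: le_trans (UV x0 Dx0).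
exists (fine V); split; [exact: fine_ge0|by rewrite fineK// ge0_fin_numE|move=> x Dx].
apply: fine_le; last exact: UV.
- by rewrite ge0_fin_numE//; exact: le_lt_trans (UV x Dx) Vfin.
- by rewrite ge0_fin_numE.
Qed.

(* u' is a Borel extension of u, and D is G without a null set off which every
   almost-everywhere property of u holds at each point. *)
Record reduced (C theta : R) (p q : \bar R) (G : set 'rV[R]_k) (u : 'rV[R]_k -> 'rV[R]_n)
    (D : set 'rV[R]_k) (u' : 'rV[R]_k -> 'rV[R]_n) : Prop := Reduced {
  reduced_measurable : measurable D;
  reduced_sub : D `<=` G;
  reduced_ae : {ae leb, forall x, G x -> D x};
  reduced_fun : measurable_fun setT u';
  reduced_eq : forall x, G x -> u' x = u x;
  reduced_potential : potential_on p G u D (fun x => fine (U (u' x)));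
  reduced_pointwise : forall x y, D x -> D y -> `|phit (u' x) - phit (u' y)| <=
    C * enorm (u' x - u' y) `^ s * (fine (U (u' x)) + fine (U (u' y)));
  reduced_holder : q = +oo%E -> exists h, [/\ 0 <= h, seminorm enorm theta q G u = h%:E &
    forall x y, D x -> D y -> enorm (u' x - u' y) <= h * enorm (x - y) `^ theta];
  reduced_gagliardo : forall delta l, gagliardo enorm delta l G u =
    (slobodeckij_energy D enorm delta l u' `^ l^-1)%E;
  reduced_gagliardo_comp : forall delta l, gagliardo Num.norm delta l G (phit \o u) =
    (slobodeckij_energy D Num.norm delta l (phit \o u') `^ l^-1)%E
}.

Lemma reduction theta (p q : \bar R) (G : set 'rV[R]_k) (u : 'rV[R]_k -> 'rV[R]_n) :
  (1 <= p)%E -> open G -> G !=set0 -> sobolev theta q G u -> V_space phi s p G u ->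
  exists D u', reduced (2 * lebesgue_point_cst n s) theta p q G u D u'.
Proof.
move=> p1 oG G0 sob [mu Vfin].
have mG : measurable G := open_measurable_rV oG.
have [u' mu' u'u] := measurable_extension mG mu.
have [N1 [mN1 N10 HN1]] := potential_reduction p1 mG (open_measure_gt0 oG G0) mu' u'u Vfin.
have [N2 [mN2 N20 HN2]] : exists N, [/\ measurable N, leb N = 0%E &
    q = +oo%E -> exists h, [/\ 0 <= h, seminorm enorm theta q G u = h%:E &
      forall x y, (G `\` N) x -> (G `\` N) y -> enorm (u x - u y) <= h * enorm (x - y) `^ theta]].
  case: q sob => [q|sob|] ; [by exists set0|idtac|by exists set0].
  have [h h0 Hh] := holder_seminorm_fin k0 oG G0 sob.
  have [N [mN N0 HN]] := holder_seminorm_ae h0 Hh.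
  by exists N; split=> // _; exists h.
pose M := N1 `|` N2.
have mM : measurable M by exact: measurableU.
have M0 : leb M = 0%E by rewrite -N10; exact: measureU0.
have [Ufin pot] := HN1 M mM M0 (@subsetUl _ _ _).
exists (G `\` M), u'; split=> //.
- exact: measurableD.
- exists M; split=> // x /= nGD; apply: contrapT => Mx; apply: nGD => Gx; exact: conj.
- by move=> x y Dx Dy; apply: representative_holder => //; exact: Ufin.
- move=> qoo; have [h [h0 Hh HN]] := HN2 qoo; exists h; split=> // x y [Gx Mx] [Gy My].
  rewrite !u'u//; apply: HN; split=> // ?; [apply: Mx|apply: My]; exact: or_intror.
- move=> delta l; apply: gagliardo_energy => //; apply: measurable_enormB.
    by apply: (measurableT_comp mu'); exact: measurable_fst.
  by apply: (measurableT_comp mu'); exact: measurable_snd.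
- move=> delta l; apply: gagliardo_energy => //=; last by move=> x Gx; rewrite u'u.
  have mw : measurable_fun setT (phit \o u') by apply: measurableT_comp => //; exact: rep.1.
  apply: (measurableT_comp (@normr_measurable _ _)); apply: measurable_funB.
    by apply: (measurableT_comp mw); exact: measurable_fst.
  by apply: (measurableT_comp mw); exact: measurable_snd.
Qed.

End reduction.

(** * The estimates *)

(** One expression for both forms of the last factor of the estimate. *)
Definition V_norm {R : realType} {k n : nat} (phi : 'rV[R]_n -> R) (s : R) (p : \bar R)
    (G : set 'rV[R]_k) (u : 'rV[R]_k -> 'rV[R]_n) : \bar R :=
  (if p is p'%:E then V_energy phi s p G u `^ p'^-1 else V_energy phi s p G u)%E.

Lemma poweR_root_le {R : realType} (X Y : \bar R) (r : R) : 0 < r ->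
  (0 <= X)%E -> (X <= Y)%E -> (X `^ r^-1 <= Y `^ r^-1)%E.
Proof.
move=> r0 X0 XY; have r1 : 0 <= r^-1 by rewrite invr_ge0 ltW.
by apply: (gt0_ler_poweR r1 _ _ XY); rewrite in_itv/= leey andbT//; exact: le_trans XY.
Qed.

Lemma powR_root {R : realType} (x r : R) : 0 <= x -> 0 < r -> (x `^ r) `^ r^-1 = x.
Proof. by move=> x0 r0; rewrite -powRrM mulfV ?gt_eqF// powRr1. Qed.

Section estimates.
Context {R : realType} {k n : nat}.
Local Notation leb := (lebesgue_rV k).
Variables (phi phit : 'rV[R]_n -> R) (C s theta beta : R) (p q : \bar R).
Hypotheses (s01 : 0 < s < 1) (rep : lebesgue_representative phi phit).
Hypothesis C0 : 0 <= C.
Variables (G D : set 'rV[R]_k) (u u' : 'rV[R]_k -> 'rV[R]_n).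
Hypothesis red : reduced phi phit s C theta p q G u D u'.
Local Notation U := (gradient_potential phi s).
Local Notation Vn := (V_norm phi s p G u).

Let v x : R := fine (U (u' x)).

Let v0 x : 0 <= v x. Proof. by rewrite fine_ge0// riesz_potential_ge0. Qed.

Let mv : measurable_fun setT v.
Proof.
apply: measurableT_comp => //.
apply: (measurableT_comp (measurable_gradient_potential phi s)); exact: reduced_fun red.
Qed.

Let mw : measurable_fun setT (phit \o u').
Proof. by apply: measurableT_comp; [exact: rep.1|exact: reduced_fun red]. Qed.

Let s0 : 0 <= s. Proof. by have /andP[/ltW] := s01. Qed.

Let mD : measurable D. Proof. exact: reduced_measurable red. Qed.

Let wuv x y : D x -> D y ->
  `|(phit \o u') x - (phit \o u') y| <= C * enorm (u' x - u' y) `^ s * (v x + v y).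
Proof. exact: (reduced_pointwise red). Qed.

(* As fine +oo = 0 and 0^-1 = 0, the exponent is 1/t when p' = +oo. *)
Definition volume_cst (d t : R) (p' : \bar R) : R := ((4 * d) ^+ k) `^ (t^-1 - (fine p')^-1).

Let diam_volume (d : R) : 0 < d -> (forall x y, D x -> D y -> enorm (x - y) <= d) ->
  (leb D <= ((4 * d) ^+ k)%:E)%E.
Proof.
move=> d0 diamD; have [->|/set0P[x Dx]] := eqVneq D set0.
  by rewrite measure0 lee_fin exprn_ge0// mulr_ge0// ltW.
apply: (@le_trans _ _ (leb (cube x (2 * d)))).
  apply: le_measure; rewrite ?inE//; first exact: measurable_cube.
  move=> y Dy i; apply: (@le_lt_trans _ _ d); last by rewrite mulr_natl mulr2n ltrDl.
  by have := le_trans (coord_le_enorm (y - x) i) (diamD y x Dy Dx); rewrite !mxE.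
rewrite lebesgue_rV_cube; last by rewrite mulr_ge0// ltW.
by rewrite mulrA -natrM.
Qed.

(** Passing from the exponent t up to p costs a power of the volume of D, which is controlled by the
    diameter bound d. *)
Let potential_integral_le (t d : R) : 0 < t -> (t%:E <= p)%E -> 0 < d ->
  (forall x y, D x -> D y -> enorm (x - y) <= d) ->
  ((\int[leb]_(x in D) (v x `^ t)%:E) `^ t^-1 <= (volume_cst d t p)%:E * Vn)%E.
Proof.
move=> t0 tp d0 diamD; have lebD := diam_volume d0 diamD.
have B0 : 0 <= (4 * d) ^+ k by rewrite exprn_ge0// mulr_ge0// ltW.
have := reduced_potential red; rewrite /V_norm /volume_cst; case: p tp => [p'||//] tp /=.
  move=> ->; rewrite lee_fin in tp; have tp' : 0 < t <= p' by rewrite t0.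
  apply: (le_trans (le_integral_powR leb mD mv v0 tp')).
  apply: lee_wpmul2r; first exact: poweR_ge0.
  rewrite -poweR_EFin; have e0 : 0 <= t^-1 - p'^-1.
    by rewrite subr_ge0 lef_pV2 ?posrE// (lt_le_trans t0).
  by apply: (gt0_ler_poweR e0 _ _ lebD); rewrite in_itv/= leey andbT ?lee_fin.
case=> V [V0 -> vV]; rewrite invr0 subr0.
apply: (@le_trans _ _ (((V `^ t)%:E * ((4 * d) ^+ k)%:E) `^ t^-1)%E).
  apply: poweR_root_le => //; first by apply: integral_ge0 => x _; rewrite lee_fin powR_ge0.
  apply: (@le_trans _ _ (\int[leb]_(x in D) (V `^ t)%:E)%E).
    apply: ge0_le_integral => //.
    - by move=> x _; rewrite lee_fin powR_ge0.
    - apply: measurable_funTS; apply/measurable_EFinP; exact: measurable_powR_fun.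
    - move=> x Dx; rewrite lee_fin; apply: ge0_ler_powR; rewrite ?nnegrE ?(ltW t0)//.
      exact: vV.
  by rewrite integral_cst//; apply: lee_wpmul2l; rewrite ?lee_fin ?powR_ge0.
by rewrite -EFinM poweR_EFin powRM ?powR_ge0// powR_root// mulrC EFinM.
Qed.

Let kernel_cst (t d : R) : R := 2 `^ t * 2 * riesz_kernel_cst k ((theta * s - beta) * t) d.

Let energy_ge0 {E : zmodType} (M : E -> R) delta l f : (0 <= slobodeckij_energy D M delta l f)%E.
Proof. by apply: integral_ge0 => z _; rewrite lee_fin mulr_ge0 ?invr_ge0 ?powR_ge0. Qed.

Let kernel_cst_ge0 t d : 0 < d -> 0 < t -> beta < theta * s -> 0 <= kernel_cst t d.
Proof.
move=> d0 t0 bts; apply: mulr_ge0; first by rewrite mulr_ge0 ?powR_ge0.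
by apply/ltW/riesz_kernel_cst_gt0; rewrite ?mulr_gt0// subr_gt0.
Qed.

Let kernel_root_le (t d : R) : 0 < t -> (t%:E <= p)%E -> 0 < d -> beta < theta * s ->
  (forall x y, D x -> D y -> enorm (x - y) <= d) ->
  (((kernel_cst t d)%:E * \int[leb]_(x in D) (v x `^ t)%:E) `^ t^-1 <=
    (kernel_cst t d `^ t^-1 * volume_cst d t p)%:E * Vn)%E.
Proof.
move=> t0 tp d0 bts diamD.
rewrite poweRM; last 2 first.
- by rewrite lee_fin kernel_cst_ge0.
- by apply: integral_ge0 => x _; rewrite lee_fin powR_ge0.
rewrite poweR_EFin EFinM -muleA; apply: lee_wpmul2l; first by rewrite lee_fin powR_ge0.
exact: potential_integral_le.
Qed.

Definition interpolation_cst (t d : R) : R :=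
  C * ((2 `^ t * 2 * riesz_kernel_cst k ((theta * s - beta) * t) d) `^ t^-1 * volume_cst d t p).

(** The strict inequality s r < q keeps both Hoelder weights A = s r / q and 1 - A positive; after
    the r-th root, A / r = s / q gives the power s of the seminorm and (1 - A) / r = 1 / t the root
    of the potential. *)
Lemma estimate_interpolation (r q' t d : R) : q = q'%:E -> 0 < r -> 0 < q' -> s * r < q' ->
  t^-1 = r^-1 - s / q' -> (t%:E <= p)%E -> 0 < d ->
  (forall x y, D x -> D y -> enorm (x - y) <= d) -> beta < theta * s ->
  (seminorm Num.norm beta r%:E G (phit \o u) <=
    (interpolation_cst t d)%:E * seminorm enorm theta q G u `^ s * Vn)%E.
Proof.
move=> qq' r0 q0 A1 tE tp d0 diamD bts; rewrite qq' /=.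
rewrite (reduced_gagliardo_comp red) (reduced_gagliardo red).
have /andP[s_gt0 _] := s01.
pose A := s * r / q'.
have A01 : 0 < A < 1 by rewrite /A divr_gt0 ?mulr_gt0//= ltr_pdivrMr// mul1r.
have ti : 0 < t^-1.
  by rewrite tE subr_gt0 ltr_pdivrMr// ltr_pdivlMl// mulrC.
have t0 : 0 < t by rewrite invr_gt0 in ti.
have tA : t^-1 = (1 - A) / r by rewrite tE /A; field; rewrite !gt_eqF.
have qA : q' * A = s * r by rewrite /A; field; rewrite gt_eqF.
have tA' : t * (1 - A) = r.
  apply: (mulfI (lt0r_neq0 ti)); rewrite mulrA mulVf ?gt_eqF// mul1r tA.
  by field; rewrite gt_eqF.
have H := energy_interpolation mD mw (reduced_fun red) mv v0 C0 r0 wuv d0 diamD A01 qA tA' bts.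
apply: (le_trans (poweR_root_le r0 (energy_ge0 _ _ _ _) H)).
rewrite poweRM; [|by rewrite lee_fin powR_ge0|by rewrite mule_ge0 ?poweR_ge0].
rewrite poweRM ?poweR_ge0// -!poweRrM -tA poweR_EFin -powRrM mulfV ?gt_eqF// powRr1//.
have -> : A / r = q'^-1 * s by rewrite /A; field; rewrite !gt_eqF.
have alg (a b : R) (X Y : \bar R) : (a%:E * (X * (b%:E * Y)) = (a * b)%:E * X * Y)%E.
  by rewrite EFinM (muleAC a%:E b%:E) !muleA.
rewrite /interpolation_cst -/(kernel_cst t d) -alg.
apply: lee_wpmul2l; first by rewrite lee_fin.
by apply: lee_wpmul2l; [exact: poweR_ge0|exact: kernel_root_le].
Qed.

Lemma estimate_lipschitz (r d : R) : q = +oo%E -> 0 < r -> (r%:E <= p)%E -> 0 < d ->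
  (forall x y, D x -> D y -> enorm (x - y) <= d) -> beta < theta * s ->
  (seminorm Num.norm beta r%:E G (phit \o u) <=
    (interpolation_cst r d)%:E * seminorm enorm theta q G u `^ s * Vn)%E.
Proof.
move=> qoo r0 rp d0 diamD bts.
have [h [h0 -> uh]] := reduced_holder red qoo.
rewrite [leLHS](reduced_gagliardo_comp red).
have H := energy_lipschitz mD mw mv v0 C0 s0 r0 wuv d0 h0 diamD uh bts.
apply: (le_trans (poweR_root_le r0 (energy_ge0 _ _ _ _) H)).
have I0 : (0 <= \int[leb]_(x in D) (v x `^ r)%:E)%E.
  by apply: integral_ge0 => x _; rewrite lee_fin powR_ge0.
rewrite poweRM; last 2 first.
- by rewrite lee_fin; apply: mulr_ge0; exact: powR_ge0.
- by apply: mule_ge0 => //; rewrite lee_fin; exact: kernel_cst_ge0.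
have -> : ((C `^ r * h `^ (s * r))%:E `^ r^-1 = (C * h `^ s)%:E)%E.
  by rewrite poweR_EFin powRM ?powR_ge0// powR_root// (powRrM h) powR_root ?powR_ge0.
apply: le_trans (lee_wpmul2l _ (kernel_root_le r0 rp d0 bts diamD)) _.
  by rewrite lee_fin mulr_ge0 ?powR_ge0.
rewrite muleA -EFinM poweR_EFin -EFinM /interpolation_cst -/(kernel_cst r d).
have alg (a b c : R) : a * b * c = a * c * b by ring.
by rewrite (alg C).
Qed.

Lemma estimate_bounded (r M : R) : p = +oo%E -> q = (s * r)%:E -> 0 < r -> 0 <= M ->
  (forall x y, D x -> D y -> enorm (x - y) `^ ((theta * s - beta) * r) <= M) ->
  (seminorm Num.norm beta r%:E G (phit \o u) <=
    (C * (2 * M `^ r^-1))%:E * seminorm enorm theta q G u `^ s * Vn)%E.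
Proof.
move=> poo qsr r0 M0 eM; rewrite qsr /=.
rewrite (reduced_gagliardo_comp red) (reduced_gagliardo red).
have := reduced_potential red; rewrite /V_norm poo /= => -[V [V0 -> vV]].
have /andP[s_gt0 _] := s01.
have H := energy_bounded mD mw (reduced_fun red) v0 C0 r0 wuv vV eM.
apply: (le_trans (poweR_root_le r0 (energy_ge0 _ _ _ _) H)).
have c0 : 0 <= C `^ r * (2 * V) `^ r by apply: mulr_ge0; exact: powR_ge0.
rewrite poweRM; [|by rewrite lee_fin mulr_ge0|exact: energy_ge0].
have -> : ((C `^ r * (2 * V) `^ r * M)%:E `^ r^-1 = (C * (2 * V) * M `^ r^-1)%:E)%E.
  rewrite poweR_EFin (powRM _ c0 M0) powRM ?powR_ge0//.
  by rewrite !powR_root// mulr_ge0.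
rewrite -poweRrM; have -> : (s * r)^-1 * s = r^-1 by field; rewrite !gt_eqF.
rewrite [leRHS]muleAC -EFinM.
have alg (a b c : R) : a * (2 * b) * c = a * (2 * c) * b by ring.
by rewrite alg.
Qed.

(** For 0 < beta <= 1 the function |x - y|^beta is a metric, so the extension from D keeps the
    constant K. It agrees with the composition almost everywhere on G and is thus a competitor in
    the infimum defining the seminorm. *)
Lemma estimate_holder (M : R) : p = +oo%E -> q = +oo%E -> 0 <= M -> 0 < beta <= 1 ->
  (forall x y, D x -> D y -> enorm (x - y) `^ (theta * s) <= M * enorm (x - y) `^ beta) ->
  (seminorm Num.norm beta +oo%E G (phit \o u) <=
    (C * (2 * M))%:E * seminorm enorm theta q G u `^ s * Vn)%E.
Proof.
move=> poo qoo M0 beta01 eM; have [h [h0 -> uh]] := reduced_holder red qoo.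
have := reduced_potential red; rewrite /V_norm poo /= => -[V [V0 -> vV]].
pose K := C * (2 * M) * h `^ s * V.
have K0 : 0 <= K by rewrite /K; do 4?[apply: mulr_ge0 => //]; exact: powR_ge0.
have wK x y : D x -> D y -> `|(phit \o u') x - (phit \o u') y| <= K * enorm (x - y) `^ beta.
  move=> Dx Dy; apply: (le_trans (wuv Dx Dy)).
  have -> : K * enorm (x - y) `^ beta = C * (h `^ s * (M * enorm (x - y) `^ beta)) * (2 * V).
    by rewrite /K; ring.
  apply: ler_pM.
  - by rewrite mulr_ge0 ?powR_ge0.
  - by rewrite addr_ge0.
  - apply: ler_wpM2l => //; apply: (@le_trans _ _ ((h * enorm (x - y) `^ theta) `^ s)).
      by apply: ge0_ler_powR; rewrite ?nnegrE ?enorm_ge0 ?mulr_ge0 ?powR_ge0// uh.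
    rewrite powRM ?powR_ge0// -powRrM; apply: ler_wpM2l; first exact: powR_ge0.
    exact: eM.
  - by rewrite mulr_natl mulr2n; apply: lerD; exact: vV.
have [||||f [fw fK]] := mcshane_extension _ _ _ _ wK.
- by move=> x; rewrite subrr enorm0 powR0 ?mulr0// gt_eqF//; have /andP[] := beta01.
- by move=> x y; rewrite mulr_ge0 ?powR_ge0.
- by move=> x y; rewrite enorm_distC.
- move=> x y z; rewrite -mulrDr; apply: ler_wpM2l => //.
  apply: le_trans (powR_subadditive (enorm_ge0 _) (enorm_ge0 _) beta01).
  apply: ge0_ler_powR; rewrite ?nnegrE ?addr_ge0 ?enorm_ge0//.
    by have /andP[/ltW] := beta01.
  by rewrite -[x - z](subrKA y); exact: ler_enormD.
apply: (@le_trans _ _ (holder_quotient Num.norm beta G f)).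
  apply: ereal_inf_lbound; exists f => //=.
  have := reduced_ae red; apply: filterS => x GD Gx.
  by rewrite (fw x (GD Gx)) /= (reduced_eq red Gx).
rewrite -!EFinM; apply: ge_ereal_sup => _ [x [y [Gx Gy xy ->]]].
rewrite lee_fin ler_pdivrMr; first exact: fK.
by rewrite powR_gt0// enorm_gt0 subr_eq0 eq_sym.
Qed.

End estimates.

(** * The composition theorem *)

Lemma lebesgue_point_cst_gt0 {R : realType} (n : nat) (s : R) : (0 < n)%N -> 0 < s ->
  0 < lebesgue_point_cst n s.
Proof.
move=> n0 s0; have q1 := half_powR_lt1 s0.
have nR : 0 < n%:R :> R by rewrite ltr0n.
rewrite /lebesgue_point_cst; apply: mulr_gt0; last exact: exprn_gt0.
apply: mulr_gt0; last exact: powR_gt0.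
apply: mulr_gt0.
  rewrite /oscillation_cst; apply: mulr_gt0; last by rewrite powR_gt0// mulr_gt0.
  by rewrite mulr_gt0 ?exprn_gt0// mulr_gt0.
by rewrite addr_gt0// divr_gt0// subr_gt0.
Qed.

Lemma composition_estimate_of_reduced {R : realType} (k n : nat) (s theta beta : R)
    (p q r : \bar R) (c : R) (G : set 'rV[R]_k) :
  (0 < k)%N -> (0 < n)%N -> 0 < s < 1 -> (1 <= p)%E -> bounded_domain G ->
  (forall (phi phit : 'rV[R]_n -> R) u D u', lebesgue_representative phi phit ->
    reduced phi phit s (2 * lebesgue_point_cst n s) theta p q G u D u' ->
    (seminorm Num.norm beta r G (phit \o u) <=
      c%:E * seminorm enorm theta q G u `^ s * V_norm phi s p G u)%E) ->
  composition_estimate k n s theta beta p q r c G.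
Proof.
move=> k0 n0 s01 p1 [G0 oG _ _] H phi u bv sob Vs phit rep.
have [D [u' red]] := reduction k0 n0 bv s01 rep p1 oG G0 sob Vs.
have := H phi phit u D u' rep red.
by rewrite /V_norm; case: p p1 Vs {H red} => [p'||//] _ _ /= E; split.
Qed.

Lemma interpolation_cst_gt0 {R : realType} (k : nat) (C s theta beta : R) p (t d : R) :
  0 < C -> 0 < t -> 0 < d -> beta < theta * s ->
  0 < @interpolation_cst R k C s theta beta p t d.
Proof.
move=> C0 t0 d0 bts; apply: mulr_gt0 => //; apply: mulr_gt0; last first.
  by apply: powR_gt0; apply: exprn_gt0; exact: mulr_gt0.
apply: powR_gt0; apply: mulr_gt0; first by rewrite mulr_gt0// powR_gt0.
by apply: riesz_kernel_cst_gt0; rewrite ?mulr_gt0// subr_gt0.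
Qed.

(* The inverse of +oo is read off as (fine +oo)^-1 = 0^-1 = 0. *)
Lemma exponents_finite {R : realType} (s : R) (p q r : \bar R) :
  (1 <= p)%E -> (1 <= q)%E -> (1 <= r)%E ->
  (p^-1 + s%:E * q^-1 <= r^-1)%E -> (fine p)^-1 + s * (fine q)^-1 <= (fine r)^-1.
Proof.
have E (x : \bar R) : (1 <= x)%E -> (x^-1 = ((fine x)^-1)%:E)%E.
  case: x => [x||//] x1 /=; last by rewrite invr0.
  by rewrite inver gt_eqF//; move: x1; rewrite lee_fin; exact: lt_le_trans.
by move=> p1 q1 r1; rewrite (E p p1) (E q q1) (E r r1) -EFinM -EFinD lee_fin.
Qed.

Lemma exponent_infinite {R : realType} (x : \bar R) : (1 <= x)%E -> (fine x)^-1 <= 0 -> x = +oo%E.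
Proof.
case: x => [x||//] //=; rewrite lee_fin => x1; rewrite invr_le0 => x0.
by have := le_trans x1 x0; rewrite ler10.
Qed.

Lemma lee_fine_inv {R : realType} (t : R) (p : \bar R) : 0 < t -> (1 <= p)%E ->
  (fine p)^-1 <= t^-1 -> (t%:E <= p)%E.
Proof.
move=> t0; case: p => [p||//] /= p1; last by rewrite leey.
have p0 : 0 < p by move: p1; rewrite lee_fin; exact: lt_le_trans.
by rewrite lef_pV2 ?posrE// lee_fin.
Qed.

Section composition_theorem.
Context {R : realType} {k n : nat}.
Variables (s theta beta : R) (p q r : \bar R).
Hypotheses (k0 : (0 < k)%N) (n0 : (0 < n)%N) (s01 : 0 < s < 1).
Hypotheses (p1 : (1 <= p)%E) (q1 : (1 <= q)%E) (r1 : (1 <= r)%E).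
Hypothesis pqr : (p^-1 + s%:E * q^-1 <= r^-1)%E.
Hypothesis theta01 : 0 < theta < 1.

Let C : R := 2 * lebesgue_point_cst n s.

Let C0 : 0 < C.
Proof. by apply: mulr_gt0 => //; apply: lebesgue_point_cst_gt0 => //; case/andP: s01. Qed.

Let s0 : 0 < s. Proof. by case/andP: s01. Qed.

Let pqr' : (fine p)^-1 + s * (fine q)^-1 <= (fine r)^-1.
Proof. exact: exponents_finite. Qed.

Let fine_ge0 (x : \bar R) : (1 <= x)%E -> 0 <= (fine x)^-1.
Proof. by move=> x1; rewrite invr_ge0 fine_ge0// (le_trans _ x1). Qed.

Let beta_le1 : beta <= theta * s -> beta <= 1.
Proof.
move=> b; apply: (le_trans b); have /andP[t0 t1] := theta01; have /andP[_ s1] := s01.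
by rewrite -[leRHS]mulr1 ler_pM// ltW.
Qed.

(** With 1/r = 0 the nonnegative terms 1/p and s/q both vanish. *)
Let pq_infinite : r = +oo%E -> p = +oo%E /\ q = +oo%E.
Proof.
move=> roo; move: pqr'; rewrite roo /= invr0 => H.
have P := fine_ge0 p1; have Q := fine_ge0 q1.
have sQ : 0 <= s * (fine q)^-1 by rewrite mulr_ge0// ltW.
split; apply: exponent_infinite => //.
  by apply: le_trans H; rewrite lerDl.
have : s * (fine q)^-1 <= 0 by apply: le_trans H; rewrite lerDr.
by rewrite pmulr_rle0.
Qed.

(** Here s/q = 1/r already exhausts the right-hand side, leaving 1/p <= 0. *)
Let p_infinite r' : r = r'%:E -> q = (s * r')%:E -> p = +oo%E.
Proof.
move=> rr' qsr; apply: exponent_infinite => //.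
have r0 : 0 < r' by move: r1; rewrite rr' lee_fin; exact: lt_le_trans.
move: pqr'; rewrite rr' qsr /= invfM mulrA mulfV ?gt_eqF// mul1r.
by rewrite gerDr.
Qed.

Let estimate_oo (M : R) (G : set 'rV[R]_k) : r = +oo%E -> 0 <= M -> 0 < beta <= theta * s ->
  bounded_domain G ->
  (forall x y, G x -> G y -> enorm (x - y) `^ (theta * s) <= M * enorm (x - y) `^ beta) ->
  composition_estimate k n s theta beta p q r (C * (2 * M)) G.
Proof.
move=> roo M0 /andP[b0 b1] Gb GM; have [poo qoo] := pq_infinite roo.
apply: composition_estimate_of_reduced => // phi phit u D u' rep red; rewrite roo.
apply: (estimate_holder s01 (ltW C0) red) => //; first by rewrite b0 beta_le1.
by move=> x y Dx Dy; apply: GM; exact: (reduced_sub red).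
Qed.

Let estimate_p_oo (r' M : R) (G : set 'rV[R]_k) : r = r'%:E -> q = (s * r')%:E -> 0 <= M ->
  bounded_domain G ->
  (forall x y, G x -> G y -> enorm (x - y) `^ ((theta * s - beta) * r') <= M) ->
  composition_estimate k n s theta beta p q r (C * (2 * M `^ r'^-1)) G.
Proof.
move=> rr' qsr M0 Gb GM; have poo := p_infinite rr' qsr.
have r0 : 0 < r' by move: r1; rewrite rr' lee_fin; exact: lt_le_trans.
apply: composition_estimate_of_reduced => // phi phit u D u' rep red; rewrite rr'.
apply: (estimate_bounded s01 rep (ltW C0) red) => //.
by move=> x y Dx Dy; apply: GM; exact: (reduced_sub red).
Qed.

Lemma subcritical_estimate (diam : R) : 0 < beta < theta * s ->
  exists c : R, 0 < c /\ forall G : set 'rV[R]_k, bounded_domain G ->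
    (forall x y, G x -> G y -> enorm (x - y) <= diam) ->
    composition_estimate k n s theta beta p q r c G.
Proof.
(* [diam] is an arbitrary real, so the maximum provides a positive bound. *)
move=> /andP[b0 bts]; pose d := Num.max diam 1.
have d0 : 0 < d by rewrite lt_max ltr01 orbT.
have g0 : 0 < theta * s - beta by rewrite subr_gt0.
have powR_diam (G : set 'rV[R]_k) (a : R) x y : (forall x y, G x -> G y -> enorm (x - y) <= diam) ->
    G x -> G y -> 0 <= a -> enorm (x - y) `^ a <= d `^ a.
  move=> H Gx Gy a0; apply: ge0_ler_powR; rewrite ?nnegrE ?enorm_ge0 ?(ltW d0)//.
  by rewrite le_max H.
have diamD (G D : set 'rV[R]_k) : D `<=` G -> (forall x y, G x -> G y -> enorm (x - y) <= diam) ->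
    forall x y, D x -> D y -> enorm (x - y) <= d.
  by move=> DG H x y Dx Dy; rewrite le_max H//; exact: DG.
case rE : r r1 => [r'||//] r1'; last first.
  exists (C * (2 * d `^ (theta * s - beta))); split.
    by rewrite mulr_gt0// mulr_gt0// powR_gt0.
  move=> G Gb Gd; rewrite -rE; apply: estimate_oo => //; first exact: powR_ge0.
    by rewrite b0 ltW.
  move=> x y Gx Gy; rewrite -[theta * s](subrK beta).
  have [->|xy] := eqVneq x y.
    by rewrite subrr enorm0 subrK powR0 ?mulr_ge0 ?powR_ge0// gt_eqF// (lt_trans b0).
  rewrite [in leLHS]powRD; last by rewrite enorm_eq0 subr_eq0 (negPf xy) implybT.
  apply: ler_wpM2r; first exact: powR_ge0.
  by rewrite subrK; apply: powR_diam Gd Gx Gy _; exact: ltW.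
have r0 : 0 < r' by move: r1'; rewrite lee_fin; exact: lt_le_trans.
case qE : q q1 => [q'||//] q1'; last first.
  exists (@interpolation_cst R k C s theta beta p r' d); split; first exact: interpolation_cst_gt0.
  move=> G Gb Gd; apply: composition_estimate_of_reduced => // phi phit u D u' rep red.
  apply: (estimate_lipschitz s01 rep (ltW C0) red) => //.
    by apply: lee_fine_inv => //; move: pqr'; rewrite rE qE /= invr0 mulr0 addr0.
  exact: diamD (reduced_sub red) Gd.
have q0 : 0 < q' by move: q1'; rewrite lee_fin; exact: lt_le_trans.
have H : (fine p)^-1 + s / q' <= r'^-1 by move: pqr'; rewrite rE qE.
have P := fine_ge0 p1.
have A : s / q' <= r'^-1 by apply: le_trans H; rewrite lerDr.
(* Equality s/q = 1/r would make t infinite, and it forces p = +oo: the bounded estimate takes over,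
   with M a power of d. *)
move: (A); rewrite le_eqVlt => /predU1P[AE|Alt].
  have qsr : q' = s * r'.
    have -> : s = r'^-1 * q' by rewrite -AE divfK ?gt_eqF.
    by rewrite mulrAC mulVf ?gt_eqF// mul1r.
  exists (C * (2 * (d `^ ((theta * s - beta) * r')) `^ r'^-1)); split.
    by rewrite mulr_gt0// mulr_gt0// powR_gt0// powR_gt0.
  move=> G Gb Gd; rewrite -rE -qE; apply: estimate_p_oo => //; first by rewrite qE qsr.
  - exact: powR_ge0.
  - by move=> x y Gx Gy; apply: powR_diam Gd Gx Gy _; rewrite mulr_ge0// ltW.
pose t := (r'^-1 - s / q')^-1.
have t0 : 0 < t by rewrite invr_gt0 subr_gt0.
exists (@interpolation_cst R k C s theta beta p t d); split; first exact: interpolation_cst_gt0.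
move=> G Gb Gd; apply: composition_estimate_of_reduced => // phi phit u D u' rep red.
apply: (estimate_interpolation s01 rep (ltW C0) red (q' := q')) => //.
- by move: Alt; rewrite ltr_pdivrMr// ltr_pdivlMl// mulrC.
- by rewrite invrK.
- by apply: lee_fine_inv => //; rewrite invrK lerBrDr.
- exact: diamD (reduced_sub red) Gd.
Qed.

(** The leftover power of |x - y| has exponent 0, so M = 1 serves for every domain and no diameter
    enters the constant. *)
Lemma critical_estimate : beta = theta * s ->
  r = +oo%E \/ (r < +oo)%E /\ q = (s%:E * r)%E ->
  exists c : R, 0 < c /\ forall G : set 'rV[R]_k, bounded_domain G ->
    composition_estimate k n s theta beta p q r c G.
Proof.
move=> bts cases; exists (C * (2 * 1)); split; first by apply: mulr_gt0.
have /andP[th0 _] := theta01.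
case: cases => [roo|[rfin qsr]] G Gb.
  apply: estimate_oo => //; first by rewrite bts lexx mulr_gt0.
  by move=> x y _ _; rewrite bts mul1r.
have [r' rr'] : exists r', r = r'%:E by case: r r1 rfin => [r'||//] //; exists r'.
have -> : 2 * 1 = 2 * 1 `^ r'^-1 :> R by rewrite powR1.
apply: estimate_p_oo => //.
- by rewrite qsr rr' EFinM.
- by move=> x y _ _; rewrite bts subrr mul0r powRr0.
Qed.

End composition_theorem.

(** Replacing G by lambda G and u by u(x / lambda) multiplies the ratio of the two sides by lambda
    to the power theta s - beta + k (1/r - 1/p - s/q). This power is positive for beta < theta s,
    which is why the constant there is tied to a bound on the diameter; it is 0 in the critical
    cases. *)
Theorem theorem7p4 (R : realType) (k n : nat) (s theta beta : R)
    (p q r : \bar R) :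
  (1 <= k)%N -> (1 <= n)%N -> 0 < s < 1 ->
  (1 <= p)%E -> (1 <= q)%E -> (1 <= r)%E ->
  (p^-1 + s%:E * q^-1 <= r^-1)%E ->
  0 < theta < 1 ->
  (0 < beta < theta * s ->
    forall diam : R, exists c : R, 0 < c /\
      forall G : set 'rV[R]_k, bounded_domain G ->
        (forall x y, G x -> G y -> enorm (x - y) <= diam) ->
        composition_estimate k n s theta beta p q r c G) /\
  (beta = theta * s ->
    r = +oo%E \/ (r < +oo)%E /\ q = (s%:E * r)%E ->
    exists c : R, 0 < c /\
      forall G : set 'rV[R]_k, bounded_domain G ->
        composition_estimate k n s theta beta p q r c G).
Proof.
move=> k1 n1 s01 p1 q1 r1 pqr theta01; split=> [b diam|b h].
  exact: subcritical_estimate.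
exact: critical_estimate.
Qed.
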